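(* Fix $\vartheta>0$ and let $X^{(\vartheta)}$ be the almost sure limit of $\frac{I_n^{(\vartheta)}-n\log n}{n}$, where $I_n^{(\vartheta)}$ is the internal path length of a Hoppe tree with parameter $\vartheta$ and $n$ nodes. Then the distribution of $X^{(\vartheta)}$ has a Lebesgue density $f_\vartheta$ which belongs to the Schwartz space on $\mathbb{R}$, i.e., $f_\vartheta$ is infinitely differentiable and $f_\vartheta$ together with all its derivatives is rapidly decreasing.
   Context: Hoppe tree with parameter $\vartheta>0$: the tree is grown by successive insertion of nodes, all on one probability space. Initially there is only the root. In each step a parent node is chosen among the existing nodes, independently of the past, with probability proportional to its weight, where the root has weight $\vartheta$ and every other node has weight $1$; a new node is attached as a child of the chosen node. The internal path length is the sum over all nodes of their distances to the root. The limit $X^{(\vartheta)}$ exists almost surely and is non-degenerate; its law is the unique integrable solution of $X^{(\vartheta)} \stackrel{d}{=} (1-B)X^{(\vartheta)}+ B \widetilde{X}^{(1)} + B\log B+(1-B)\log(1-B)+B$ with $X^{(\vartheta)},\widetilde{X}^{(1)},B$ independent, $B\sim$ beta$(1,\vartheta)$, $\widetilde{X}^{(1)}\stackrel{d}{=}X^{(1)}$. *)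

(* Defs.v *)
From HB Require Import structures.
From mathcomp Require Import all_boot all_order all_algebra.
From mathcomp Require Import all_classical all_reals all_analysis.
Set Implicit Arguments. Unset Strict Implicit. Unset Printing Implicit Defensive.
Import Order.TTheory GRing.Theory Num.Theory.
Import numFieldNormedType.Exports.
Local Open Scope classical_set_scope.
Local Open Scope ring_scope.

(* Hoppe tree: nodes are labelled 0,1,2,... in order of insertion, 0 is the
   root.  Node k >= 1 is attached to parent j in {0,...,k-1}; at that time the
   existing nodes are 0..k-1 with total weight theta + (k-1).  The probability
   of choosing parent j is hoppe_weight theta k j. *)
Definition hoppe_weight (R : realType) (theta : R) (k j : nat) : R :=
  if j == 0%N then theta / (theta + k.-1%:R)
  else if (j < k)%N then 1 / (theta + k.-1%:R) else 0.

Definition hoppe_choices (R : realType) (theta : R) d (T : measurableType d)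
    (P : probability T R) (par : nat -> T -> nat) : Prop :=
  (forall k j, measurable [set w | par k w = j]) /\
  (forall (n : nat) (j : nat -> nat),
     P [set w | forall k, (1 <= k <= n)%N -> par k w = j k] =
     (\prod_(1 <= k < n.+1) hoppe_weight theta k (j k))%:E).

(* depth of node k in the tree given by the parent function p (with p k < k
   for k >= 1); fuel-based recursion, fuel k suffices. *)
Fixpoint depth_fuel (p : nat -> nat) (fuel k : nat) : nat :=
  match fuel with
  | 0 => 0
  | f.+1 => if k == 0%N then 0 else (depth_fuel p f (p k)).+1
  end.

Definition depth (p : nat -> nat) (k : nat) : nat := depth_fuel p k k.

Definition ipl (p : nat -> nat) (n : nat) : nat := (\sum_(k < n) depth p k)%N.

Definition schwartz (R : realType) (f : R -> R) : Prop :=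
  (forall (n : nat) (x : R), derivable (derive1n n f) x 1) /\
  (forall n m : nat, exists C : R, forall x : R,
      `|x| ^+ m * `|derive1n n f x| <= C).

(* Main.v *)
(* No fixed-point equation for the limit is used: everything is proved for the
   internal path length I_n of finite trees, uniformly in n, and passes to the
   limit.

   - The first child of the root splits a Hoppe tree into the subtree of that
     child, a recursive tree, and a smaller Hoppe tree.  Hence
     psi_n(tau) = |E exp(i tau I_n)| is bounded by an average of products of two
     psi's with the same tau and with sizes adding up to n.
   - (I_n - E I_n) / (theta + n - 1) is a martingale, so Var I_n >= c n^2; the
     same splitting gives E exp(lambda |I_n - E I_n| / n) <= C by induction.
     Together they give psi_n(tau) <= q < 1 when tau is small and tau n >= A.
   - If psi <= q when tau n >= A, then in the splitting both parts are usually
     of size at least A / tau, so that psi is at most about q^2 for larger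
     tau n; iterating, psi is as small as desired, and then a last induction
     yields psi_n(tau) <= C_p / (tau n)^p for every p.
   - With tau = t / n and n tending to infinity, the characteristic function of
     X decays faster than any power and X has exponential tails.
   - The smoothed distribution functions E atan((x - X) / s) have derivatives
     E s / (s^2 + (x - X)^2), which are Fourier integrals (Poisson kernel); as s
     tends to 0 this gives the density f as a Fourier integral, with bounded
     derivatives of all orders.
   - The tails make the increments of the distribution function rapidly
     decreasing, and a Landau-type interpolation between a function and its
     bounded second derivative transfers this to f and all its derivatives. *)
Require Import Defs.
From HB Require Import structures.
From mathcomp Require Import all_boot all_order all_algebra.
From mathcomp Require Import all_classical all_reals all_analysis.
From mathcomp Require Import measurable_realfun.
From mathcomp Require Import ring lra zify.
From mathcomp.real_closed Require Import complex.
Set Implicit Arguments.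
Unset Strict Implicit.
Unset Printing Implicit Defensive.
Import Order.TTheory GRing.Theory Num.Theory.
Import numFieldNormedType.Exports.
Local Open Scope classical_set_scope.
Local Open Scope ring_scope.

(** * Growth of weighted trees *)

(** Passing to moduli is what makes finite trees tractable: at fixed tau the deterministic toll of a
    split is a mere phase, so the recursion for psi has neither a toll nor a change of argument,
    whereas the fixed-point equation rescales the argument by random factors. The price is that I_n
    is an integer: psi_n is periodic in tau and cannot decay for all tau. Every decay bound is
    therefore restricted to 0 < tau <= tau0, which costs nothing once tau = t / n. The subtree of
    the first child has parameter 1 whatever theta is. The exponential and decay bounds are thus
    proved for parameter 1, where the split is uniform, and then transferred; for theta < 1 a
    subtree of nearly full size has no probability bound of order 1 / n. [growth] lives over an
    arbitrary commutative ring because one recursion serves real moments and complex characteristic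
    functions. It is an unnormalised expectation: dividing by [rising theta m] makes it one. The
    index m always counts insertions, so the tree has m + 1 nodes. *)

Section growth.
Variable A : comNzRingType.
Implicit Types (F G : seq (A * nat) -> A) (L : seq (A * nat)).

(* A tree is represented by the list of the (weight, depth) pairs of its nodes;
   [growth F m L] sums [F] over the results of all the ways to insert [m] nodes
   into [L], weighted by the product of the weights of the chosen parents. *)
Fixpoint growth F m L : A :=
  if m is m'.+1 then \sum_(x <- L) x.1 * growth F m' ((1, x.2.+1) :: L)
  else F L.

Definition pathlen L := (\sum_(x <- L) x.2)%N.

Definition deepen L := [seq (x.1, x.2.+1) | x <- L].

Lemma growth_perm F m L L' : (forall K K', perm_eq K K' -> F K = F K') ->
  perm_eq L L' -> growth F m L = growth F m L'.
Proof.
move=> FP; elim: m L L' => [|m IH] L L' LL' /=; first exact: FP.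
rewrite (perm_big _ LL') /=; apply: eq_bigr => x _.
by congr (_ * _); apply: IH; rewrite perm_cons.
Qed.

Lemma eq_growth F G m L : F =1 G -> growth F m L = growth G m L.
Proof.
move=> FG; elim: m L => [|m IH] L /=; first exact: FG.
by apply: eq_bigr => x _; rewrite IH.
Qed.

Lemma growth_sum (I : Type) (r : seq I) (F : I -> seq (A * nat) -> A)
    (c : I -> A) m L :
  growth (fun K => \sum_(i <- r) c i * F i K) m L =
  \sum_(i <- r) c i * growth (F i) m L.
Proof.
elim: m L => [|m IH] L //=.
under eq_bigr do rewrite IH mulr_sumr.
rewrite exchange_big /=; apply: eq_bigr => i _; rewrite mulr_sumr.
by apply: eq_bigr => x _; rewrite mulrCA.
Qed.

Lemma growthD F G m L :
  growth (fun K => F K + G K) m L = growth F m L + growth G m L.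
Proof.
elim: m L => [|m IH] L //=; rewrite -big_split /=.
by apply: eq_bigr => x _; rewrite IH mulrDr.
Qed.

Lemma growthZ c F m L : growth (fun K => c * F K) m L = c * growth F m L.
Proof.
elim: m L => [|m IH] L //=; rewrite mulr_sumr.
by apply: eq_bigr => x _; rewrite IH mulrCA.
Qed.

(** The definition peels off the first insertion; conditioning on the tree before the last one, as
    the martingale arguments do, needs the other end. *)
Lemma growthSr F m L :
  growth F m.+1 L = growth (fun K => \sum_(x <- K) x.1 * F ((1, x.2.+1) :: K)) m L.
Proof.
elim: m L => [|m IH] L //.
transitivity (\sum_(x <- L) x.1 * growth F m.+1 ((1, x.2.+1) :: L)) => //.
by under eq_bigr do rewrite IH.
Qed.

(* Pascal's rule: each step grows either the first or the second part. *)
Lemma growth_cat F m L1 L2 : (forall K K', perm_eq K K' -> F K = F K') ->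
  growth F m (L1 ++ L2) =
  \sum_(k < m.+1) 'C(m, k)%:R *
    growth (fun K1 => growth (fun K2 => F (K1 ++ K2)) (m - k) L2) k L1.
Proof.
move=> FP; elim: m L1 L2 => [|m IH] L1 L2; first by rewrite big_ord1 /= bin0 mul1r.
pose H j k := growth (fun K1 => growth (fun K2 => F (K1 ++ K2)) j L2) k L1.
have -> : growth F m.+1 (L1 ++ L2) =
   \sum_(k < m.+1) 'C(m, k)%:R * H (m - k)%N k.+1 +
   \sum_(k < m.+1) 'C(m, k)%:R * H (m - k).+1 k.
  transitivity (\sum_(x <- L1 ++ L2) x.1 * growth F m ((1, x.2.+1) :: L1 ++ L2)) => //.
  rewrite big_cat; congr (_ + _).
    under eq_bigr do rewrite -cat_cons IH mulr_sumr.
    rewrite exchange_big /=; apply: eq_bigr => k _; rewrite /H /= mulr_sumr.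
    by apply: eq_bigr => x _; rewrite mulrCA.
  transitivity (\sum_(x <- L2) x.1 * growth F m (L1 ++ ((1, x.2.+1) :: L2))).
    apply: eq_bigr => x _; congr (_ * _); apply: growth_perm => //.
    by rewrite -cat_rcons perm_sym -cats1 -catA perm_catCA.
  under eq_bigr do rewrite IH mulr_sumr.
  rewrite exchange_big /=; apply: eq_bigr => k _.
  transitivity ('C(m, k)%:R * growth (fun K1 => \sum_(x <- L2) x.1 *
      growth (fun K2 => F (K1 ++ K2)) (m - k) ((1, x.2.+1) :: L2)) k L1) => //.
  rewrite growth_sum mulr_sumr.
  by apply: eq_bigr => x _; rewrite mulrCA.
under [RHS]eq_bigr => k _ do rewrite -/(H (m.+1 - k)%N k).
rewrite [RHS]big_ord_recl [X in _ + X]big_ord_recl /=.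
rewrite bin0 subn0 mul1r addrCA; congr (_ + _).
have -> : \sum_(i < m.+1) 'C(m.+1, bump 0 i)%:R * H (m.+1 - bump 0 i)%N (bump 0 i)
  = \sum_(i < m.+1) 'C(m, i)%:R * H (m - i)%N i.+1
    + \sum_(i < m.+1) 'C(m, i.+1)%:R * H (m - i)%N i.+1.
  rewrite -big_split /=; apply: eq_bigr => i _.
  by rewrite /bump leq0n add1n subSS binS natrD mulrDl addrC.
congr (_ + _); rewrite [RHS]big_ord_recr /= bin_small // mul0r addr0.
by apply: eq_bigr => i _; rewrite /bump leq0n add1n subnSK.
Qed.

Lemma eq_growth_size F G n m L :
  (forall K, size K = (n + m)%N -> F K = G K) -> size L = n ->
  growth F m L = growth G m L.
Proof.
elim: m n L => [|m IH] n L FG sL /=; first by apply: FG; rewrite addn0.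
apply: eq_bigr => x _; congr (_ * _).
by apply: (IH n.+1) => [K sK|/=]; [apply: FG; rewrite sK addSnnS|rewrite sL].
Qed.

Lemma growth_deepen F m L :
  growth F m (deepen L) = growth (fun K => F (deepen K)) m L.
Proof.
elim: m L => [|m IH] L //=; rewrite big_map; apply: eq_bigr => x _.
by rewrite -IH.
Qed.

Lemma pathlen_deepen L : pathlen (deepen L) = (pathlen L + size L)%N.
Proof.
rewrite /pathlen big_map -sum1_size -big_split /=.
by apply: eq_bigr => x _; rewrite addn1.
Qed.

Lemma pathlen_cat L1 L2 : pathlen (L1 ++ L2) = (pathlen L1 + pathlen L2)%N.
Proof. by rewrite /pathlen big_cat. Qed.

Lemma pathlen_perm L L' : perm_eq L L' -> pathlen L = pathlen L'.
Proof. exact: perm_big. Qed.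

Definition rising (x : A) m := \prod_(i < m) (x + i%:R).

Lemma risingS x m : rising x m.+1 = rising x m * (x + m%:R).
Proof. by rewrite /rising big_ord_recr. Qed.

Lemma risingSl x m : rising x m.+1 = x * rising (x + 1) m.
Proof.
rewrite /rising big_ord_recl addr0; congr (_ * _).
by apply: eq_bigr => i _; rewrite -addrA -natr1 [_ + 1]addrC.
Qed.

(** Each insertion adds a node of weight 1, so the total weights met along the way are consecutive:
    their product is the normalising constant. *)
Lemma growth1 m L : growth (fun=> 1) m L = rising (\sum_(x <- L) x.1) m.
Proof.
elim: m L => [|m IH] L; first by rewrite /rising big_ord0.
rewrite /= risingSl mulr_suml; apply: eq_bigr => x _.
by rewrite IH big_cons addrC.
Qed.

(** The Chu-Vandermonde identity, read off from [growth_cat] for the constant 1. *)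
Lemma risingD x y m : rising (x + y) m =
  \sum_(k < m.+1) 'C(m, k)%:R * (rising x k * rising y (m - k)).
Proof.
transitivity (growth (fun=> 1) m ([:: (x, 0)] ++ [:: (y, 0)])).
  by rewrite growth1 /= big_cons big_seq1.
rewrite growth_cat//; apply: eq_bigr => k _; congr (_ * _).
transitivity (growth (fun=> rising y (m - k) * 1) k [:: (x, 0)]).
  by apply: eq_growth => K; rewrite growth1 big_seq1 mulr1.
by rewrite growthZ growth1 big_seq1 mulrC.
Qed.

(* The first child of the root splits the tree into its own subtree, which is
   an ordinary recursive tree, and a Hoppe tree. *)
Lemma growth_split F theta m : (forall K K', perm_eq K K' -> F K = F K') ->
  growth F m.+1 [:: (theta, 0)] =
  theta * \sum_(k < m.+1) 'C(m, k)%:R *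
    growth (fun K1 => growth (fun K2 => F (deepen K1 ++ K2)) (m - k)
      [:: (theta, 0)]) k [:: (1, 0)].
Proof.
move=> FP; rewrite [LHS]/= big_seq1; congr (_ * _) => /=.
rewrite -[LHS]/(growth F m ([:: (1, 1)] ++ [:: (theta, 0)])) growth_cat//.
apply: eq_bigr => k _; congr (_ * _).
by rewrite -[[:: (1, 1)]]/(deepen [:: (1, 0)]) growth_deepen.
Qed.

(* For the tree with [m + 1] nodes, up to the normalisation [rising theta m]. *)
Definition pathlen_gf theta z m :=
  growth (fun K => z ^+ pathlen K) m [:: (theta, 0)].

Definition pathlen_sum theta m :=
  growth (fun K => (pathlen K)%:R) m [:: (theta, 0)].

(** Hanging a subtree of k + 1 nodes below the root deepens each of them by 1, whence the factor
    [z ^+ k.+1]. *)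
Lemma pathlen_gfS theta z m : pathlen_gf theta z m.+1 =
  theta * \sum_(k < m.+1) 'C(m, k)%:R *
    (z ^+ k.+1 * (pathlen_gf 1 z k * pathlen_gf theta z (m - k))).
Proof.
rewrite /pathlen_gf growth_split; last by move=> K K' /pathlen_perm ->.
congr (_ * _); apply: eq_bigr => k _; congr (_ * _).
transitivity (growth (fun K => z ^+ k.+1 * (pathlen_gf theta z (m - k) * z ^+ pathlen K))
   k [:: (1, 0)]); last by rewrite !growthZ [X in _ * X]mulrC.
apply: (@eq_growth_size _ _ 1) => // K sK.
rewrite /pathlen_gf mulrA mulrAC -exprD -growthZ.
apply: eq_growth => K2.
by rewrite pathlen_cat pathlen_deepen sK -exprD (addnC (pathlen K)).
Qed.

Lemma pathlen_sumS theta m : pathlen_sum theta m.+1 =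
  theta * \sum_(k < m.+1) 'C(m, k)%:R *
    (k.+1%:R * (rising 1 k * rising theta (m - k)) +
     pathlen_sum 1 k * rising theta (m - k) +
     rising 1 k * pathlen_sum theta (m - k)).
Proof.
rewrite /pathlen_sum growth_split; last by move=> K K' /pathlen_perm ->.
congr (_ * _); apply: eq_bigr => k _; congr (_ * _).
transitivity (growth (fun K =>
    (k.+1%:R * rising theta (m - k) + pathlen_sum theta (m - k)) * 1 +
    rising theta (m - k) * (pathlen K)%:R) k [:: (1, 0)]); last first.
  rewrite growthD !growthZ growth1 big_seq1 /= /pathlen_sum; ring.
apply: (@eq_growth_size _ _ 1) => // K sK.
transitivity (growth (fun K2 => (k.+1%:R + (pathlen K)%:R) * 1 + (pathlen K2)%:R)
   (m - k) [:: (theta, 0)]); last first.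
  rewrite growthD growthZ growth1 big_seq1 /= /pathlen_sum; ring.
apply: eq_growth => K2.
by rewrite pathlen_cat pathlen_deepen sK !natrD -natr1; ring.
Qed.

End growth.

(** * Mean of the path length and lower bound on its variance *)

Section martingale.
Variable R : realFieldType.
Implicit Types (F G : seq (R * nat) -> R) (L K : seq (R * nat)).

(* Only the root, at depth 0, may have a weight different from 1. *)
Definition balanced a L := [/\ all (fun x => 0 <= x.1) L,
  \sum_(x <- L) x.1 = a & \sum_(x <- L) x.1 * x.2%:R = (pathlen L)%:R].

Lemma balanced_cons a n L : balanced a L -> balanced (a + 1) ((1, n) :: L).
Proof.
case=> L0 sL pL; split; first by rewrite /= ler01.
- by rewrite big_cons sL addrC.
- by rewrite big_cons pL /pathlen big_cons natrD mul1r.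
Qed.

Lemma balanced_root theta : 0 <= theta -> balanced theta [:: (theta, 0)].
Proof. by move=> t0; split; rewrite /= ?t0 ?/pathlen ?big_seq1 ?mulr0. Qed.

(** Comparing only on balanced states, whose total weight is known, allows one-step identities such
    as [step_pathlen] to be used under [growth]. *)
Lemma ler_growth F G a m L : (forall K, balanced (a + m%:R) K -> F K <= G K) ->
  balanced a L -> growth F m L <= growth G m L.
Proof.
elim: m a L => [|m IH] a L FG bL /=; first by apply: FG; rewrite addr0.
rewrite big_seq [leRHS]big_seq; apply: ler_sum => x xL; apply: ler_wpM2l.
  by case: bL => /allP/(_ _ xL).
apply: (IH (a + 1)); last exact: balanced_cons.
by move=> K; rewrite -addrA nat1r; exact: FG.
Qed.

Lemma eq_growth_balanced F G a m L :
  (forall K, balanced (a + m%:R) K -> F K = G K) ->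
  balanced a L -> growth F m L = growth G m L.
Proof.
move=> FG bL; apply/eqP; rewrite eq_le.
by apply/andP; split; apply: ler_growth bL => K /FG ->.
Qed.

(** The mean depth of the next parent is the path length divided by the total weight, because the
    only node of special weight has depth 0. *)
Lemma step_pathlen a L : balanced a L ->
  \sum_(x <- L) x.1 * (pathlen ((1 : R, x.2.+1) :: L))%:R =
  (a + 1) * (pathlen L)%:R + a.
Proof.
case=> _ sL pL.
transitivity (\sum_(x <- L) (x.1 * ((pathlen L)%:R + 1) + x.1 * x.2%:R)).
  apply: eq_bigr => x _; rewrite /pathlen big_cons /= natrD -natr1; ring.
rewrite big_split /= -mulr_suml sL pL; ring.
Qed.

Lemma rising_gt0 (theta : R) m : 0 < theta -> 0 < rising theta m.
Proof. by move=> t0; apply: prodr_gt0 => i _; rewrite ltr_wpDr. Qed.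

Lemma rising1 m : rising (1 : R) m = m`!%:R.
Proof.
elim: m => [|m IH]; first by rewrite /rising big_ord0.
by rewrite risingS IH nat1r factS natrM mulrC.
Qed.

(** The expected path length with m + 1 nodes: divided by theta + m, its recursion telescopes to a
    harmonic sum. *)
Definition mean (theta : R) m :=
  (theta + m%:R) * \sum_(i < m) (theta + i.+1%:R)^-1.

Lemma mean0 theta : mean theta 0 = 0.
Proof. by rewrite /mean big_ord0 mulr0. Qed.

Lemma meanS theta m : 0 < theta ->
  mean theta m.+1 * (theta + m%:R) =
  (theta + m.+1%:R) * mean theta m + (theta + m%:R).
Proof.
move=> t0; rewrite /mean big_ord_recr /=; field.
by rewrite nat1r gt_eqF // ltr_wpDr.
Qed.

Lemma pathlen_sumE (theta : R) m : 0 < theta ->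
  pathlen_sum theta m = rising theta m * mean theta m.
Proof.
move=> t0; elim: m => [|m IH].
  by rewrite /pathlen_sum /= /pathlen big_seq1 mean0 mulr0.
rewrite risingS -mulrA [_ * mean _ _]mulrC meanS // mulrDr [X in X + _]mulrCA -IH.
rewrite /pathlen_sum growthSr.
rewrite -[rising theta m * _](_ : growth (fun=> (theta + m%:R) * 1) m [:: (theta, 0)] = _).
  rewrite -growthZ -growthD.
  apply: (@eq_growth_balanced _ _ theta); last exact/balanced_root/ltW.
  move=> K /step_pathlen ->; rewrite -natr1; ring.
by rewrite growthZ growth1 big_seq1 mulrC.
Qed.

Definition pathlen_var theta m :=
  growth (fun K => ((pathlen K)%:R - mean theta m) ^+ 2) m [:: (theta, 0)].

(* Jensen for the martingale (I_n - E I_n) / (theta + n - 1). *)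
Lemma pathlen_varS theta m : 0 < theta ->
  (theta + m.+1%:R) ^+ 2 / (theta + m%:R) * pathlen_var theta m <=
  pathlen_var theta m.+1.
Proof.
move=> t0; set a := theta + m%:R.
have a0 : 0 < a by rewrite /a ltr_wpDr.
have am : theta + m.+1%:R = a + 1 by rewrite /a -natr1 addrA.
rewrite /pathlen_var growthSr -growthZ.
apply: (@ler_growth _ _ theta); last exact/balanced_root/ltW.
move=> K; rewrite -/a am => bK.
have mS : mean theta m.+1 = (a + 1) / a * mean theta m + 1.
  apply: (mulIf (lt0r_neq0 a0)); rewrite meanS // -/a am; field; exact: lt0r_neq0.
set c := mean theta m; set s := (pathlen K)%:R.
(* [mu] is the conditional mean of the next deviation. Jensen's inequality becomes the tangent bound
   y ^+ 2 >= 2 * mu * y - mu ^+ 2, summed over the possible parents. *)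
pose mu := (a + 1) / a * (s - c).
have -> : (a + 1) ^+ 2 / a * (s - c) ^+ 2 =
  \sum_(x <- K) (2 * mu * (x.1 * (pathlen ((1 : R, x.2.+1) :: K))%:R) -
    x.1 * (2 * mu * mean theta m.+1 + mu ^+ 2)).
  rewrite big_split /= -mulr_sumr sumrN -mulr_suml (step_pathlen bK) -/s.
  case: bK => _ -> _; rewrite mS -/c /mu; field; exact: lt0r_neq0.
rewrite big_seq [leRHS]big_seq; apply: ler_sum => x xK.
rewrite -subr_ge0; set p := (pathlen _)%:R.
rewrite (_ : _ - _ = x.1 * (p - mean theta m.+1 - mu) ^+ 2); last by ring.
by apply: mulr_ge0; [case: bK => /allP/(_ _ xK)|exact: sqr_ge0].
Qed.

(** With three nodes the path length is 2 or 3, each with probability 1/2, so the variance is 1/4 =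
    3 ^+ 2 / 36. Smaller trees are deterministic, and the martingale step preserves the bound on
    variance over squared size. *)
Lemma pathlen_var1_ge m : (2 <= m)%N ->
  rising (1 : R) m * (m.+1%:R ^+ 2 / 36) <= pathlen_var 1 m.
Proof.
elim: m => // m IH; rewrite leq_eqVlt => /predU1P[<-|m2].
  rewrite /pathlen_var /mean /rising /= !(big_cons, big_nil, big_ord_recr, big_ord0) /=.
  rewrite /pathlen !(big_cons, big_nil) /=.
  rewrite (_ : 0 + _ + _ = 5 / 6 :> R); last by field.
  rewrite -[(0.+2 + _)%N]/3%N -[(0.+1 + _)%N]/2%N; lra.
apply: le_trans (pathlen_varS m ltr01); rewrite !nat1r risingS nat1r.
have m0 : 0 < m.+1%:R :> R by [].
apply: le_trans (ler_wpM2l _ (IH _)) => //.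
rewrite le_eqVlt; apply/orP; left; apply/eqP; field; by rewrite nat1r gt_eqF.
Qed.

End martingale.

(** * Splitting at the first child of the root *)

Section split.
Variable R : realFieldType.
Implicit Types (theta : R).

(* Probability that the subtree of the first child of the root has k + 1 of
   the m + 2 nodes. *)
Definition split_prob theta m k :=
  theta * 'C(m, k)%:R * rising 1 k * rising theta (m - k) / rising theta m.+1.

Lemma split_prob_ge0 theta m k : 0 < theta -> 0 <= split_prob theta m k.
Proof.
move=> t0; apply: divr_ge0; last exact/ltW/rising_gt0.
by rewrite !mulr_ge0 // ltW // rising_gt0.
Qed.

Lemma sum_split_prob theta m : 0 < theta ->
  \sum_(k < m.+1) split_prob theta m k = 1.
Proof.
move=> t0; rewrite -mulr_suml; have r0 := lt0r_neq0 (rising_gt0 m.+1 t0).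
apply: (mulIf r0); rewrite divfK // mul1r risingSl [theta + 1]addrC risingD mulr_sumr.
by apply: eq_bigr => k _; rewrite !mulrA.
Qed.

Lemma mean_split theta m : 0 < theta -> mean theta m.+1 =
  \sum_(k < m.+1) split_prob theta m k *
     (k.+1%:R + mean 1 k + mean theta (m - k)).
Proof.
move=> t0; have r0 := lt0r_neq0 (rising_gt0 m.+1 t0).
apply: (mulfI r0); rewrite -pathlen_sumE // pathlen_sumS !mulr_sumr.
apply: eq_bigr => k _; rewrite !pathlen_sumE // /split_prob; field.
exact: r0.
Qed.

(** The two factors are absorbed by the rising factorials, whose parameters become 2 and theta + 1;
    the sum is again a Chu-Vandermonde sum. *)
Lemma split_size theta m : 0 < theta ->
  \sum_(k < m.+1) split_prob theta m k * (k.+1%:R * (theta + (m - k)%:R)) =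
  theta * (theta + m.+1%:R) * (theta + m.+2%:R) / ((theta + 1) * (theta + 2)).
Proof.
move=> t0; have r0 := lt0r_neq0 (rising_gt0 m.+1 t0).
have e : rising theta m.+1 * (theta + m.+1%:R) * (theta + m.+2%:R) =
    theta * (theta + 1) * (theta + 2) * rising (2 + (theta + 1)) m.
  rewrite -!risingS !risingSl !mulrA -!(addrA theta) (_ : 2 + (theta + 1) = theta + (1 + 1 + 1)); last ring.
  by rewrite -natr1.
transitivity (theta * theta * rising (2 + (theta + 1)) m / rising theta m.+1).
  rewrite risingD mulr_sumr mulr_suml; apply: eq_bigr => k _.
  have -> : rising (2 : R) k = rising 1 k * k.+1%:R.
    by rewrite -[2]/(1 + 1) -[LHS]mul1r -risingSl risingS nat1r.
  have -> : theta * theta * ('C(m, k)%:R * (rising 1 k * k.+1%:R * rising (theta + 1) (m - k))) =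
    theta * 'C(m, k)%:R * rising 1 k * k.+1%:R * (theta * rising (theta + 1) (m - k)) by ring.
  rewrite -risingSl risingS /split_prob; field; exact: r0.
apply: (mulIf r0); rewrite divfK //.
transitivity (theta * (rising theta m.+1 * (theta + m.+1%:R) * (theta + m.+2%:R)) /
  ((theta + 1) * (theta + 2))); last by field; lra.
rewrite e; field; lra.
Qed.

(** This gain of order n ^+ 2 pays for the toll in [mgf_step]. It follows from [split_size] by theta
    + j <= (theta + 1) * (j + 1). *)
Lemma split_product_ge theta m : 0 < theta ->
  theta / (2 * (theta + 1) ^+ 2 * (theta + 2)) * m.+2%:R ^+ 2 <=
  \sum_(k < m.+1) split_prob theta m k * (k.+1%:R * (m - k).+1%:R).
Proof.
move=> t0; rewrite -(@ler_pM2l _ (theta + 1)); last by lra.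
apply: (@le_trans _ _ (\sum_(k < m.+1) split_prob theta m k * (k.+1%:R * (theta + (m - k)%:R)))).
  rewrite split_size // [leLHS](_ : _ = theta / ((theta + 1) * (theta + 2)) * (m.+2%:R ^+ 2 / 2)); last by field; lra.
  rewrite [leRHS](_ : _ = theta / ((theta + 1) * (theta + 2)) * ((theta + m.+1%:R) * (theta + m.+2%:R))); last by field; lra.
  apply: ler_wpM2l; first by rewrite divr_ge0 ?mulr_ge0 //; lra.
  rewrite -[m.+2]addn2 -[m.+1]addn1 !natrD.
  have := ler0n R m; move: (m%:R) => x x0; nra.
rewrite mulr_sumr; apply: ler_sum => k _; rewrite [leRHS]mulrCA.
apply: ler_wpM2l; first exact: split_prob_ge0.
rewrite [leRHS]mulrCA; apply: ler_wpM2l => //.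
rewrite -natr1; have := ler0n R (m - k); move: (_%:R) => x x0; nra.
Qed.

(** The restriction to the lower half is essential: the limiting law of the relative subtree size is
    beta(1, theta), whose density is unbounded near 1 when theta < 1. *)
Lemma split_prob_le theta m k : 0 < theta -> (k.*2 <= m)%N ->
  split_prob theta m k <= (2 * theta + 4) / m.+2%:R.
Proof.
move=> t0 km; have k_le_m : (k <= m)%N by lia.
(* For theta < 1 the sequence [a] decreases, but j * a j is nondecreasing for every theta > 0; this
   gives a (m - k) / a m <= m / (m - k) <= 2. *)
pose a j := rising theta j / j`!%:R.
have f0 j : j`!%:R != 0 :> R by rewrite pnatr_eq0 -lt0n fact_gt0.
have aS j : j.+1%:R * a j.+1 = (theta + j%:R) * a j.
  rewrite /a risingS factS natrM; field; by rewrite f0 nat1r pnatr_eq0.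
have a0 j : 0 < a j by rewrite divr_gt0 ?rising_gt0 ?ltr0n ?fact_gt0.
have aP : {homo (fun j => j%:R * a j) : i j / (i <= j)%N >-> i <= j}.
  apply: homo_leq => // [i j l|i]; first exact: le_trans.
  by rewrite aS ler_pM2r // lerDr ltW.
have tm : 0 < theta + m%:R by rewrite ltr_wpDr.
have -> : split_prob theta m k = theta / (theta + m%:R) * (a (m - k)%N / a m).
  have := bin_fact k_le_m => /(congr1 (fun n => n%:R : R)); rewrite !natrM => bf.
  rewrite /split_prob /a rising1 risingS -bf.
  have := f0 k; have := f0 (m - k)%N; have : 'C(m, k)%:R != 0 :> R by rewrite pnatr_eq0 -lt0n bin_gt0.
  have := lt0r_neq0 (rising_gt0 m t0); have := lt0r_neq0 tm; move=> h1 h2 h3 h4 h5.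
  by field; rewrite h1 h2 h3 h4 h5.
apply: (@le_trans _ _ (theta / (theta + m%:R) * 2)).
  apply: ler_wpM2l; first by rewrite divr_ge0 // ltW.
  rewrite ler_pdivrMr //.
  have [m0|m0] := posnP m.
    by rewrite m0 sub0n ler_peMl // ?ler1n // ltW.
  have mk0 : 0 < (m - k)%:R :> R by rewrite ltr0n; lia.
  rewrite -(ler_pM2l mk0); apply: le_trans (aP _ _ (leq_subr k m)) _.
  rewrite [leRHS]mulrA ler_pM2r // -natrM ler_nat; lia.
rewrite ler_pdivlMr // [leLHS](_ : _ = theta * 2 * m.+2%:R / (theta + m%:R)); last by ring.
rewrite ler_pdivrMr //.
rewrite -[m.+2]addn2 natrD; have := ler0n R m; move: (m%:R) => x x0; nra.
Qed.

Lemma split_prob1 m k : (k <= m)%N -> split_prob 1 m k = m.+1%:R^-1.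
Proof.
move=> km; rewrite /split_prob !rising1 mul1r -!natrM -mulnA bin_fact // factS natrM.
by rewrite invfM mulrCA divff ?mulr1 // pnatr_eq0 -lt0n fact_gt0.
Qed.

(** Conditional minus unconditional mean of the path length, given that the subtree of the first
    child has k + 1 nodes. *)
Definition toll theta m k :=
  k.+1%:R + mean 1 k + mean theta (m - k) - mean theta m.+1.

Lemma sum_toll theta m : 0 < theta ->
  \sum_(k < m.+1) split_prob theta m k * toll theta m k = 0.
Proof.
move=> t0; under eq_bigr do rewrite mulrBr.
by rewrite big_split /= sumrN -mulr_suml sum_split_prob // mul1r -mean_split // subrr.
Qed.

Definition harm theta m := \sum_(i < m) (theta + i.+1%:R)^-1.

Lemma harm_sub theta i j : 0 < theta -> (i <= j)%N ->
  harm theta i <= harm theta j /\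
  (theta + i.+1%:R) * (harm theta j - harm theta i) <= (j - i)%:R.
Proof.
move=> t0; elim: j => [|j IH]; first by rewrite leqn0 => /eqP ->; rewrite subrr mulr0.
rewrite leq_eqVlt => /predU1P[->|]; first by rewrite subrr mulr0.
rewrite ltnS => ij; have [h1 h2] := IH ij.
have -> : harm theta j.+1 = harm theta j + (theta + j.+1%:R)^-1.
  by rewrite /harm big_ord_recr.
have p : 0 < theta + j.+1%:R by rewrite ltr_wpDr.
split; first by rewrite (le_trans h1) // lerDl invr_ge0 ltW.
rewrite subSn // -[leRHS]natr1 [_ + _ - _]addrAC mulrDr lerD // ler_pdivrMr // mul1r lerD2l ler_nat; lia.
Qed.

Lemma harm_dist theta k : 0 < theta -> `|harm 1 k - harm theta k| <= `|theta - 1|.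
Proof.
move=> t0; rewrite /harm -sumrB.
apply: le_trans (ler_norm_sum _ _ _) _.
(* The majorant telescopes to at most 1. *)
apply: (@le_trans _ _ (\sum_(i < k) `|theta - 1| * (i.+1%:R^-1 - i.+2%:R^-1))).
  apply: ler_sum => i _; rewrite nat1r.
  have i1 : i.+2%:R = i.+1%:R + 1 :> R by rewrite natr1.
  have i0 : 0 < i.+1%:R :> R by [].
  rewrite i1; move: (i.+1%:R) i0 => x x0.
  rewrite (_ : (x + 1)^-1 - (theta + x)^-1 = (theta - 1) / ((x + 1) * (theta + x))); last by field; lra.
  rewrite (_ : x^-1 - (x + 1)^-1 = (x * (x + 1))^-1); last by field; lra.
  have q1 : 0 < (x + 1) * (theta + x) by apply: mulr_gt0; lra.
  have q2 : 0 < x * (x + 1) by apply: mulr_gt0; lra.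
  rewrite normrM ler_wpM2l // normfV (ger0_norm (ltW q1)) lef_pV2 //.
  by rewrite mulrC ler_pM2l; lra.
rewrite -mulr_sumr ler_piMr //.
elim: k => [|k IH]; first by rewrite big_ord0.
have -> : \sum_(i < k.+1) (i.+1%:R^-1 - i.+2%:R^-1) = 1 - k.+2%:R^-1 :> R.
  by elim: k.+1 => [|j IHj]; rewrite ?big_ord0 ?invr1 ?subrr// big_ord_recr /= IHj; ring.
by rewrite gerBl invr_ge0.
Qed.

(** Each mean is of order n log n. The logarithms cancel because the factors 1 + k and theta + (m -
    k) add up to theta + m.+1; what remains are differences of harmonic sums, each contributing
    order n. *)
Lemma toll_le theta m k : 0 < theta -> (k <= m)%N ->
  `|toll theta m k| <= (3 + `|theta - 1|) * m.+2%:R.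
Proof.
move=> t0 km; have e1 : (k.+1 + (m.+1 - k))%N = m.+2 by lia.
have e2 : k.+1%:R + (m.+1 - k)%:R = m.+2%:R :> R by rewrite -natrD e1.
rewrite /toll /mean -!/(harm _ _).
have -> : k.+1%:R + (1 + k%:R) * harm 1 k + (theta + (m - k)%:R) * harm theta (m - k) -
    (theta + m.+1%:R) * harm theta m.+1 =
  k.+1%:R - (theta + (m - k)%:R) * (harm theta m.+1 - harm theta (m - k)) +
  (1 + k%:R) * (harm 1 k - harm theta k) - (1 + k%:R) * (harm theta m.+1 - harm theta k).
  rewrite (_ : m.+1%:R = (m - k)%:R + 1 + k%:R); last by rewrite natr1 -natrD; congr _%:R; lia.
  ring.
have [h1 h2] := harm_sub t0 (leqW (leq_subr k m)).
have [h3 h4] := harm_sub t0 (leqW km).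
have h5 := harm_dist k t0.
rewrite (_ : (m.+1 - (m - k))%N = k.+1) in h2; last by lia.
have k0 : 0 < k.+1%:R :> R by [].
set x := harm theta m.+1 - harm theta (m - k) in h2 *.
set y := harm theta m.+1 - harm theta k in h4 *.
have x0 : 0 <= x by rewrite subr_ge0.
have y0 : 0 <= y by rewrite subr_ge0.
rewrite nat1r; set z := harm 1 k - _ in h5 *.
have tx : 0 <= (theta + (m - k)%:R) * x <= k.+1%:R.
  apply/andP; split; first by apply: mulr_ge0 => //; rewrite addr_ge0 // ltW.
  apply: le_trans h2.
  by rewrite ler_wpM2r // lerD2l ler_nat.
have ty : 0 <= k.+1%:R * y <= (m.+1 - k)%:R.
  apply/andP; split; first by rewrite mulr_ge0.
  apply: le_trans h4.
  by rewrite ler_wpM2r // lerDr ltW.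
have tz : `|k.+1%:R * z| <= k.+1%:R * `|theta - 1|.
  by rewrite normrM ger0_norm // ler_wpM2l.
rewrite -e2.
move: tx ty tz; set X := (_ * x); set Y := (_ * y); set Z := (_ * z).
set v := (m.+1 - k)%:R; set w := k.+1%:R in k0 *; set t := `|theta - 1|.
have t1 : 0 <= t by exact: normr_ge0.
have v0 : 0 <= v by exact: ler0n.
rewrite (_ : (3 + t) * (w + v) = 3 * w + 3 * v + w * t + v * t); last by ring.
have : 0 <= v * t by exact: mulr_ge0.
move: (w * t) (v * t) => wt vt vt0 /andP[? ?] /andP[? ?]; rewrite !ler_norml => /andP[? ?].
by apply/andP; split; lra.
Qed.

End split.

(** * Decay of submultiplicative sequences *)

Section decay.
Variable R : realFieldType.
Implicit Types (theta tau A q : R).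

Lemma count_small tau A N : 0 < tau -> 0 <= A ->
  \sum_(k < N) (tau * k.+1%:R < A)%R%:R <= A / tau.
Proof.
move=> t0 A0.
suff: \sum_(k < N) (tau * k.+1%:R < A)%R%:R <= A / tau /\
      \sum_(k < N) (tau * k.+1%:R < A)%R%:R <= N%:R :> R by case.
elim: N => [|N [IH1 IH2]]; first by rewrite big_ord0 divr_ge0 // ltW.
rewrite big_ord_recr /= -natr1; case: ltP => h /=; last first.
  by rewrite addr0; split=> //; rewrite (le_trans IH2) // lerDl.
split; last by rewrite lerD2r.
apply: (@le_trans _ _ (N%:R + 1)); first by rewrite lerD2r.
by rewrite ler_pdivlMr // mulrC ltW.
Qed.

Lemma count_small_rev tau A m : 0 < tau -> 0 <= A ->
  \sum_(k < m.+1) (tau * (m - k).+1%:R < A)%R%:R <= A / tau.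
Proof.
move=> t0 A0; rewrite (reindex_inj rev_ord_inj) /=.
apply: le_trans (count_small m.+1 t0 A0).
by apply: ler_sum => k _; rewrite subSS subKn // -ltnS.
Qed.

Lemma half_le m k : (k <= m)%N ->
  ((m.+2 <= k.+1.*2) || (m.+2 <= (m - k).+1.*2))%N.
Proof. by lia. Qed.

(** All that the decay argument keeps of the characteristic functions: [psi1] stands for the
    recursive tree, [psi] for the Hoppe tree, at one common tau. *)
Definition splittable theta (psi1 psi : nat -> R) :=
  [/\ forall m, 0 <= psi m, forall m, psi m <= 1 &
   forall m, psi m.+1 <=
     \sum_(k < m.+1) split_prob theta m k * (psi1 k * psi (m - k)%N)].

(** Beyond the window, one of the two parts keeps at least half of the size, hence stays above A /
    tau and is bounded by q by induction; the other is bounded by 1. *)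
Lemma splittable_persist psi tau A q : splittable 1 psi psi -> 0 < tau -> tau <= 4 * A ->
  (forall m, A <= tau * m.+1%:R <= 4 * A -> psi m <= q) ->
  forall m, A <= tau * m.+1%:R -> psi m <= q.
Proof.
move=> [psi0 psi_le1 psiS] t0 tA psiq; elim/ltn_ind => m IH Am.
have [mA|mA] := leP (tau * m.+1%:R) (4 * A); first by apply: psiq; rewrite Am.
case: m IH Am mA => [|m] IH Am mA.
  by move: mA; rewrite mulr1 ltNge tA.
apply: le_trans (psiS m) _.
apply: (@le_trans _ _ (\sum_(k < m.+1) split_prob 1 m k * q)); last first.
  by rewrite -mulr_suml sum_split_prob // mul1r.
apply: ler_sum => k _; apply: ler_wpM2l; first exact: split_prob_ge0.
have km : (k <= m)%N by rewrite -ltnS.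
have [h|h] := orP (half_le km).
  have ->: q = q * 1 by rewrite mulr1.
  apply: ler_pM => //; apply: IH => //; rewrite ?ltnS //.
  move: h; rewrite -(ler_nat R) -muln2 natrM => /(ler_wpM2l (ltW t0)).
  rewrite mulrA; move: (tau * _) (tau * _) mA Am => x y; lra.
have ->: q = 1 * q by rewrite mul1r.
apply: ler_pM => //; apply: IH => //; rewrite ?ltnS ?leq_subr //.
move: h; rewrite -(ler_nat R) -muln2 natrM => /(ler_wpM2l (ltW t0)).
rewrite mulrA; move: (tau * _) (tau * _) mA Am => x y; lra.
Qed.

Lemma split_pair tau A m (k : 'I_m.+1) : 0 < tau -> 2 * A <= tau * m.+2%:R ->
  A <= tau * k.+1%:R \/ A <= tau * (m - k).+1%:R.
Proof.
move=> t0 mA; have km : (k <= m)%N by rewrite -ltnS.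
have e : tau * m.+2%:R = tau * k.+1%:R + tau * (m - k).+1%:R.
  by rewrite -mulrDr -natrD; congr (_ * _%:R); lia.
have [|h] := leP A (tau * k.+1%:R); [by left|right].
by move: (tau * _) (tau * _) (tau * _) h e mA => x y z; lra.
Qed.

(** The product of the two parts is at most q ^+ 2 unless one of them is below A / tau, and then it
    is still at most q, since both cannot be that small. Under the uniform split the exceptional
    sizes have probability at most (1 - r) / 2. Separating r from q keeps the contraction factor
    fixed when the lemma is iterated with ever smaller q. *)
Lemma splittable_improve psi tau A q r : splittable 1 psi psi -> 0 < tau ->
  tau <= A -> 0 <= q -> q <= r -> r < 1 ->
  (forall m, A <= tau * m.+1%:R -> psi m <= q) ->
  forall m, 8 * A / (1 - r) <= tau * m.+1%:R -> psi m <= q * ((1 + r) / 2).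
Proof.
move=> [psi0 psi_le1 psiS] t0 tA q0 qr r1 psiq [|m] mA.
  exfalso; move: mA; rewrite ler_pdivrMr; last lra.
  by rewrite mulr1; nra.
have A0 : 0 < A by exact: lt_le_trans tA.
have r0 : 0 < 1 - r by lra.
have AX : 8 * A <= (1 - r) * (tau * m.+2%:R) by move: mA; rewrite ler_pdivrMr // [leRHS]mulrC.
have AX2 : 2 * A <= tau * m.+2%:R.
  have : 0 <= r * (tau * m.+2%:R) by apply: mulr_ge0; [exact: le_trans qr|apply: mulr_ge0 => //; exact: ltW].
  by move: (tau * _) AX => x; lra.
apply: le_trans (psiS m) _.
pose bad k := (tau * k.+1%:R < A)%R%:R + (tau * (m - k).+1%:R < A)%R%:R : R.
apply: (@le_trans _ _ (\sum_(k < m.+1) m.+1%:R^-1 * (q * (q + bad k)))).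
  apply: ler_sum => k _; rewrite split_prob1; last by rewrite -ltnS.
  apply: ler_wpM2l; first by rewrite invr_ge0.
  have := split_pair k t0 AX2; rewrite /bad.
  have := psi_le1 k; have := psi_le1 (m - k)%N; have := psi0 k; have := psi0 (m - k)%N.
  have := psiq k; have := psiq (m - k)%N.
  case: ltP => h1; case: ltP => h2 /=.
  - by move=> _ _ _ _ _ _ []; rewrite leNgt ?h1 ?h2.
  - move=> /(_ isT) pq _; move: (psi k) (psi _) pq => x y; nra.
  - move=> _ /(_ isT) pq; move: (psi k) (psi _) pq => x y; nra.
  - move=> /(_ isT) pq /(_ isT); move: (psi k) (psi _) pq => x y; nra.
rewrite -mulr_sumr -mulr_sumr big_split /= sumr_const card_ord mulrCA.
apply: ler_wpM2l => //; rewrite ler_pdivrMl // big_split /=.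
have b1 := count_small m.+1 t0 (ltW A0).
have b2 := count_small_rev m t0 (ltW A0).
rewrite -[q *+ _]mulr_natr.
have : A / tau * 8 <= (1 - r) * m.+2%:R.
  by rewrite mulrAC ler_pdivrMr // mulrC (le_trans AX) // mulrAC -mulrA.
have : m.+2%:R = m.+1%:R + 1 :> R by rewrite natr1.
have : 1 <= m.+1%:R :> R by rewrite ler1n.
move: (A / tau) b1 b2 (m.+1%:R : R) (m.+2%:R : R) => a.
move: (\sum_(_ < _) _) (\sum_(_ < _) _) => u v b1 b2 x y x1 -> h; nra.
Qed.

Lemma splittable_small (psi : R -> nat -> R) tau0 A q : 0 < tau0 -> tau0 <= A ->
  0 <= q < 1 ->
  (forall tau, 0 < tau <= tau0 -> splittable 1 (psi tau) (psi tau)) ->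
  (forall tau m, 0 < tau <= tau0 -> A <= tau * m.+1%:R -> psi tau m <= q) ->
  forall N, exists A', 0 < A' /\ forall tau m, 0 < tau <= tau0 ->
    A' <= tau * m.+1%:R -> psi tau m <= q * ((1 + q) / 2) ^+ N.
Proof.
move=> tau00 tauA /andP[q0 q1] psiP psiq N.
(* The invariant tau0 <= A' is carried along because [splittable_improve] asks for tau <= A in every
   round. *)
suff [A' [tA' h]] : exists A', tau0 <= A' /\ forall tau m, 0 < tau <= tau0 ->
    A' <= tau * m.+1%:R -> psi tau m <= q * ((1 + q) / 2) ^+ N.
  by exists A'; split => //; exact: lt_le_trans tA'.
elim: N => [|N [A' [tA' IH]]]; first by exists A; split=> // *; rewrite mulr1; exact: psiq.
exists (8 * A' / (1 - q)); split.
  rewrite ler_pdivlMr; last lra.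
  nra.
move=> tau m t0; rewrite exprSr mulrA; have /andP[t1 t2] := t0.
apply: (@splittable_improve _ tau A') => //; first exact: psiP.
- exact: le_trans tA'.
- by rewrite mulr_ge0 // exprn_ge0 //; lra.
- by rewrite ler_piMr // exprn_ile1 //; lra.
- by move=> l; apply: IH.
Qed.

(** The larger part has at least half of the size, so the induction loses a factor [2 ^+ P]. The
    other part has to win it back, which is why decay of order P presupposes q * 2 ^+ P <= 1/4. The
    remaining room is for the at most 2 * A / tau values of k that leave a part below A / tau. *)
Lemma splittable_decay1 (psi : R -> nat -> R) tau0 A q P : 0 < tau0 -> 0 < A ->
  0 <= q -> q * 2 ^+ P <= 4^-1 ->
  (forall tau, 0 < tau <= tau0 -> splittable 1 (psi tau) (psi tau)) ->
  (forall tau m, 0 < tau <= tau0 -> A <= tau * m.+1%:R -> psi tau m <= q) ->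
  exists C, 0 < C /\ forall tau m, 0 < tau <= tau0 ->
    psi tau m * (tau * m.+1%:R) ^+ P <= C.
Proof.
move=> tau00 A0 q0 qP psiP psiq.
(* Up to [X0] the trivial bound psi <= 1 gives the claim with the constant [X0 ^+ P]; [tau0] in the
   maximum puts the one-node tree into this range. *)
pose X0 := Num.max tau0 (16 * A * 2 ^+ P).
exists (X0 ^+ P).
have X00 : 0 < X0 by rewrite lt_max tau00.
split=> [|tau m tt]; first exact: exprn_gt0.
have [psi0 psi_le1 psiS] := psiP _ tt; have /andP[t0 t1] := tt.
elim/ltn_ind: m => m IH.
have [mX|mX] := leP (tau * m.+1%:R) X0.
  rewrite -[leRHS]mul1r; apply: ler_pM => //.
    by rewrite exprn_ge0 // mulr_ge0 // ltW.
  by rewrite lerXn2r // nnegrE ?mulr_ge0 // ltW.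
case: m IH mX => [|m] IH mX.
  by move: mX; rewrite mulr1 ltNge /X0 le_max t1.
set X := tau * m.+2%:R; have X0' : 0 < X by exact: lt_trans mX.
have XP : 0 < X ^+ P by exact: exprn_gt0.
rewrite -ler_pdivlMr //; apply: le_trans (psiS m) _.
pose bad k := (tau * k.+1%:R < A)%R%:R + (tau * (m - k).+1%:R < A)%R%:R : R.
pose D := X0 ^+ P * 2 ^+ P / X ^+ P.
have D0 : 0 <= D by rewrite !mulr_ge0 ?invr_ge0 ?exprn_ge0 // ltW.
have big l : (l <= m)%N -> (m.+2 <= l.+1.*2)%N -> psi tau l <= D.
  move=> lm ml; rewrite /D ler_pdivlMr //.
  have := IH l; rewrite ltnS => /(_ lm) => h.
  apply: (@le_trans _ _ (psi tau l * (tau * l.+1%:R) ^+ P * 2 ^+ P)).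
    rewrite -mulrA; apply: ler_wpM2l => //; rewrite -exprMn.
    rewrite lerXn2r // ?nnegrE ?mulr_ge0 ?(ltW X0') ?(ltW t0) //.
    by rewrite -mulrA /X ler_pM2l // -natrM ler_nat muln2.
  by apply: ler_wpM2r => //; rewrite exprn_ge0.
have small l : psi tau l <= q + (tau * l.+1%:R < A)%R%:R.
  case: ltP => h /=; last by rewrite addr0; exact: psiq.
  by rewrite (le_trans (psi_le1 l)) // lerDr.
apply: (@le_trans _ _ (\sum_(k < m.+1) m.+1%:R^-1 * (D * (q + bad k)))).
  apply: ler_sum => k _; have km : (k <= m)%N by rewrite -ltnS.
  rewrite split_prob1 //.
  apply: ler_wpM2l; first by rewrite invr_ge0.
  have [h|h] := orP (half_le km).
    apply: ler_pM => //; first by apply: big.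
    by apply: le_trans (small _) _; rewrite lerD2l lerDr.
  rewrite mulrC; apply: ler_pM => //; first by apply: big => //; exact: leq_subr.
  by apply: le_trans (small _) _; rewrite lerD2l lerDl.
rewrite -mulr_sumr -mulr_sumr; set S := (\sum_(_ < _) _).
rewrite [leLHS](_ : _ = X0 ^+ P / X ^+ P * (2 ^+ P * (m.+1%:R^-1 * S))); last by rewrite /D; ring.
rewrite -[leRHS]mulr1; apply: ler_wpM2l; first by rewrite divr_ge0 ?exprn_ge0 // ltW.
rewrite mulrCA ler_pdivrMl // mulr1 /S big_split /= sumr_const card_ord big_split /=.
have b1 := count_small m.+1 t0 (ltW A0).
have b2 := count_small_rev m t0 (ltW A0).
rewrite -[q *+ _]mulr_natr.
have h : 16 * A * 2 ^+ P <= X by rewrite (le_trans _ (ltW mX)) // /X0 le_max lexx orbT.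
have : A / tau * 2 ^+ P * 16 <= m.+2%:R.
  have -> : A / tau * 2 ^+ P * 16 = 16 * A * 2 ^+ P / tau by ring.
  by rewrite ler_pdivrMr // [leRHS]mulrC.
have : m.+2%:R = m.+1%:R + 1 :> R by rewrite natr1.
have : 1 <= m.+1%:R :> R by rewrite ler1n.
have : 0 < 2 ^+ P :> R by exact: exprn_gt0.
move: (A / tau) b1 b2 (m.+1%:R : R) (m.+2%:R : R) (2 ^+ P : R) qP => a.
move: (\sum_(_ < _) _) (\sum_(_ < _) _) => u v b1 b2 x y p qp p0 x1 -> {}h.
have : p * u <= p * a by rewrite ler_pM2l.
have : p * v <= p * a by rewrite ler_pM2l.
have : q * p * x <= 4^-1 * x by apply: ler_wpM2r => //; lra.
rewrite mulrDr mulrDr mulrCA mulrA; lra.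
Qed.

(** If the recursive subtree holds the larger half, its own decay [C1] suffices. Otherwise the
    induction applies to the Hoppe part, and k lies in the range where [split_prob_le] controls the
    probability of small subtrees. *)
Lemma splittable_decay theta (psi1 psi : R -> nat -> R) tau0 A q P C1 :
  0 < theta -> 0 < tau0 -> 0 < A ->
  0 <= q -> q * 2 ^+ P <= 4^-1 -> 0 < C1 ->
  (forall tau m, 0 < tau <= tau0 -> 0 <= psi1 tau m <= 1) ->
  (forall tau, 0 < tau <= tau0 -> splittable theta (psi1 tau) (psi tau)) ->
  (forall tau m, 0 < tau <= tau0 -> A <= tau * m.+1%:R -> psi1 tau m <= q) ->
  (forall tau m, 0 < tau <= tau0 -> psi1 tau m * (tau * m.+1%:R) ^+ P <= C1) ->
  exists C, 0 < C /\ forall tau m, 0 < tau <= tau0 ->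
    psi tau m * (tau * m.+1%:R) ^+ P <= C.
Proof.
move=> th0 tau00 A0 q0 qP C10 psi1b psiP psiq psi1C.
pose c := 2 * theta + 4.
have c0 : 0 < c by rewrite /c; lra.
pose X0 := Num.max tau0 (4 * c * A * 2 ^+ P).
have X00 : 0 < X0 by rewrite lt_max tau00.
(* Beyond [X0], three contributions take at most a quarter of [C] each: the decay [C1], the factor q
   * 2 ^+ P and the small subtrees. *)
pose C := Num.max (X0 ^+ P) (4 * 2 ^+ P * C1).
have C0 : 0 < C by rewrite lt_max exprn_gt0.
exists C; split=> // tau m tt.
have [psi0 psi_le1 psiS] := psiP _ tt; have /andP[t0 t1] := tt.
elim/ltn_ind: m => m IH.
have [mX|mX] := leP (tau * m.+1%:R) X0.
  apply: (@le_trans _ _ (X0 ^+ P)); last by rewrite le_max lexx.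
  rewrite -[leRHS]mul1r; apply: ler_pM => //.
    by rewrite exprn_ge0 // mulr_ge0 // ltW.
  by rewrite lerXn2r // nnegrE ?mulr_ge0 // ltW.
case: m IH mX => [|m] IH mX.
  by move: mX; rewrite mulr1 ltNge /X0 le_max t1.
set X := tau * m.+2%:R; have X0' : 0 < X by exact: lt_trans mX.
have XP : 0 < X ^+ P by exact: exprn_gt0.
rewrite -ler_pdivlMr //; apply: le_trans (psiS m) _.
pose bad k := (tau * k.+1%:R < A)%R%:R : R.
have half l : (m.+2 <= l.+1.*2)%N -> X ^+ P <= (tau * l.+1%:R) ^+ P * 2 ^+ P.
  move=> ml; rewrite -exprMn lerXn2r // ?nnegrE ?mulr_ge0 ?(ltW X0') ?(ltW t0) //.
  by rewrite -mulrA /X ler_pM2l // -natrM ler_nat muln2.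
have small l : psi1 tau l <= q + bad l.
  rewrite /bad; case: ltP => h /=; last by rewrite addr0; exact: psiq.
  have /andP[_ h1] := psi1b tau l tt.
  by rewrite (le_trans h1) // lerDr.
apply: (@le_trans _ _ (\sum_(k < m.+1)
    (split_prob theta m k * (2 ^+ P / X ^+ P * (C1 + C * q)) +
     c / m.+2%:R * (C * 2 ^+ P / X ^+ P * bad k)))).
  apply: ler_sum => k _; have km : (k <= m)%N by rewrite -ltnS.
  have p0 := split_prob_ge0 m k th0.
  have /andP[a1 a2] := psi1b tau k tt.
  have [h|h] := leqP k.*2 m.
    have h' : (m.+2 <= (m - k).+1.*2)%N by clear -h; lia.
    have hp := split_prob_le th0 h.
    have hC : psi tau (m - k)%N <= C * 2 ^+ P / X ^+ P.
      rewrite ler_pdivlMr //.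
      apply: (@le_trans _ _ (psi tau (m - k)%N * (tau * (m - k).+1%:R) ^+ P * 2 ^+ P)).
        by rewrite -mulrA; apply: ler_wpM2l => //; apply: half.
      by apply: ler_wpM2r; [rewrite exprn_ge0|apply: IH; rewrite ltnS leq_subr].
    apply: (@le_trans _ _ (split_prob theta m k * ((q + bad k) * (C * 2 ^+ P / X ^+ P)))).
      by apply: ler_wpM2l => //; apply: ler_pM.
    rewrite [X in _ * X <= _]mulrDl mulrDr; apply: lerD.
      apply: ler_wpM2l => //.
      rewrite [leRHS](_ : _ = q * (C * 2 ^+ P / X ^+ P) + 2 ^+ P / X ^+ P * C1); last by ring.
      by rewrite lerDl mulr_ge0 ?divr_ge0 ?exprn_ge0 // ltW.
    rewrite [bad k * _]mulrC; apply: ler_pM => //.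
    by rewrite mulr_ge0 // divr_ge0 ?mulr_ge0 ?exprn_ge0 // ltW.
  have h' : (m.+2 <= k.+1.*2)%N by clear -h; lia.
  apply: (@le_trans _ _ (split_prob theta m k * (2 ^+ P / X ^+ P * (C1 + C * q)))).
    apply: ler_wpM2l => //; rewrite -[leRHS]mulr1; apply: ler_pM => //.
    apply: (@le_trans _ _ (2 ^+ P / X ^+ P * C1)); last first.
      apply: ler_wpM2l; first by rewrite divr_ge0 ?exprn_ge0 // ltW.
      by rewrite lerDl mulr_ge0 // ltW.
    rewrite mulrAC ler_pdivlMr //.
    apply: (@le_trans _ _ (psi1 tau k * (tau * k.+1%:R) ^+ P * 2 ^+ P)).
      by rewrite -mulrA; apply: ler_wpM2l => //; apply: half.
    by rewrite [leRHS]mulrC; apply: ler_wpM2r; [rewrite exprn_ge0|exact: psi1C].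
  rewrite lerDl !mulr_ge0 ?invr_ge0 ?exprn_ge0 // ltW //.
rewrite big_split /= -mulr_suml sum_split_prob // mul1r -!mulr_sumr.
have b1 := count_small m.+1 t0 (ltW A0).
rewrite ler_pdivlMr // mulrDl.
rewrite [X in X + _](_ : _ = 2 ^+ P * C1 + C * (q * 2 ^+ P)); last by field; rewrite gt_eqF.
rewrite [X in _ + X](_ : _ = C * (c * 2 ^+ P * (\sum_(i < m.+1) bad i) / m.+2%:R)); last first.
  have : m.+2%:R != 0 :> R by rewrite pnatr_eq0.
  by move: (m.+2%:R) => y y0; field; rewrite y0 gt_eqF.
have hC : 4 * 2 ^+ P * C1 <= C by rewrite /C le_max lexx orbT.
have h1 : C * (q * 2 ^+ P) <= C * 4^-1 by rewrite ler_pM2l.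
have h2 : c * 2 ^+ P * (\sum_(i < m.+1) bad i) / m.+2%:R <= 4^-1.
  rewrite ler_pdivrMr //.
  have h : 4 * c * A * 2 ^+ P <= X by rewrite (le_trans _ (ltW mX)) // /X0 le_max lexx orbT.
  apply: (@le_trans _ _ (c * 2 ^+ P * (A / tau))).
    by apply: ler_wpM2l => //; rewrite mulr_ge0 ?exprn_ge0 // ltW.
  rewrite -(@ler_pM2l _ (4 * tau)); last by lra.
  rewrite [leLHS](_ : _ = 4 * c * A * 2 ^+ P); last by field; rewrite gt_eqF.
  by rewrite [leRHS](_ : _ = X) // /X; field.
have h3 : C * (c * 2 ^+ P * (\sum_(i < m.+1) bad i) / m.+2%:R) <= C * 4^-1 by rewrite ler_pM2l.
move: (C * (q * _)) (C * (_ / _)) h1 h3 => a b; lra.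
Qed.

End decay.

Lemma natr_split (A : pzSemiRingType) m k : (k <= m)%N ->
  m.+2%:R = k.+1%:R + (m - k).+1%:R :> A.
Proof. by move=> km; rewrite -natrD addSn addnS subnKC. Qed.

(** * Exponential moments of the internal path length *)

Section mgf.
Variable R : realType.
Implicit Types (theta tau : R).

(** From expR y <= (1 - y)^-1 and (1 + y + 2 * y ^+ 2) * (1 - y) = 1 + y ^+ 2 * (1 - 2 * y). *)
Lemma expR_le_quadratic (y : R) : y <= 2^-1 -> expR y <= 1 + y + 2 * y ^+ 2.
Proof.
move=> y2; have h := expR_ge1Dx (- y).
have e := expRxMexpNx_1 y; have p := expR_gt0 y.
have y1 : 0 < 1 - y by lra.
rewrite -(ler_pM2r y1); apply: (@le_trans _ _ 1); last by nra.
by rewrite -[leRHS]e ler_pM2l.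
Qed.

Definition mgf theta tau m := pathlen_gf theta (expR tau) m / rising theta m.

Lemma mgf_ge0 theta tau m : 0 < theta -> 0 <= mgf theta tau m.
Proof.
move=> t0; apply: divr_ge0; last exact/ltW/rising_gt0.
rewrite /pathlen_gf -[leLHS](mul0r (growth (fun=> 1) m [:: (theta, 0)])) -growthZ.
apply: (@ler_growth _ _ _ theta) => [K _|]; last exact/balanced_root/ltW.
by rewrite mul0r exprn_ge0 // expR_ge0.
Qed.

Lemma mgfS theta tau m : 0 < theta -> mgf theta tau m.+1 =
  \sum_(k < m.+1) split_prob theta m k *
    (expR tau ^+ k.+1 * (mgf 1 tau k * mgf theta tau (m - k))).
Proof.
move=> t0; rewrite /mgf pathlen_gfS mulr_sumr mulr_suml; apply: eq_bigr => k _.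
have r1 := lt0r_neq0 (rising_gt0 m.+1 t0).
have r2 := lt0r_neq0 (rising_gt0 (m - k) t0).
have r3 := lt0r_neq0 (rising_gt0 k (@ltr01 R)).
by rewrite /split_prob; field; rewrite r1 r2 r3.
Qed.

Definition gauss K theta tau m :=
  expR (tau * mean theta m + K * (tau * m.+1%:R) ^+ 2).

(** Since (a + b) ^+ 2 = a ^+ 2 + b ^+ 2 + 2 * a * b, the quadratic exponent of the whole exceeds
    those of the parts by the cross term; the linear exponents differ by the centered toll. *)
Lemma gauss_split K theta tau m k : (k <= m)%N ->
  expR tau ^+ k.+1 * (gauss K 1 tau k * gauss K theta tau (m - k)) =
  gauss K theta tau m.+1 *
    expR (tau * toll theta m k - 2 * K * tau ^+ 2 * (k.+1%:R * (m - k).+1%:R)).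
Proof.
move=> km; rewrite -expRM_natl /gauss -!expRD; congr expR.
by rewrite (natr_split _ km) /toll; ring.
Qed.

(* The gain [k (m - k)] of the quadratic term under splitting dominates the
   variance of the toll. *)
Lemma mgf_step theta tau K L m : 0 < theta -> 0 <= K -> `|tau| * m.+2%:R <= L ->
  4 * (3 + `|theta - 1|) ^+ 2 <=
    K * (theta / (2 * (theta + 1) ^+ 2 * (theta + 2))) ->
  K * L ^+ 2 <= theta / (2 * (theta + 1) ^+ 2 * (theta + 2)) ->
  (3 + `|theta - 1|) * L <= 2^-1 ->
  (forall k, (k <= m)%N -> mgf 1 tau k <= gauss K 1 tau k) ->
  (forall k, (k <= m)%N -> mgf theta tau k <= gauss K theta tau k) ->
  mgf theta tau m.+1 <= gauss K theta tau m.+1.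
Proof.
move=> t0 K0 tL; set c := 3 + _; set kap := theta / _ => cK KL cL h1 h2.
have c0 : 0 <= c by rewrite addr_ge0.
rewrite mgfS //.
pose y k := tau * toll theta m k - 2 * K * tau ^+ 2 * (k.+1%:R * (m - k).+1%:R).
apply: (@le_trans _ _ (\sum_(k < m.+1) split_prob theta m k *
    (gauss K theta tau m.+1 * expR (y k)))).
  apply: ler_sum => k _; apply: ler_wpM2l; first exact: split_prob_ge0.
  have km : (k <= m)%N by rewrite -ltnS.
  rewrite -gauss_split //; apply: ler_wpM2l; first by rewrite exprn_ge0 ?expR_ge0.
  by apply: ler_pM; rewrite ?mgf_ge0 // ?h1 ?h2 ?leq_subr.
under eq_bigr do rewrite mulrCA.
rewrite -mulr_sumr ler_piMr ?expR_ge0 //.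
pose n : R := m.+2%:R; have n0 : 0 < n by [].
have tn : (tau * n) ^+ 2 <= L ^+ 2.
  have : 0 <= `|tau| * n by rewrite mulr_ge0.
  move=> h; rewrite (_ : (tau * n) ^+ 2 = (`|tau| * n) ^+ 2); last first.
    by rewrite !exprMn real_normK ?num_real.
  by rewrite lerXn2r // nnegrE // (le_trans h).
(* The linear toll term averages to 0 and the gain to at least 2 * K * kap * (tau * n) ^+ 2. The
   quadratic term costs at most 4 * c ^+ 2 + K ^+ 2 * L ^+ 2 times (tau * n) ^+ 2, and the
   hypotheses on K and L grant half of the gain to each summand. *)
apply: (@le_trans _ _ (\sum_(k < m.+1) (split_prob theta m k +
    (tau * (split_prob theta m k * toll theta m k) -
     2 * K * tau ^+ 2 * (split_prob theta m k * (k.+1%:R * (m - k).+1%:R)) +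
    split_prob theta m k * ((4 * c ^+ 2 + K ^+ 2 * L ^+ 2) * (tau * n) ^+ 2))))).
  apply: ler_sum => k _; have km : (k <= m)%N by rewrite -ltnS.
  have p0 := split_prob_ge0 m k t0.
  have T := toll_le t0 km; rewrite -/c -/n in T.
  pose w : R := k.+1%:R * (m - k).+1%:R.
  have w0 : 0 <= w by rewrite mulr_ge0.
  have wn : 4 * w <= n ^+ 2.
    rewrite /n (natr_split _ km).
    rewrite /w; move: (k.+1%:R) ((m - k).+1%:R) => a b.
    by rewrite -subr_ge0 (_ : _ - _ = (a - b) ^+ 2) ?sqr_ge0 //; ring.
  have tT : `|tau * toll theta m k| <= c * (`|tau| * n).
    by rewrite normrM mulrCA ler_wpM2l.
  have tT2 : (tau * toll theta m k) ^+ 2 <= c ^+ 2 * (tau * n) ^+ 2.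
    rewrite -[leLHS]real_normK ?num_real // -exprMn -[leRHS]real_normK ?num_real //.
    rewrite lerXn2r // ?nnegrE // (le_trans tT) // !normrM (ger0_norm c0) (gtr0_norm n0).
    by [].
  have yk : expR (y k) <= 1 + y k + 2 * (y k) ^+ 2.
    apply: expR_le_quadratic; rewrite /y -/w.
    have : 0 <= 2 * K * tau ^+ 2 * w.
      by apply: mulr_ge0 => //; rewrite mulr_ge0 ?sqr_ge0 // mulr_ge0.
    have : c * (`|tau| * n) <= c * L by apply: ler_wpM2l.
    have := ler_norm (tau * toll theta m k); lra.
  apply: (@le_trans _ _ (split_prob theta m k * (1 + y k + 2 * (y k) ^+ 2))).
    exact: ler_wpM2l.
  rewrite [leRHS](_ : _ = split_prob theta m k * (1 + y k + (4 * c ^+ 2 + K ^+ 2 * L ^+ 2) * (tau * n) ^+ 2)); last first.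
    by rewrite /y; ring.
  apply: ler_wpM2l => //; rewrite lerD2l.
  pose u := tau * toll theta m k; pose v := 2 * K * tau ^+ 2 * w.
  have -> : y k = u - v by [].
  have v2 : 4 * v ^+ 2 <= K ^+ 2 * L ^+ 2 * (tau * n) ^+ 2.
    apply: (@le_trans _ _ ((K * (tau * n) ^+ 2) ^+ 2)).
      have -> : 4 * v ^+ 2 = (K * tau ^+ 2 * (4 * w)) ^+ 2 by rewrite /v; ring.
      have e1 : K * tau ^+ 2 * (4 * w) <= K * (tau * n) ^+ 2.
        by rewrite exprMn -mulrA ler_wpM2l // ler_wpM2l // sqr_ge0.
      have e0 : 0 <= K * tau ^+ 2 * (4 * w).
        by apply: mulr_ge0; apply: mulr_ge0 => //; exact: sqr_ge0.
      by rewrite lerXn2r // nnegrE // (le_trans e0).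
    rewrite (_ : (K * (tau * n) ^+ 2) ^+ 2 = K ^+ 2 * (tau * n) ^+ 2 * (tau * n) ^+ 2); last by ring.
    by apply: ler_wpM2r; [rewrite sqr_ge0|rewrite ler_wpM2l // sqr_ge0].
  have : 0 <= (u + v) ^+ 2 by exact: sqr_ge0.
  rewrite mulrDl; move: tT2; rewrite -/u; move: v2.
  clear; lra.
rewrite !big_split /= sum_split_prob // -!mulr_sumr sumrN -!mulr_sumr sum_toll // mulr0 add0r.
rewrite -mulr_suml sum_split_prob // mul1r gerDl.
have hk := split_product_ge m t0; rewrite -/kap -/n in hk.
have : K * (kap * n ^+ 2) <= K * (\sum_(k < m.+1) split_prob theta m k * (k.+1%:R * (m - k).+1%:R)).
  by rewrite ler_wpM2l.
set S := \sum_(_ < _) _ => hS.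
have h : (4 * c ^+ 2 + K ^+ 2 * L ^+ 2) * (tau * n) ^+ 2 <= 2 * (K * kap) * (tau * n) ^+ 2.
  apply: ler_wpM2r; first exact: sqr_ge0.
  have : K * (K * L ^+ 2) <= K * kap by rewrite ler_wpM2l.
  by rewrite mulrA -expr2; move: cK; lra.
have : 2 * tau ^+ 2 * (K * (kap * n ^+ 2)) <= 2 * tau ^+ 2 * (K * S).
  by rewrite ler_wpM2l // mulr_ge0 // sqr_ge0.
rewrite exprMn in h *; move: h; clear; lra.
Qed.

Lemma mgf_0 theta tau : mgf theta tau 0 = 1.
Proof.
by rewrite /mgf /pathlen_gf /= /pathlen big_seq1 expr0 /rising big_ord0 divr1.
Qed.

(** The disjunction lets one induction serve twice: for theta = 1 the subtree falls under the
    induction hypothesis, for other theta under the result for 1. *)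
Lemma mgf_bound_step theta K L : 0 < theta -> 0 <= K ->
  4 * (3 + `|theta - 1|) ^+ 2 <=
    K * (theta / (2 * (theta + 1) ^+ 2 * (theta + 2))) ->
  K * L ^+ 2 <= theta / (2 * (theta + 1) ^+ 2 * (theta + 2)) ->
  (3 + `|theta - 1|) * L <= 2^-1 ->
  (theta = 1 \/ forall tau m, `|tau| * m.+1%:R <= L -> mgf 1 tau m <= gauss K 1 tau m) ->
  forall tau m, `|tau| * m.+1%:R <= L -> mgf theta tau m <= gauss K theta tau m.
Proof.
move=> t0 K0 h1 h2 h3 h4 tau; elim/ltn_ind => -[|m] IH mL.
  rewrite mgf_0 /gauss mean0 mulr0 add0r -(expR0 R) ler_expR.
  by rewrite mulr_ge0 // sqr_ge0.
have kL k : (k <= m)%N -> `|tau| * k.+1%:R <= L.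
  move=> km; apply: le_trans mL; rewrite ler_wpM2l // ler_nat.
  exact: leq_trans km _.
apply: (mgf_step (L := L)) => // k km; last by apply: IH => //; exact: kL.
case: h4 => [e|]; last by apply; exact: kL.
by rewrite -[X in mgf X]e -[X in gauss _ X]e; apply: IH => //; exact: kL.
Qed.

Lemma mgf_bound theta : 0 < theta -> exists K L, [/\ 0 <= K, 0 < L &
  forall tau m, `|tau| * m.+1%:R <= L -> mgf theta tau m <= gauss K theta tau m].
Proof.
move=> t0.
pose c x : R := 3 + `|x - 1|; have c0 x : 0 < c x by rewrite /c ltr_wpDr.
pose kap x : R := x / (2 * (x + 1) ^+ 2 * (x + 2)).
have kap0 x : 0 < x -> 0 < kap x.
  by move=> x0; rewrite divr_gt0 // mulr_gt0 ?mulr_gt0 ?exprn_gt0 //; lra.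
(* [K] comes first, large enough for the toll; [L] is then small depending on [K], and at most 1 so
   that L ^+ 2 <= L. *)
pose K := Num.max (4 * c 1 ^+ 2 / kap 1) (4 * c theta ^+ 2 / kap theta).
have K0 : 0 < K.
  by rewrite lt_max divr_gt0 ?kap0 // mulr_gt0 // exprn_gt0.
pose L := Num.min (Num.min ((2 * c 1)^-1) ((2 * c theta)^-1))
  (Num.min 1 (Num.min (kap 1 / K) (kap theta / K))).
have L0 : 0 < L.
  have f x : 0 < (2 * c x)^-1 by rewrite invr_gt0 mulr_gt0.
  have g x : 0 < x -> 0 < kap x / K by move=> x0; rewrite divr_gt0 // kap0.
  by rewrite !lt_min !f ltr01 !g.
have L2 : L ^+ 2 <= L.
  by rewrite expr2 ger_pMl // !ge_min lexx !orbT.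
have cL x : x = 1 \/ x = theta -> c x * L <= 2^-1.
  move=> xE; rewrite -ler_pdivlMl // -invfM [c x * _]mulrC.
  by case: xE => ->; rewrite !ge_min lexx ?orbT.
have KL x : x = 1 \/ x = theta -> K * L ^+ 2 <= kap x.
  move=> xE; apply: (@le_trans _ _ (K * L)); first by rewrite ler_pM2l.
  by rewrite mulrC -ler_pdivlMr //; case: xE => ->; rewrite !ge_min lexx ?orbT.
have cK x : 0 < x -> x = 1 \/ x = theta -> 4 * c x ^+ 2 <= K * kap x.
  move=> x0 xE; rewrite -ler_pdivrMr ?kap0 //.
  by case: xE => ->; rewrite !le_max lexx ?orbT.
exists K, L; split=> //; first exact: ltW.
apply: mgf_bound_step => //; [exact: ltW|by apply: cK => //; right|
  by apply: KL; right|by apply: cL; right|right].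
apply: mgf_bound_step => //; [exact: ltW|by apply: cK => //; left|
  by apply: KL; left|by apply: cL; left|by left].
Qed.

Lemma fourth_moment_expR (y : R) : y ^+ 4 <= 24 * (expR y + expR (- y)).
Proof.
wlog y0 : y / 0 <= y.
  have [y0|/ltW y0] := leP 0 y; first exact.
  move=> /(_ (- y)); rewrite oppr_ge0 opprK => /(_ y0).
  by rewrite (_ : (- y) ^+ 4 = y ^+ 4); [rewrite addrC|ring].
have := expR_ge1Dxn 3 y0; have := expR_ge0 (- y).
rewrite (_ : 4`!%:R = 24 :> R); last by rewrite factE.
lra.
Qed.

End mgf.

(** * Characteristic function of the internal path length *)

Section trigo_bounds.
Variable R : realType.

Lemma ge0_derive_ge0 (f g : R -> R) : f 0 = 0 ->
  (forall x : R, is_derive x (1 : R) f (g x)) -> (forall x, 0 <= x -> 0 <= g x) ->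
  forall x, 0 <= x -> 0 <= f x.
Proof.
move=> f0 fg g0 x; rewrite le_eqVlt => /predU1P[<-|x0]; first by rewrite f0.
have [|c cI] := MVT x0 (fun y _ => fg y).
  apply: continuous_subspaceT => y.
  by apply: differentiable_continuous; apply/derivable1_diffP; case: (fg y).
rewrite f0 !subr0 => ->; apply: mulr_ge0; last exact: ltW.
by apply: g0; move: cI; rewrite in_itv/= => /andP[/ltW].
Qed.

Lemma sin_le_id (x : R) : 0 <= x -> sin x <= x.
Proof.
rewrite -[_ <= x]subr_ge0; apply: (@ge0_derive_ge0 (fun y => y - sin y) (fun y => 1 - cos y)).
- by rewrite sin0 subr0.
- by move=> y _; rewrite subr_ge0 cos_le1.
Qed.

Lemma cos_ge_quadratic (x : R) : 0 <= x -> 1 - x ^+ 2 / 2 <= cos x.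
Proof.
rewrite -[_ <= cos x]subr_ge0.
apply: (@ge0_derive_ge0 (fun y => cos y - (1 - y ^+ 2 / 2)) (fun y => y - sin y)).
- by rewrite cos0 expr0n /= mul0r subr0 subrr.
- move=> y; apply: is_derive_eq; rewrite !scaler0 /GRing.scale /=.
  by field.
- by move=> y y0; rewrite subr_ge0 sin_le_id.
Qed.

Lemma sin_ge_cubic (x : R) : 0 <= x -> x - x ^+ 3 / 6 <= sin x.
Proof.
rewrite -[_ <= sin x]subr_ge0.
apply: (@ge0_derive_ge0 (fun y => sin y - (y - y ^+ 3 / 6)) (fun y => cos y - (1 - y ^+ 2 / 2))).
- by rewrite sin0 expr0n /= mul0r !subr0.
- move=> y; apply: is_derive_eq; rewrite !scaler0 /GRing.scale /=.
  by field.
- by move=> y y0; rewrite subr_ge0 cos_ge_quadratic.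
Qed.

Lemma cos_le_quartic (x : R) : cos x <= 1 - x ^+ 2 / 2 + x ^+ 4 / 24.
Proof.
rewrite -cos_norm -[x ^+ 2]real_normK ?num_real // -[4%N]/(2 * 2)%N exprM -[x ^+ 2]real_normK ?num_real //.
rewrite -exprM; move: `|x| (normr_ge0 x) => {}x.
rewrite -[cos x <= _]subr_ge0.
apply: (@ge0_derive_ge0 (fun y => 1 - y ^+ 2 / 2 + y ^+ 4 / 24 - cos y)
  (fun y => sin y - (y - y ^+ 3 / 6))).
- by rewrite cos0 !expr0n /= !mul0r subr0 addr0 subrr.
- move=> y; apply: is_derive_eq; rewrite !scaler0 /GRing.scale /=.
  by field.
- by move=> y y0; rewrite subr_ge0 sin_ge_cubic.
Qed.

Lemma sin_sub_id (x : R) : `|sin x - x| <= `|x| ^+ 3.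
Proof.
wlog x0 : x / 0 <= x.
  have [x0|/ltW x0] := leP 0 x; first exact.
  move=> /(_ (- x)); rewrite oppr_ge0 sinN normrN -opprD normrN; exact.
rewrite (ger0_norm x0) ler_norml; have := sin_le_id x0; have := sin_ge_cubic x0.
have : 0 <= x ^+ 3 by rewrite exprn_ge0.
by move=> *; apply/andP; split; lra.
Qed.

End trigo_bounds.

Section characteristic_function.
Variable R : realType.
Implicit Types (theta tau : R) (L K : seq (R * nat)).
Local Notation normc := (@ComplexField.Normc.normc R).

Definition cis (t : R) : R[i] := Complex (cos t) (sin t).

Lemma cisD s t : cis (s + t) = cis s * cis t.
Proof. by rewrite /cis cosD sinD [RHS]/GRing.mul /= [sin s * _ + _]addrC. Qed.

Lemma cisX t n : cis t ^+ n = cis (t * n%:R).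
Proof.
elim: n => [|n IH]; first by rewrite expr0 mulr0 /cis cos0 sin0.
by rewrite exprS IH -cisD -natr1 mulrDr mulr1 addrC.
Qed.

Lemma normc_cis t : normc (cis t) = 1.
Proof. by rewrite /cis /= cos2Dsin2 sqrtr1. Qed.

Definition complex_state L : seq (R[i] * nat) := [seq (x.1%:C%C, x.2) | x <- L].

Lemma growth_complex (F G : seq (R * nat) -> R) (H : seq (R[i] * nat) -> R[i]) m L :
  (forall K, H (complex_state K) = Complex (F K) (G K)) ->
  growth H m (complex_state L) = Complex (growth F m L) (growth G m L).
Proof.
move=> HFG; elim: m L => [|m IH] L //=.
have sumC (s : seq (R * nat)) (a b : R * nat -> R) :
    \sum_(x <- s) Complex (a x) (b x) = Complex (\sum_(x <- s) a x) (\sum_(x <- s) b x).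
  by elim: s => [|x s IHs]; rewrite ?big_nil // !big_cons IHs.
rewrite big_map -sumC; apply: eq_bigr => x _ /=.
rewrite -[_ :: _]/(complex_state ((1, x.2.+1) :: L)) IH.
by rewrite [LHS]/GRing.mul /= !mul0r subr0 addr0.
Qed.

Lemma pathlen_complex L : pathlen (complex_state L) = pathlen L.
Proof. by rewrite /pathlen big_map. Qed.

Definition psi theta tau m :=
  normc (pathlen_gf (theta%:C%C) (cis tau) m) / rising theta m.

(** Centering at [b] multiplies by a phase, invisible in the modulus. It is used with the exact mean
    for small tau and with n log n for the limit. *)
Lemma psi_centered theta tau m (b : R) : 0 < theta -> psi theta tau m =
  Num.sqrt
    ((growth (fun K => cos (tau * ((pathlen K)%:R - b))) m [:: (theta, 0)] / rising theta m) ^+ 2 +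
     (growth (fun K => sin (tau * ((pathlen K)%:R - b))) m [:: (theta, 0)] / rising theta m) ^+ 2).
Proof.
move=> t0; have r0 := rising_gt0 m t0.
rewrite !expr_div_n -mulrDl -exprVn sqrtrM ?addr_ge0 ?sqr_ge0 // sqrtr_sqr gtr0_norm ?invr_gt0 //.
congr (_ / _).
rewrite -[LHS]mul1r -[X in X * _ = _](normc_cis (tau * - b)) -ComplexField.Normc.normcM.
rewrite /pathlen_gf -growthZ -[[:: _]]/(complex_state [:: (theta, 0)]).
rewrite (@growth_complex (fun K => cos (tau * ((pathlen K)%:R - b))) (fun K => sin (tau * ((pathlen K)%:R - b)))) //.
by move=> K; rewrite pathlen_complex cisX -cisD addrC -mulrDr.
Qed.

Lemma normc_sum (I : Type) (r : seq I) (f : I -> R[i]) :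
  normc (\sum_(i <- r) f i) <= \sum_(i <- r) normc (f i).
Proof.
elim: r => [|i r IH]; rewrite ?big_nil ?ComplexField.Normc.normc0 // !big_cons.
by apply: le_trans (le_normcD _ _) _; rewrite lerD2l.
Qed.

Lemma normc_real (x : R) : 0 <= x -> normc (x%:C%C) = x.
Proof. by move=> x0; rewrite /= expr0n /= addr0 sqrtr_sqr ger0_norm. Qed.

Lemma psi_ge0 theta tau m : 0 < theta -> 0 <= psi theta tau m.
Proof.
move=> t0; apply: divr_ge0; last exact/ltW/rising_gt0.
by case: (pathlen_gf _ _ _) => a b /=; exact: sqrtr_ge0.
Qed.

Lemma psi0 theta tau : psi theta tau 0 = 1.
Proof.
rewrite /psi /pathlen_gf /= /pathlen big_seq1 expr0 /rising big_ord0 divr1.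
exact: ComplexField.Normc.normc1.
Qed.

(** The toll enters as [cis tau ^+ k.+1] and disappears in the modulus; the triangle inequality does
    the rest. *)
Lemma psiS theta tau m : 0 < theta -> psi theta tau m.+1 <=
  \sum_(k < m.+1) split_prob theta m k * (psi 1 tau k * psi theta tau (m - k)).
Proof.
move=> t0; have r1 := rising_gt0 m.+1 t0.
rewrite {1}/psi pathlen_gfS ComplexField.Normc.normcM (normc_real (ltW t0)).
rewrite ler_pdivrMr //.
apply: le_trans (ler_wpM2l (ltW t0) (normc_sum _ _)) _.
rewrite mulr_sumr mulr_suml; apply: ler_sum => k _.
rewrite !ComplexField.Normc.normcM cisX normc_cis mul1r.
have -> : normc ('C(m, k)%:R) = 'C(m, k)%:R by rewrite -(rmorph_nat (real_complex R)) normc_real.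
have r2 := lt0r_neq0 (rising_gt0 (m - k) t0).
have r3 := lt0r_neq0 (rising_gt0 k (@ltr01 R)).
rewrite le_eqVlt; apply/orP; left; apply/eqP.
rewrite /psi /split_prob (rmorph1 (real_complex R)).
by field; rewrite ?r2 ?r3 ?(lt0r_neq0 r1).
Qed.

Lemma psi_le1 theta tau m : 0 < theta -> psi theta tau m <= 1.
Proof.
have step theta' : 0 < theta' ->
    (forall m, (theta' = 1) \/ psi 1 tau m <= 1) -> forall m, psi theta' tau m <= 1.
  move=> t0 h; elim/ltn_ind => -[|{}m] IH; first by rewrite psi0.
  apply: le_trans (psiS _ _ t0) _; rewrite -[leRHS](sum_split_prob m t0).
  apply: ler_sum => k _; rewrite ler_piMr ?split_prob_ge0 //.
  rewrite -[leRHS]mulr1; apply: ler_pM; rewrite ?psi_ge0 ?IH ?ltnS ?leq_subr //.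
  case: (h k) => [e|h1]; last exact: h1.
  by have := IH k (ltn_ord k); rewrite e.
move=> t0; apply: (step) => // k; right.
by apply: step => // j; left.
Qed.

Lemma psi_splittable theta tau : 0 < theta ->
  splittable theta (psi 1 tau) (psi theta tau).
Proof. by move=> t0; split=> m; [exact: psi_ge0|exact: psi_le1|exact: psiS]. Qed.

Definition ev theta m (F : seq (R * nat) -> R) :=
  growth F m [:: (theta, 0)] / rising theta m.

Lemma evD theta m F G : ev theta m (fun K => F K + G K) = ev theta m F + ev theta m G.
Proof. by rewrite /ev growthD mulrDl. Qed.

Lemma evZ theta m c F : ev theta m (fun K => c * F K) = c * ev theta m F.
Proof. by rewrite /ev growthZ mulrA. Qed.

Lemma ev_cst theta m (c : R) : 0 < theta -> ev theta m (fun=> c) = c.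
Proof.
move=> t0; rewrite -[c in fun=> c]mulr1 evZ /ev growth1 big_seq1 divff ?mulr1 //.
exact/lt0r_neq0/rising_gt0.
Qed.

Lemma le_ev theta m F G : 0 < theta -> (forall K, F K <= G K) ->
  ev theta m F <= ev theta m G.
Proof.
move=> t0 FG; rewrite ler_pM2r ?invr_gt0 ?rising_gt0 //.
by apply: (@ler_growth _ _ _ theta) => //; exact/balanced_root/ltW.
Qed.

Definition dev theta m K : R := ((pathlen K)%:R - mean theta m) / m.+1%:R.

(** This is [mgf_bound] at the ends tau = L / n and tau = - L / n of its range, where the Gaussian
    factor is the constant expR (K * L ^+ 2). *)
Lemma dev_exp_bound theta : 0 < theta -> exists lam C, [/\ 0 < lam, 0 < C &
  forall m, ev theta m (fun K => expR (lam * dev theta m K) +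
    expR (- (lam * dev theta m K))) <= C].
Proof.
move=> t0; have [K [L [K0 L0 h]]] := mgf_bound t0.
exists L, (2 * expR (K * L ^+ 2)); split=> //; first by rewrite mulr_gt0 // expR_gt0.
move=> m; have n0 : 0 < m.+1%:R :> R by [].
have key s : `|s| = L -> ev theta m (fun J => expR (s * dev theta m J)) <= expR (K * L ^+ 2).
  move=> sL.
  have -> : ev theta m (fun J => expR (s * dev theta m J)) =
      expR (- (s / m.+1%:R * mean theta m)) * mgf theta (s / m.+1%:R) m.
    rewrite /mgf /pathlen_gf mulrA -growthZ; congr (_ / _); apply: eq_growth => J.
    by rewrite -expRM_natl -expRD; congr expR; rewrite /dev; field; rewrite nat1r.
  rewrite -(ler_pM2l (expR_gt0 (s / m.+1%:R * mean theta m))) mulrA expRxMexpNx_1 mul1r.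
  rewrite -expRD; apply: le_trans (h _ _ _) _.
    by rewrite normrM normfV (ger0_norm (ltW n0)) divfK ?lt0r_neq0 // sL.
  rewrite /gauss divfK ?lt0r_neq0 // -[s ^+ 2]real_normK ?num_real // sL.
  by [].
rewrite evD mulr2n mulrDl mul1r; apply: lerD; first by apply: key; exact: gtr0_norm.
apply: le_trans (key (- L) _); last by rewrite normrN gtr0_norm.
by apply: le_ev => // J; rewrite mulNr.
Qed.

Lemma dev_fourth theta : 0 < theta -> exists M, 0 < M /\
  forall m, ev theta m (fun K => dev theta m K ^+ 4) <= M.
Proof.
move=> t0; have [l [C [l0 C0 h]]] := dev_exp_bound t0.
exists (24 * C / l ^+ 4); split; first by rewrite divr_gt0 ?exprn_gt0 // mulr_gt0.
move=> m; rewrite ler_pdivlMr ?exprn_gt0 // mulrC -evZ.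
apply: (@le_trans _ _ (24 * ev theta m (fun K => expR (l * dev theta m K) +
    expR (- (l * dev theta m K))))); last by rewrite ler_pM2l.
rewrite -evZ; apply: le_ev => // K; rewrite -exprMn; exact: fourth_moment_expR.
Qed.

Lemma dev1_var m : (2 <= m)%N -> 36^-1 <= ev 1 m (fun K => dev 1 m K ^+ 2).
Proof.
move=> m2; have n0 : 0 < m.+1%:R ^+ 2 :> R by rewrite exprn_gt0.
have -> : ev 1 m (fun K => dev 1 m K ^+ 2) = m.+1%:R ^- 2 * (pathlen_var 1 m / rising 1 m).
  rewrite /pathlen_var -/(ev 1 m (fun K => ((pathlen K)%:R - mean 1 m) ^+ 2)) -evZ.
  by congr (_ / _); apply: eq_growth => K; rewrite /dev exprMn exprVn mulrC.
rewrite ler_pdivlMl // ler_pdivlMr ?rising_gt0 // mulrC; exact: pathlen_var1_ge.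
Qed.

(** Expansion about the mean: the real part is 1 - x ^+ 2 / 2 * V up to order 4, with V >= 1/36, and
    the imaginary part is of order 3 because the linear term is centered. The fourth moment controls
    both remainders. *)
Lemma psi1_small : exists s c : R, [/\ 0 < s, 0 < c, c <= 1 &
  forall tau m, (2 <= m)%N -> 0 < tau -> tau * m.+1%:R <= s ->
    psi 1 tau m <= 1 - c * (tau * m.+1%:R) ^+ 2].
Proof.
have [M [M0 h4]] := dev_fourth (@ltr01 R).
(* [D] collects the coefficients of the remainders; [s] makes x ^+ 2 * D <= 288^-1, an eighth of the
   variance bound 36^-1. *)
pose D := 2 + 2 * M + (1 + M) ^+ 2.
have D0 : 0 < D by rewrite /D; have := sqr_ge0 (1 + M); lra.
pose s : R := (12 * D)^-1.
have s0 : 0 < s by rewrite invr_gt0 mulr_gt0.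
have sD : s * (12 * D) = 1 by rewrite mulVf // lt0r_neq0 // mulr_gt0.
exists s, 288^-1; split; [exact: s0|lra|lra|].
move=> tau m m2 t0 ts; set x := tau * m.+1%:R in ts *.
have n0 : 0 < m.+1%:R :> R by [].
have x0 : 0 < x by rewrite mulr_gt0.
rewrite (psi_centered _ _ (mean 1 m)) //.
have e K : tau * ((pathlen K)%:R - mean 1 m) = x * dev 1 m K.
  by rewrite /x /dev; field; rewrite nat1r.
clearbody x.
rewrite -!/(ev _ _ _); set a := ev _ _ _; set b := ev _ _ _.
have v2 := dev1_var m2; set V := ev _ _ _ in v2.
have v4 := h4 m; set W := ev _ _ _ in v4.
have W0 : 0 <= W.
  rewrite -(ev_cst m 0 (@ltr01 R)); apply: le_ev => // K.
  by rewrite (_ : 4%N = (2 * 2)%N) // exprM sqr_ge0.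
have VW : V <= 1 + W.
  rewrite -[1](ev_cst m 1 (@ltr01 R)) -evD; apply: le_ev => // K.
  have := sqr_ge0 (dev 1 m K ^+ 2 - 1); have := sqr_ge0 (dev 1 m K).
  by rewrite -[4%N]/(2 * 2)%N exprM; move: (dev 1 m K ^+ 2) => y; lra.
have aU : a <= 1 - x ^+ 2 / 2 * V + x ^+ 4 / 24 * W.
  rewrite -[X in X - _](ev_cst m 1 (@ltr01 R)) -mulNr -!evZ -!evD; apply: le_ev => // K.
  rewrite e; apply: le_trans (cos_le_quartic _) _.
  by move: (dev 1 m K) => y; rewrite !exprMn; lra.
have aL : 1 - x ^+ 2 / 2 * V <= a.
  rewrite -[X in X - _](ev_cst m 1 (@ltr01 R)) -mulNr -!evZ -!evD; apply: le_ev => // K.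
  rewrite e -cos_norm; apply: le_trans (cos_ge_quadratic (normr_ge0 _)).
  by rewrite real_normK ?num_real //; move: (dev 1 m K) => y; rewrite exprMn; lra.
have dev0 : ev 1 m (dev 1 m) = 0.
  have -> : ev 1 m (dev 1 m) =
      ev 1 m (fun K => m.+1%:R^-1 * (pathlen K)%:R + - (m.+1%:R^-1 * mean 1 m)).
    by congr (_ / _); apply: eq_growth => K; rewrite /dev mulrC mulrBr.
  rewrite evD evZ ev_cst // /ev -/(pathlen_sum 1 m) pathlen_sumE //.
  by rewrite [_ / rising _ _]mulrAC divff ?mul1r ?subrr // lt0r_neq0 // rising_gt0.
have bU : `|b| <= x ^+ 3 * (1 + W).
  have sn : ev 1 m (fun K => sin (x * dev 1 m K)) = b by congr (_ / _); apply: eq_growth => K; rewrite e.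
  have cub K : `|sin (x * dev 1 m K) - x * dev 1 m K| <= x ^+ 3 * (1 + dev 1 m K ^+ 4).
    apply: le_trans (sin_sub_id _) _; rewrite normrM (gtr0_norm x0) exprMn.
    rewrite ler_pM2l ?exprn_gt0 //.
    rewrite -[4%N]/(2 * 2)%N exprM -[dev 1 m K ^+ 2]real_normK ?num_real //.
    move: `|_| (normr_ge0 (dev 1 m K)) => y y0.
    have [y1|y1] := leP y 1.
      have : y ^+ 3 <= 1 by exact: exprn_ile1.
      have := sqr_ge0 (y ^+ 2); lra.
    have : y ^+ 3 <= (y ^+ 2) ^+ 2 by rewrite -exprM ler_weXn2l // ltW.
    lra.
  have -> : b = ev 1 m (fun K => sin (x * dev 1 m K) + - x * dev 1 m K).
    by rewrite evD evZ dev0 mulr0 addr0.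
  have rhs : x ^+ 3 * (1 + W) = ev 1 m (fun K => x ^+ 3 * (1 + dev 1 m K ^+ 4)).
    by rewrite evZ evD ev_cst.
  rewrite rhs ler_norml -mulN1r -evZ; apply/andP; split; apply: le_ev => // K; have := cub K;
    rewrite ler_norml => /andP[]; lra.
have a1 : a <= 1.
  rewrite -[leRHS](ev_cst m 1 (@ltr01 R)); apply: le_ev => // K; exact: cos_le1.
clearbody a b V W; clear h4 e dev0.
have zD : x ^+ 2 * D <= 288^-1.
  have sD' : s * D = 12^-1 by lra.
  have s24 : s <= 24^-1.
    have D2 : 2 <= D by rewrite /D; have := sqr_ge0 (1 + M); lra.
    have : s * 2 <= s * D by rewrite ler_pM2l.
    lra.
  apply: (@le_trans _ _ (s * (s * D))).
    rewrite expr2 -mulrA; apply: ler_pM; rewrite ?ler_pM2r //; first exact: ltW.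
    by rewrite mulr_ge0 // ltW.
  rewrite sD'; lra.
have z0 : 0 < x ^+ 2 by exact: exprn_gt0.
have zM : x ^+ 2 * W <= x ^+ 2 * M by rewrite ler_pM2l.
have zMM : 0 <= x ^+ 2 * M by rewrite mulr_ge0 // ltW.
have zQ : 0 <= x ^+ 2 * (1 + M) ^+ 2 by rewrite mulr_ge0 ?sqr_ge0 // ltW.
have zV : x ^+ 2 * V <= x ^+ 2 * (1 + W) by rewrite ler_pM2l.
have zE : x ^+ 2 * D = 2 * x ^+ 2 + 2 * (x ^+ 2 * M) + x ^+ 2 * (1 + M) ^+ 2 by rewrite /D; ring.
have a0 : 0 <= a by lra.
have b2 : b ^+ 2 <= x ^+ 2 * (x ^+ 2 * (x ^+ 2 * (1 + M) ^+ 2)).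
  rewrite (_ : _ * _ = (x ^+ 3 * (1 + M)) ^+ 2); last by ring.
  rewrite -[b ^+ 2]real_normK ?num_real // lerXn2r // ?nnegrE.
    by rewrite mulr_ge0 ?exprn_ge0 ?addr_ge0 // ltW.
  by apply: le_trans bU _; rewrite ler_pM2l ?exprn_gt0 // lerD2l.
have v2' : x ^+ 2 * 36^-1 <= x ^+ 2 * V by rewrite ler_pM2l.
have aa : a ^+ 2 <= a by rewrite expr2 ler_piMr.
have h1 : x ^+ 4 * W <= x ^+ 2 * (x ^+ 2 * M).
  rewrite (_ : x ^+ 4 * W = x ^+ 2 * (x ^+ 2 * W)); last by ring.
  by rewrite ler_pM2l.
have h2 : x ^+ 2 * (x ^+ 2 * M) <= x ^+ 2 * 288^-1 by rewrite ler_pM2l //; lra.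
have h3 : x ^+ 2 * (x ^+ 2 * (x ^+ 2 * (1 + M) ^+ 2)) <= x ^+ 2 * (1 * 288^-1).
  rewrite ler_pM2l //; apply: ler_pM => //; first exact: ltW.
    by lra.
  by lra.
have z1 : x ^+ 2 <= 1 by lra.
have q0 : 0 <= 1 - 288^-1 * x ^+ 2 by lra.
rewrite -[leRHS](ger0_norm q0) -sqrtr_sqr ler_wsqrtr //.
have zz := sqr_ge0 (x ^+ 2).
have -> : (1 - 288^-1 * x ^+ 2) ^+ 2 = 1 - 144^-1 * x ^+ 2 + 288^-1 ^+ 2 * (x ^+ 2) ^+ 2 by field.
have zz' : 0 <= 288^-1 ^+ 2 * (x ^+ 2) ^+ 2 by apply: mulr_ge0; exact: sqr_ge0.
apply: le_trans (lerD aa b2) _.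
clear - aU h1 h2 h3 v2' zz' z0.
move: (x ^+ 2 * (x ^+ 2 * (x ^+ 2 * (1 + M) ^+ 2))) h3 => Q h3.
lra.
Qed.

End characteristic_function.

(** * Decay of the characteristic function at every polynomial rate *)

Section characteristic_decay.
Variable R : realType.

Lemma expr_small (eps r : R) : 0 < eps -> 0 <= r < 1 -> exists N, r ^+ N <= eps.
Proof.
move=> e0 /andP[r0 r1].
have /cvgrPdist_le/(_ _ e0)[N _ /(_ N (leqnn N))] : (fun n => r ^+ n) @ \oo --> (0 : R).
  by apply: cvg_expr; rewrite ger0_norm.
by rewrite sub0r normrN ger0_norm ?exprn_ge0 // => h; exists N.
Qed.

Lemma psi1_lt1 : exists tau0 A q : R, [/\ 0 < tau0, tau0 <= A, 0 <= q < 1 &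
  forall tau m, 0 < tau <= tau0 -> A <= tau * m.+1%:R -> psi 1 tau m <= q].
Proof.
have [s [c [s0 c0 c1 h]]] := psi1_small R.
(* The window from A to 4 * A ends at s, so [psi1_small] covers it. With tau <= s / 12, the
   condition tau * n >= A forces n >= 3, as the variance bound requires. *)
pose A := s / 4; pose q := Num.max 0 (1 - c * A ^+ 2).
have A0 : 0 < A by rewrite divr_gt0.
exists (s / 12), A, q; split; first by rewrite divr_gt0.
- by rewrite /A; lra.
- by rewrite le_max lexx /= gt_max ltr01 /= gtrBl mulr_gt0 // exprn_gt0.
move=> tau m /andP[t0 ts]; move: m.
apply: splittable_persist => //; first exact: psi_splittable.
  by rewrite /A; lra.
move=> m /andP[Am mA].
have m2 : (2 <= m)%N.
  rewrite -ltnS -(ltr_nat R) ltNge; apply/negP => m3.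
  have : tau * m.+1%:R <= tau * 2 by rewrite ler_pM2l.
  by move: Am; rewrite /A; lra.
apply: le_trans (h _ _ m2 t0 _) _; first by move: mA; rewrite /A; lra.
rewrite /q le_max; apply/orP; right; rewrite lerD2l lerN2 ler_pM2l //.
by rewrite lerXn2r // nnegrE ltW // mulr_gt0.
Qed.

Lemma psi_decay (theta : R) : 0 < theta -> exists2 tau0, 0 < tau0 &
  forall P, exists2 C, 0 < C & forall tau m, 0 < tau <= tau0 ->
    psi theta tau m * (tau * m.+1%:R) ^+ P <= C.
Proof.
move=> th0; have [tau0 [A [q [t0 tA q01 h]]]] := psi1_lt1.
have /andP[q0 q1] := q01.
exists tau0 => // P.
have spl x tau : 0 < x -> 0 < tau <= tau0 -> splittable x (psi 1 tau) (psi x tau).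
  by move=> x0 _; exact: psi_splittable.
have [N hN] : exists N, ((1 + q) / 2) ^+ N <= (4 * 2 ^+ P)^-1.
  apply: expr_small; last lra.
  by rewrite invr_gt0 mulr_gt0 // exprn_gt0.
have [A' [A'0 h']] := splittable_small t0 tA q01 (fun tau => spl 1 tau ltr01) h N.
set q' := q * _ in h'.
have q'0 : 0 <= q' by rewrite mulr_ge0 // exprn_ge0 //; lra.
have q'P : q' * 2 ^+ P <= 4^-1.
  have p0 : 0 < 2 ^+ P :> R by exact: exprn_gt0.
  rewrite -ler_pdivlMr // -invfM; apply: le_trans hN.
  by rewrite /q' ler_piMl ?exprn_ge0 //; lra.
have [C1 [C10 hC1]] := splittable_decay1 t0 A'0 q'0 q'P (fun tau => spl 1 tau ltr01) h'.
have [|C [C0 hC]] := splittable_decay th0 t0 A'0 q'0 q'P C10 _ (fun tau => spl theta tau th0) h' hC1.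
  by move=> tau m _; rewrite psi_ge0 ?psi_le1.
by exists C.
Qed.

End characteristic_decay.

(** * The law of the Hoppe tree *)

Section depth.
Implicit Types (p q : nat -> nat) (i k f : nat).

Definition recursive_upto i p := forall k, (1 <= k <= i)%N -> (p k < k)%N.

Lemma depth_fuel_enough p i f f' k : recursive_upto i p ->
  (k <= i)%N -> (k <= f)%N -> (k <= f')%N -> depth_fuel p f k = depth_fuel p f' k.
Proof.
move=> pr; elim: f f' k => [|f IH] [|f'] [|k] //= ki kf kf'; congr S.
have pk : (p k.+1 <= k)%N by rewrite -ltnS pr.
by apply: IH; apply: leq_trans pk _ => //; exact: ltnW.
Qed.

Lemma depth_fuel_local p q i f k : recursive_upto i p ->
  (forall l, (1 <= l <= i)%N -> q l = p l) -> (k <= i)%N -> (k <= f)%N ->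
  depth_fuel q f k = depth p k.
Proof.
move=> pr qp ki kf; rewrite /depth -(depth_fuel_enough pr ki kf) //.
elim: f k ki kf => [|f IH] [|k] //= ki kf; congr S.
have pk : (p k.+1 <= k)%N by rewrite -ltnS pr.
rewrite qp //; apply: IH; apply: leq_trans pk _ => //; exact: ltnW.
Qed.

Lemma depth_recursive p i : recursive_upto i.+1 p ->
  depth p i.+1 = (depth p (p i.+1)).+1.
Proof.
move=> pr; rewrite {1}/depth /=; congr S.
have pi : (p i.+1 <= i)%N by rewrite -ltnS pr // leqnn.
by apply: (@depth_fuel_local p p i.+1); rewrite // (leq_trans pi).
Qed.

End depth.

Section nat_measurable.
Context d (T : measurableType d).
Implicit Types (F G : T -> nat).

Definition nat_measurable F := forall v, measurable [set w | F w = v].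

Lemma nat_measurable_comp2 (op : nat -> nat -> nat) F G :
  nat_measurable F -> nat_measurable G ->
  nat_measurable (fun w => op (F w) (G w)).
Proof.
move=> mF mG v.
rewrite (_ : mkset _ = \bigcup_a \bigcup_(b in [set b | op a b = v])
    ([set w | F w = a] `&` [set w | G w = b])).
  by apply: bigcup_measurable => a _; apply: bigcup_measurable => b _;
    exact: measurableI.
apply/seteqP; split=> w /=.
  by move=> h; exists (F w) => //; exists (G w).
by move=> [a _ [b /= ab [-> ->]]].
Qed.

Lemma nat_measurable_depth (par : nat -> T -> nat) f F :
  (forall k, nat_measurable (par k)) -> nat_measurable F ->
  nat_measurable (fun w => depth_fuel (fun k => par k w) f (F w)).
Proof.
move=> mpar; elim: f F => [|f IH] F mF v /=.
  have [->|v0] := eqVneq v 0%N.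
    by rewrite (_ : mkset _ = setT) //; apply/seteqP; split.
  by rewrite (_ : mkset _ = set0) //; apply/seteqP; split=> // w /= /esym /eqP; rewrite (negbTE v0).
rewrite (_ : mkset _ = \bigcup_k ([set w | F w = k] `&`
   [set w | (if k == 0%N then 0 else (depth_fuel (par^~ w) f (par k w)).+1)%N = v])).
  apply: bigcup_measurable => k _; apply: measurableI => //.
  have [_|k0] := eqVneq k 0%N.
    have [->|v0] := eqVneq v 0%N.
      by rewrite (_ : mkset _ = setT) //; apply/seteqP; split.
    by rewrite (_ : mkset _ = set0) //; apply/seteqP; split=> // w /= /esym /eqP; rewrite (negbTE v0).
  case: v => [|v].
    by rewrite (_ : mkset _ = set0) //; apply/seteqP; split.
  rewrite (_ : mkset _ = [set w | depth_fuel (par^~ w) f (par k w) = v]).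
    exact: IH.
  by apply/seteqP; split=> w /=; [move=> []|move=> ->].
apply/seteqP; split=> w /=; first by exists (F w).
by move=> [k _ [-> <-]].
Qed.

Lemma nat_measurable_ipl (par : nat -> T -> nat) n :
  (forall k, nat_measurable (par k)) ->
  nat_measurable (fun w => ipl (fun k => par k w) n).
Proof.
move=> mpar; elim: n => [|n IH].
  move=> v; have [->|v0] := eqVneq v 0%N.
    rewrite (_ : mkset _ = setT) //; apply/seteqP; split=> // w _ /=.
    by rewrite /ipl big_ord0.
  rewrite (_ : mkset _ = set0) //; apply/seteqP; split=> // w /=.
  by rewrite /ipl big_ord0 => /esym /eqP; rewrite (negbTE v0).
have -> : (fun w => ipl (fun k => par k w) n.+1) =
    (fun w => ipl (fun k => par k w) n + depth (fun k => par k w) n)%N.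
  by apply/funext => w; rewrite /ipl big_ord_recr.
apply: nat_measurable_comp2 => //; apply: nat_measurable_depth => // v.
have [->|v0] := eqVneq v n.
  by rewrite (_ : mkset _ = setT) //; apply/seteqP; split.
by rewrite (_ : mkset _ = set0) //; apply/seteqP; split=> // w /= /esym /eqP; rewrite (negbTE v0).
Qed.

Lemma nat_measurable_fun d' (T' : measurableType d') F (g : nat -> T') :
  nat_measurable F -> measurable_fun setT (g \o F).
Proof.
move=> mF _ Y mY; rewrite setTI.
rewrite (_ : _ @^-1` Y = \bigcup_(v in [set v | Y (g v)]) [set w | F w = v]).
  exact: bigcup_measurable.
apply/seteqP; split=> w /=; first by exists (F w).
by move=> [v /= Yv ->].
Qed.

End nat_measurable.

Section hoppe_law.
Context (R : realType) (theta : R) d (T : measurableType d)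
  (P : probability T R) (par : nat -> T -> nat).
Hypothesis theta0 : 0 < theta.
Hypothesis Hpar : hoppe_choices theta P par.
Implicit Types (j : nat -> nat) (i l m : nat).

Let mpar k : nat_measurable (par k). Proof. exact: (Hpar.1 k). Qed.

Definition prefix_event i j := [set w | forall k, (1 <= k <= i)%N -> par k w = j k].

Lemma measurable_prefix i j : measurable (prefix_event i j).
Proof.
rewrite (_ : prefix_event i j =
    \bigcap_(k in [set k | (1 <= k <= i)%N]) [set w | par k w = j k]).
  by apply: bigcap_measurableType => // k _; exact: mpar.
by apply/seteqP; split=> w h k /=; exact: h.
Qed.

Definition prefix_weight i j := \prod_(1 <= k < i.+1) hoppe_weight theta k (j k).

Lemma prefix_prob i j : P (prefix_event i j) = (prefix_weight i j)%:E.
Proof. exact: Hpar.2. Qed.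

Definition upd j i l := fun k : nat => if k == i then l else j k.

Fixpoint state j i : seq (R * nat) :=
  if i is i'.+1 then (1, depth j i) :: state j i' else [:: (theta, 0)].

Definition node_weight l : R := if l == 0%N then theta else 1.

Lemma sum_state j i (f : R * nat -> R) :
  \sum_(x <- state j i) f x = \sum_(l < i.+1) f (node_weight l, depth j l).
Proof.
elim: i => [|i IH]; first by rewrite /= big_seq1 big_ord1.
by rewrite /= big_cons IH [RHS]big_ord_recr /= addrC.
Qed.

Lemma pathlen_state j i : pathlen (state j i) = ipl j i.+1.
Proof.
rewrite /ipl; elim: i => [|i IH].
  by rewrite /pathlen big_seq1 big_ord1.
by rewrite [RHS]big_ord_recr -IH /= /pathlen big_cons addnC.
Qed.

Lemma recursive_upd j i l : recursive_upto i j -> (l < i.+1)%N ->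
  recursive_upto i.+1 (upd j i.+1 l).
Proof.
move=> jr li k /andP[k1 ki]; rewrite /upd; case: eqVneq => [->//|ne].
by apply: jr; rewrite k1 /= -ltnS ltn_neqAle ne.
Qed.

Lemma upd_local j i l k : (1 <= k <= i)%N -> upd j i.+1 l k = j k.
Proof. by move=> /andP[_ ki]; rewrite /upd; case: eqVneq ki => // ->; rewrite ltnn. Qed.

Lemma state_local j q i : recursive_upto i j ->
  (forall k, (1 <= k <= i)%N -> q k = j k) -> state q i = state j i.
Proof.
move=> jr qj; suff h n : (n <= i)%N -> state q n = state j n by exact: h.
elim: n => // n IH ni /=; rewrite IH ?(ltnW ni) //.
by congr (_ :: _); congr (_, _); apply: (@depth_fuel_local j q i).
Qed.

Lemma state_upd j i l : recursive_upto i j -> (l < i.+1)%N ->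
  state (upd j i.+1 l) i.+1 = (1, (depth j l).+1) :: state j i.
Proof.
move=> jr li /=; congr (_ :: _); last by apply: state_local => // k; exact: upd_local.
congr (_, _); rewrite depth_recursive; last exact: recursive_upd.
congr S; rewrite {2}/upd eqxx.
by apply: (@depth_fuel_local j _ i) => // k; exact: upd_local.
Qed.

Lemma prefix_weight_upd j i l : (l < i.+1)%N ->
  prefix_weight i.+1 (upd j i.+1 l) =
  prefix_weight i j * (node_weight l / (theta + i%:R)).
Proof.
move=> li; rewrite /prefix_weight big_nat_recr //=; congr (_ * _).
  rewrite big_nat [RHS]big_nat; apply: eq_bigr => k /andP[k1 ki].
  by rewrite upd_local // k1.
by rewrite /hoppe_weight /upd eqxx /node_weight li; case: eqP.
Qed.

Lemma node_weight_sum i : \sum_(l < i.+1) node_weight l = theta + i%:R.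
Proof.
elim: i => [|i IH]; first by rewrite big_ord1 addr0.
by rewrite big_ord_recr /= IH -[i.+1%:R]natr1 addrA.
Qed.

(** The hypothesis gives only cylinder probabilities, so the next parent is an existing node merely
    almost surely: the cylinders cover the prefix event up to [N], null because the weights of the
    existing nodes exhaust the total. *)
Lemma prefix_split i j (f : T -> \bar R) : measurable_fun setT f ->
  (forall w, (0 <= f w)%E) ->
  (\int[P]_(w in prefix_event i j) f w =
   \sum_(l < i.+1) \int[P]_(w in prefix_event i.+1 (upd j i.+1 l)) f w)%E.
Proof.
move=> mf f0; pose F l := prefix_event i.+1 (upd j i.+1 l).
pose D := \big[setU/set0]_(l < i.+1) F l.
have mD : measurable D by apply: bigsetU_measurable => l _; exact: measurable_prefix.
have FE l w : F l w <-> prefix_event i j w /\ par i.+1 w = l.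
  split=> [h|[h1 h2] k /andP[k1]].
    split=> [k ki|]; last by rewrite h ?leqnn // /upd eqxx.
    by rewrite h ?upd_local //; case/andP: ki => -> /leqW.
  rewrite leq_eqVlt => /predU1P[->|]; first by rewrite /upd eqxx.
  by rewrite ltnS => ki; rewrite upd_local ?k1 // h1 // k1.
have tF : trivIset setT F.
  by apply/trivIsetP => a b _ _ ab; apply/seteqP; split=> // w /= [/FE[_ ea] /FE[_ eb]]; move: ab; rewrite -ea eb eqxx.
have Dsub : D `<=` prefix_event i j.
  by rewrite /D -(bigcup_mkord i.+1 F) => w [l _ /FE[]].
have PD : P D = P (prefix_event i j).
  transitivity (\sum_(l < i.+1) P (F l))%E.
    apply: measure_semi_additive_ord_I => //; last exact: sub_trivIset tF.
    by move=> k _; exact: measurable_prefix.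
  rewrite [RHS]prefix_prob.
  rewrite (eq_bigr (fun l : 'I_i.+1 => (prefix_weight i j * (node_weight l / (theta + i%:R)))%:E)).
  2: by move=> l _; rewrite -prefix_weight_upd // -prefix_prob.
  rewrite sumEFin -mulr_sumr -mulr_suml node_weight_sum divff ?mulr1 //.
  by rewrite gt_eqF // ltr_wpDr.
pose N := prefix_event i j `\` D.
have mN : measurable N by apply: measurableD => //; exact: measurable_prefix.
have PN : P N = 0.
  transitivity (P (prefix_event i j) - P D)%E.
    rewrite measureD //; last 2 first.
    - exact: measurable_prefix.
    - by apply: le_lt_trans (probability_le1 _ _) (ltry 1); exact: measurable_prefix.
    by rewrite (setIidr Dsub).
  by rewrite PD subee // prefix_prob.
rewrite (ge0_negligible_integral mN) //; last 2 first.
- exact: measurable_prefix.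
- exact: measurable_funTS.
rewrite (_ : _ `\` N = D); last first.
  rewrite /N setDD; exact: setIidr.
rewrite /D -(big_mkord xpredT F) ge0_integral_bigsetU //.
- by rewrite big_mkord.
- by move=> l; exact: measurable_prefix.
- exact: iota_uniq.
- by apply: sub_trivIset tF.
- exact: measurable_funTS.
Qed.

(** Induction on the number [dd] of insertions still to come: fixing one more parent matches one
    step of [growth], and the denominator is the product of the total weights still to be met. *)
Lemma hoppe_integral_prefix (g : nat -> R) (dd i m : nat) j : (forall v, 0 <= g v) ->
  (i + dd)%N = m -> recursive_upto i j ->
  (\int[P]_(w in prefix_event i j) (g (ipl (fun k => par k w) m.+1))%:E =
   (prefix_weight i j * (growth (fun K => g (pathlen K)) dd (state j i) /
      \prod_(i <= l < m) (theta + l%:R)))%:E)%E.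
Proof.
move=> g0; elim: dd i j => [|dd IH] i j im jr.
  rewrite addn0 in im; rewrite -im big_geq // divr1 /=.
  rewrite (eq_integral (cst (g (pathlen (state j i)))%:E)); last first.
    move=> w; rewrite inE => wj; congr (EFin (g _)).
    rewrite -pathlen_state (@state_local j) // => k ki; exact: wj.
  transitivity ((g (pathlen (state j i)))%:E * P (prefix_event i j))%E.
    by apply: integral_cst; exact: measurable_prefix.
  by rewrite prefix_prob -EFinM mulrC.
rewrite prefix_split; last 2 first.
- apply/measurable_EFinP.
  by apply: (nat_measurable_fun (F := fun w => ipl (fun k => par k w) m.+1));
    apply: nat_measurable_ipl.
- by move=> w; rewrite lee_fin.
rewrite (eq_bigr (fun l : 'I_i.+1 => (prefix_weight i j / \prod_(i <= l < m) (theta + l%:R) *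
   (node_weight l * growth (fun K => g (pathlen K)) dd ((1, (depth j l).+1) :: state j i)))%:E)).
  rewrite sumEFin; congr EFin; rewrite -mulr_sumr /= sum_state; ring.
move=> l _; rewrite IH ?addSn -?addnS //; last exact: recursive_upd.
rewrite state_upd // prefix_weight_upd //; congr EFin.
have im' : (i < m)%N by rewrite -im addnS ltnS leq_addr.
rewrite [in RHS]big_ltn // invfM; ring.
Qed.

Lemma hoppe_integral (g : nat -> R) m : (forall v, 0 <= g v) ->
  (\int[P]_w (g (ipl (fun k => par k w) m.+1))%:E =
   (ev theta m (fun K => g (pathlen K)))%:E)%E.
Proof.
move=> g0; have := @hoppe_integral_prefix g m 0 m id g0 (add0n m).
rewrite (_ : prefix_event 0 id = setT); last first.
  by apply/seteqP; split=> // w _ k /=; case: k.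
move=> -> //; last by case.
rewrite /prefix_weight big_geq // mul1r /ev /rising big_mkord //.
Qed.

End hoppe_law.

(** * Comparison of the mean with n log n *)

Section mean_log.
Variable R : realType.
Implicit Types theta : R.

Lemma harm_ln m : `|harm (1 : R) m - ln m.+1%:R| <= 1.
Proof.
(* The summand [m.+1%:R^-1] strengthens the lower bound so that its induction step is exactly ln (a
   + 1) - ln a <= a^-1. *)
suff: ln m.+1%:R - 1 + m.+1%:R^-1 <= harm (1 : R) m <= ln m.+1%:R.
  have : 0 < m.+1%:R^-1 :> R by rewrite invr_gt0.
  move: (m.+1%:R^-1) => y y0 /andP[h1 h2].
  by rewrite ler_norml; apply/andP; split; lra.
elim: m => [|m /andP[IH1 IH2]].
  by rewrite /harm big_ord0 ln1 invr1; lra.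
have e : harm (1 : R) m.+1 = harm 1 m + m.+2%:R^-1.
  by rewrite /harm big_ord_recr /= nat1r.
pose a : R := m.+1%:R; have a0 : 0 < a by [].
have a1 : m.+2%:R = a + 1 by rewrite natr1.
have b1 : ln (a + 1) - ln a <= a^-1.
  rewrite -ln_div ?posrE ?addr_gt0 //.
  rewrite (_ : (a + 1) / a = 1 + a^-1); last by field; exact: lt0r_neq0.
  by apply: le_ln1Dx; rewrite (lt_trans (ltrN10 _)) // invr_gt0.
have b2 : (a + 1)^-1 <= ln (a + 1) - ln a.
  rewrite -lerN2 opprB -ln_div ?posrE ?addr_gt0 //.
  rewrite (_ : a / (a + 1) = 1 + - (a + 1)^-1); last by field; rewrite lt0r_neq0 // addr_gt0.
  by apply: le_ln1Dx; rewrite ltrN2 invf_lt1 ?addr_gt0 // ltrDr.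
rewrite e a1; move: IH1 IH2 b1 b2; rewrite -/a.
move: (ln a) (ln (a + 1)) a^-1 (a + 1)^-1 (harm 1 m) => *.
by apply/andP; split; lra.
Qed.

(** Finite trees are centered at their exact mean, the limit at n log n; after division by n the
    difference is a bounded shift, harmless for tails. *)
Lemma mean_ln theta : 0 < theta -> exists2 c, 0 <= c &
  forall m, `|(mean theta m - m.+1%:R * ln m.+1%:R) / m.+1%:R| <= c.
Proof.
move=> t0; pose t := `|theta - 1|.
exists ((theta + 1) * (t + 1) + t) => [|m].
  by rewrite addr_ge0 ?mulr_ge0 ?addr_ge0 ?normr_ge0 // ltW.
have n0 : 0 < m.+1%:R :> R by [].
rewrite normrM normfV (gtr0_norm n0) ler_pdivrMr //.
rewrite /mean -/(harm theta m); set l := ln m.+1%:R; set n : R := m.+1%:R.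
have -> : (theta + m%:R) * harm theta m - n * l =
   (theta + m%:R) * (harm theta m - l) + (theta - 1) * l.
  by rewrite /n -natr1; ring.
have h1 : `|harm theta m - l| <= t + 1.
  rewrite (_ : _ - _ = (harm 1 m - l) - (harm 1 m - harm theta m)); last by ring.
  apply: le_trans (ler_normB _ _) _; rewrite [leLHS]addrC; apply: lerD.
    exact: harm_dist.
  exact: harm_ln.
have l0 : 0 <= l by apply: ln_ge0; rewrite ler1n.
have ln : l <= n by apply/ltW/ln_sublinear.
apply: le_trans (ler_normD _ _) _; rewrite [leRHS]mulrDl !normrM; apply: lerD.
  rewrite [leRHS]mulrAC; apply: ler_pM => //.
  rewrite ger0_norm; last by rewrite addr_ge0 // ltW.
  by rewrite /n -natr1; have := ler0n R m; move: (m%:R) => x x0; nra.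
by apply: ler_pM => //; rewrite (ger0_norm l0).
Qed.

End mean_log.

(** * Characteristic function and tails of the limit *)

Lemma integrable_comp (R : realType) d (T : measurableType d) (P : probability T R)
    (X : T -> R) (mX : measurable_fun setT X) (h : R -> R) (B : R) :
  continuous h -> (forall x, `|h x| <= B) ->
  P.-integrable setT (EFin \o (fun w => h (X w))).
Proof.
move=> ch hB; apply: (@le_integrable _ _ _ _ _ measurableT _ (cst B%:E)).
- apply/measurable_EFinP; apply: measurableT_comp => //.
  exact: continuous_measurable_fun.
- move=> w _; rewrite /= lee_fin (le_trans (hB _)) //; exact: ler_norm.
- exact: finite_measure_integrable_cst.
Qed.

Lemma measurable_norm_ge (R : realType) d (T : measurableType d) (X : T -> R) x :
  measurable_fun setT X -> measurable [set w | x <= `|X w|].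
Proof.
move=> mX; rewrite (_ : mkset _ = (fun w => `|X w|) @^-1` `[x, +oo[%classic); last first.
  by apply/seteqP; split=> w /=; rewrite in_itv /= andbT.
have mN : measurable_fun setT (fun w => `|X w|).
  by apply: measurableT_comp => //; apply: continuous_measurable_fun; exact: norm_continuous.
by rewrite -[_ @^-1` _]setTI; apply: mN.
Qed.

Section limit_law.
Context (R : realType) (theta : R) d (T : measurableType d)
  (P : probability T R) (par : nat -> T -> nat) (X : T -> R).
Hypothesis theta0 : 0 < theta.
Hypothesis Hpar : hoppe_choices theta P par.
Hypothesis mX : measurable_fun setT X.
Hypothesis cvgX : {ae P, forall w, (fun n : nat =>
      (((ipl (fun k => par k w) n)%:R - n%:R * ln n%:R) / n%:R) : R)
        @ \oo --> X w}.

Let norm_ipl (n v : nat) : R := (v%:R - n%:R * ln n%:R) / n%:R.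

(** Dominated convergence. Nonnegativity matches [hoppe_integral]; a test function bounded by 1 in
    absolute value is first shifted by 1. *)
Lemma hoppe_limit (h : R -> R) (B : R) : continuous h ->
  (forall x, 0 <= h x) -> (forall x, h x <= B) ->
  (fun m => ev theta m (fun K => h (norm_ipl m.+1 (pathlen K)))) @ \oo -->
  (\int[P]_w h (X w))%R.
Proof.
move=> ch h0 hB.
pose f_ m w := (h (norm_ipl m.+1 (ipl (fun k => par k w) m.+1)))%:E.
have [|||||_ _] := @dominated_convergence _ _ _ P setT measurableT f_
    (fun w => (h (X w))%:E) (cst B%:E).
- move=> m; apply/measurable_EFinP.
  apply: (@nat_measurable_fun _ _ _ _ (fun w => ipl (fun k => par k w) m.+1)
    (fun v => h (norm_ipl m.+1 v))).
  by apply: nat_measurable_ipl; exact: Hpar.1.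
- apply/measurable_EFinP; apply: measurableT_comp => //.
  exact: continuous_measurable_fun.
- apply: filterS cvgX => w cw _; apply: cvg_EFin; first exact: nearW.
  apply: continuous_cvg; first exact: ch.
  by move: cw; rewrite -cvg_shiftS.
- exact: finite_measure_integrable_cst.
- by apply: aeW => w m _; rewrite /f_ /= lee_fin ger0_norm.
have e : (\int[P]_w (h (X w))%:E)%E = (\int[P]_w h (X w))%R%:E.
  rewrite fineK //; apply: integrable_fin_num => //.
  by apply: (@integrable_comp _ _ _ P X mX h B) => // x; rewrite ger0_norm.
rewrite e => /fine_cvg; apply: cvg_trans; apply: near_eq_cvg; apply: nearW => m /=.
by rewrite /f_ (hoppe_integral theta0 Hpar m (fun v => h0 (norm_ipl m.+1 v))).
Qed.

Lemma RintegralD1 (h : R -> R) : continuous h -> (forall x, `|h x| <= 1) ->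
  \int[P]_w (1 + h (X w)) = 1 + \int[P]_w h (X w).
Proof.
move=> ch h1; rewrite RintegralD //; last 2 first.
- exact: finite_measure_integrable_cst.
- exact: (@integrable_comp _ _ _ P X mX h 1).
congr (_ + _); rewrite Rintegral_cst // mul1r -[RHS]/(fine 1%E).
by congr fine; exact: probability_setT.
Qed.

(** Treats cosine and sine at once. With tau = t / n the product tau * n equals t for every n, and
    tau <= tau0 holds for n large. *)
Lemma char_bound_limit (p : nat) (C t tau0 : R) (h : R -> R) : 0 < t -> 0 < tau0 ->
  continuous h -> (forall x, `|h x| <= 1) ->
  (forall m, `|ev theta m (fun K => h (norm_ipl m.+1 (pathlen K)))| <= psi theta (t / m.+1%:R) m) ->
  (forall tau m, 0 < tau <= tau0 -> psi theta tau m * (tau * m.+1%:R) ^+ p <= C) ->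
  `|\int[P]_w h (X w)| <= C / t ^+ p.
Proof.
move=> t0 tau00 ch h1 hpsi hC.
have [h2 h3] : (forall x, 0 <= 1 + h x) /\ (forall x, 1 + h x <= 2).
  by split=> x; have := h1 x; rewrite ler_norml => /andP[]; lra.
have ch' : continuous (fun x => 1 + h x).
  by move=> x; apply: cvgD; [exact: cvg_cst|exact: ch].
have := hoppe_limit ch' h2 h3; rewrite RintegralD1 // => cv.
have {}cv : (fun m => ev theta m (fun K => h (norm_ipl m.+1 (pathlen K)))) @ \oo -->
    \int[P]_w h (X w).
  have -> : \int[P]_w h (X w) = 1 + \int[P]_w h (X w) - 1 by ring.
  rewrite (_ : (fun m => _) = (fun m => ev theta m (fun K => 1 + h (norm_ipl m.+1 (pathlen K))) - 1)).
    by apply: cvgB => //; exact: cvg_cst.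
  by apply/funext => m; rewrite evD ev_cst // addrAC subrr add0r.
have nv : (fun m => `|ev theta m (fun K => h (norm_ipl m.+1 (pathlen K)))|) @ \oo -->
    `|\int[P]_w h (X w)| by exact: cvg_norm.
rewrite -(cvg_lim (@Rhausdorff R) nv).
apply: limr_le; first by apply/cvg_ex; eexists; exact: nv.
near=> m; have n0 : 0 < m.+1%:R :> R by [].
apply: le_trans (hpsi m) _; rewrite ler_pdivlMr ?exprn_gt0 //.
have := hC (t / m.+1%:R) m; rewrite divfK ?lt0r_neq0 //; apply.
rewrite divr_gt0 //= ler_pdivrMr // mulrC -ler_pdivrMr //.
rewrite ltW // (@lt_le_trans _ _ m%:R) ?ler_nat //.
by near: m; exact: nbhs_infty_gtr.
Unshelve. all: by end_near. Qed.

Lemma char_decay p : exists2 C, 0 < C & forall t, 0 < t ->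
  `|\int[P]_w cos (t * X w)| <= C / t ^+ p /\
  `|\int[P]_w sin (t * X w)| <= C / t ^+ p.
Proof.
have [tau0 tau00 /(_ p)[C C0 hC]] := psi_decay theta0.
exists C => // t t0.
have e m (K : seq (R * nat)) : t * norm_ipl m.+1 (pathlen K) =
    t / m.+1%:R * ((pathlen K)%:R - m.+1%:R * ln m.+1%:R).
  by rewrite /norm_ipl mulrCA mulrC mulrAC.
split.
  apply: (@char_bound_limit p C t tau0 (fun x => cos (t * x))) => //.
  - move=> x; apply: continuous_comp; last exact: continuous_cos.
    exact: mulrl_continuous.
  - by move=> x; exact: cos_max.
  move=> m; rewrite (psi_centered _ _ (m.+1%:R * ln m.+1%:R)) //.
  rewrite -!/(ev _ _ _) -sqrtr_sqr; apply: ler_wsqrtr.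
  rewrite (_ : ev _ _ _ = ev theta m (fun K => cos (t * norm_ipl m.+1 (pathlen K)))).
    by rewrite lerDl sqr_ge0.
  by congr (_ / _); apply: eq_growth => K; rewrite e.
apply: (@char_bound_limit p C t tau0 (fun x => sin (t * x))) => //.
- move=> x; apply: continuous_comp; last exact: continuous_sin.
  exact: mulrl_continuous.
- by move=> x; exact: sin_max.
move=> m; rewrite (psi_centered _ _ (m.+1%:R * ln m.+1%:R)) //.
rewrite -!/(ev _ _ _) -sqrtr_sqr; apply: ler_wsqrtr.
rewrite [X in _ <= _ + X](_ : _ = (ev theta m (fun K => sin (t * norm_ipl m.+1 (pathlen K)))) ^+ 2).
  by rewrite lerDr sqr_ge0.
by congr ((_ / _) ^+ 2); apply: eq_growth => K; rewrite e.
Qed.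

(** Markov's inequality for expR (lam * y) + expR (- (lam * y)), truncated because the passage to
    the limit takes bounded functions only. The truncation level expR (lam * x) is already reached
    for |y| >= x, so nothing is lost. *)
Lemma tail_bound : exists lam C : R, [/\ 0 < lam, 0 < C & forall x : R, 0 <= x ->
  (P [set w | (x <= `|X w|)%R] <= (C * expR (- (lam * x)))%:E)%E].
Proof.
have [lam [C [lam0 C0 hC]]] := dev_exp_bound theta0.
have [c c0 hc] := mean_ln theta0.
pose C' := expR (lam * c) * C.
have C'0 : 0 < C' by rewrite mulr_gt0 // expR_gt0.
exists lam, C'; split=> // x x0.
pose N := expR (lam * x); have N0 : 0 < N by exact: expR_gt0.
pose h (y : R) := Num.min (expR (lam * y) + expR (- (lam * y))) N.
have ch : continuous h.
  move=> y; apply: (@continuous_min _ _ (fun y => expR (lam * y) + expR (- (lam * y))) (cst N)).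
    have cl : continuous (fun y : R => lam * y) by exact: mulrl_continuous.
    apply: cvgD; first by apply: continuous_comp (cl y) _; exact: continuous_expR.
    apply: (@continuous_comp _ _ _ (fun y => - (lam * y)) expR).
      by apply: cvgN; exact: cl.
    exact: continuous_expR.
  exact: cvg_cst.
have h0 y : 0 <= h y by rewrite le_min (ltW N0) addr_ge0 // expR_ge0.
have hN y : h y <= N by rewrite ge_min lexx orbT.
have cv := hoppe_limit ch h0 hN.
have hC' : \int[P]_w h (X w) <= C'.
  rewrite -(cvg_lim (@Rhausdorff R) cv).
  apply: limr_le; first by apply/cvg_ex; eexists; exact: cv.
  apply: nearW => m; apply: (@le_trans _ _ (expR (lam * c) * ev theta m (fun K =>
    expR (lam * dev theta m K) + expR (- (lam * dev theta m K))))); last first.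
    by rewrite ler_pM2l ?expR_gt0.
  rewrite -evZ; apply: le_ev => // K; apply: (@le_trans _ _ (expR (lam * norm_ipl m.+1 (pathlen K)) +
      expR (- (lam * norm_ipl m.+1 (pathlen K))))).
    by rewrite /h ge_min lexx.
  have e : norm_ipl m.+1 (pathlen K) = dev theta m K + (mean theta m - m.+1%:R * ln m.+1%:R) / m.+1%:R.
    by rewrite /norm_ipl /dev -mulrDl; congr (_ / _); ring.
  have := hc m; rewrite ler_norml => /andP[d1 d2].
  rewrite mulrDr; apply: lerD; rewrite -expRD ler_expR e.
    by rewrite mulrDr addrC lerD2r ler_pM2l.
  by rewrite mulrDr opprD addrC lerD2r -mulrN ler_pM2l // lerNl.
have mA := measurable_norm_ge x mX.
have key : (N%:E * P [set w | (x <= `|X w|)%R] <= (\int[P]_w h (X w))%R%:E)%E.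
  rewrite -integral_cst // fineK; last first.
    apply: integrable_fin_num => //.
    by apply: (@integrable_comp _ _ _ P X mX h N) => // y; rewrite ger0_norm.
  apply: (@le_trans _ _ (\int[P]_(w in [set w | (x <= `|X w|)%R]) (h (X w))%:E)%E).
    apply: ge0_le_integral => //.
    - by move=> w _; rewrite lee_fin ltW.
    - apply: measurable_funTS; apply/measurable_EFinP; apply: measurableT_comp => //.
      exact: continuous_measurable_fun.
    - move=> w /= xw; rewrite lee_fin /h le_min lexx andbT /N.
      have [X0|X0] := leP 0 (X w).
        rewrite (ger0_norm X0) in xw.
        by rewrite ler_wpDr ?expR_ge0 // ler_expR ler_pM2l.
      rewrite (ltr0_norm X0) in xw.
      by rewrite ler_wpDl ?expR_ge0 // ler_expR -mulrN ler_pM2l.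
  apply: ge0_subset_integral => //.
    apply/measurable_EFinP; apply: measurableT_comp => //.
    exact: continuous_measurable_fun.
  by move=> w _; rewrite lee_fin.
apply: (@le_trans _ _ ((N^-1)%:E * (\int[P]_w h (X w))%R%:E)%E).
  by rewrite lee_pdivlMl.
by rewrite -EFinM lee_fin expRN -/N mulrC ler_pM2r // invr_gt0.
Qed.

End limit_law.

(** * Fourier integrals *)

Lemma is_derive_Rintegral (R : realType) d (Y : measurableType d)
    (mu : {measure set Y -> \bar R}) (B : set Y) (f df : R -> Y -> R) (G : Y -> R) (x0 : R) :
  measurable B ->
  (forall x, mu.-integrable B (EFin \o f x)) ->
  (forall x y, B y -> is_derive (x : R) (1 : R) (f ^~ y) (df x y)) ->
  (forall y, 0 <= G y) -> mu.-integrable B (EFin \o G) ->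
  (forall x y, B y -> `|df x y| <= G y) ->
  is_derive x0 (1 : R) (fun x => \int[mu]_(y in B) f x y) (\int[mu]_(y in B) df x0 y).
Proof.
move=> mB intf fdf G0 intG Gub.
have Ia : `]x0 - 1, x0 + 1[%classic x0 by rewrite /= in_itv/= ltrBlDr ltrDl ltr01.
have intf' x : `]x0 - 1, x0 + 1[%classic x -> mu.-integrable B (EFin \o f x) by [].
have der x y : `]x0 - 1, x0 + 1[%classic x -> B y -> derivable (f ^~ y) x 1.
  by move=> _ By; case: (fdf x y By).
have ub x y : `]x0 - 1, x0 + 1[%classic x -> B y -> `|partial1of2 f x y| <= G y.
  move=> _ By; rewrite partial1of2E; have h := fdf x y By.
  by rewrite derive_val; exact: Gub.
have D := derivable_under_integral mB Ia intf' der G0 intG ub.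
have V := differentiation_under_integral mB Ia intf' der G0 intG ub.
apply: DeriveDef => //.
rewrite -derive1E V; apply: eq_Rintegral => y; rewrite inE => By.
by rewrite partial1of2E; have h := fdf x0 y By; rewrite derive_val.
Qed.

Section fourier_integral.
Context (R : realType) (a b : R -> R).
Local Notation mu := (@lebesgue_measure R).
Hypotheses (ma : measurable_fun setT a) (mb : measurable_fun setT b).
Hypothesis abC : forall k, exists2 C, 0 < C &
  forall t, 0 <= t -> t ^+ k * (`|a t| + `|b t|) <= C.

Let D : set (measurableTypeR R) := `[0, +oo[%classic.
Let mD : measurable D. Proof. exact: measurable_itv. Qed.

(* The shift by [k] quarter periods makes [wave k] the [k]-th derivative in [x]
   of [wave 0], up to the factor [t ^+ k]; [s] below is a smoothing parameter. *)
Definition wave k (x t : R) : R :=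
  a t * cos (t * x + k%:R * (pi / 2)) + b t * sin (t * x + k%:R * (pi / 2)).

Definition fourier_integrand (s : R) k x t := expR (- (s * t)) * t ^+ k * wave k x t.

Definition fourier (s : R) k x := \int[mu]_(t in D) fourier_integrand s k x t.

Lemma wave_le k x t : `|wave k x t| <= `|a t| + `|b t|.
Proof.
apply: le_trans (ler_normD _ _) _; rewrite !normrM.
by apply: lerD; rewrite ler_piMr // ?cos_max ?sin_max.
Qed.

Lemma measurable_wave k x : measurable_fun setT (wave k x).
Proof.
have ml : measurable_fun setT (fun t : R => t * x + k%:R * (pi / 2)).
  apply: measurable_funD => //; apply: measurable_funM => //; exact: measurable_id.
apply: measurable_funD; apply: measurable_funM => //.
  apply: measurableT_comp ml; apply: continuous_measurable_fun; exact: continuous_cos.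
apply: measurableT_comp ml; apply: continuous_measurable_fun; exact: continuous_sin.
Qed.

Lemma integrable_oneDsqrV (C : R) : mu.-integrable D (EFin \o (fun t => C * (oneDsqr t)^-1)).
Proof.
have h : mu.-integrable D (EFin \o (fun t => (oneDsqr t)^-1)).
  apply/integrableP; split.
    apply/measurable_EFinP; apply: measurable_funTS; apply: continuous_measurable_fun.
    exact: continuous_oneDsqrV.
  under eq_integral do rewrite /= ger0_norm ?invr_ge0 //.
  by rewrite integral0y_oneDsqr ltry.
by apply: (eq_integrable mD _ _ _ (integrableZl mD C h)) => t _; rewrite /= EFinM.
Qed.

(** The moments of orders k and k + 2 together yield the integrable majorant C / (1 + t ^+ 2),
    uniformly in s and x. *)
Lemma integrand_dominated k : exists2 C, 0 < C & forall s x t, 0 <= s -> 0 <= t ->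
  `|fourier_integrand s k x t| <= C * (oneDsqr t)^-1.
Proof.
have [C1 C10 h1] := abC k; have [C2 C20 h2] := abC k.+2.
exists (C1 + C2) => [|s x t s0 t0]; first by rewrite addr_gt0.
rewrite ler_pdivlMr ?(lt_le_trans ltr01) ?oneDsqr_ge1 //.
rewrite /fourier_integrand !normrM (ger0_norm (expR_ge0 _)) (ger0_norm (exprn_ge0 _ t0)).
apply: (@le_trans _ _ (t ^+ k * (`|a t| + `|b t|) * oneDsqr t)).
  apply: ler_wpM2r; first by rewrite (le_trans ler01) ?oneDsqr_ge1.
  apply: ler_pM => //; first by rewrite mulr_ge0 ?expR_ge0 ?exprn_ge0.
    by rewrite ler_piMl ?exprn_ge0 // expR_le1 oppr_le0 mulr_ge0.
  exact: wave_le.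
rewrite /oneDsqr mulrDr mulr1; apply: lerD; first exact: h1.
by rewrite mulrAC -exprD addn2; exact: h2.
Qed.

Lemma integrable_dominated (f : R -> R) (C : R) : measurable_fun setT f ->
  (forall t, 0 <= t -> `|f t| <= C * (oneDsqr t)^-1) -> mu.-integrable D (EFin \o f).
Proof.
move=> mf fC; apply: (@le_integrable _ _ _ mu D mD (EFin \o f)
    (EFin \o (fun t => C * (oneDsqr t)^-1))).
- exact/measurable_EFinP/measurable_funTS.
- move=> t; rewrite /D /= in_itv/= andbT => t0; rewrite lee_fin.
  by apply: le_trans (fC t t0) _; exact: ler_norm.
- exact: integrable_oneDsqrV.
Qed.

Lemma measurable_integrand s k x : measurable_fun setT (fourier_integrand s k x).
Proof.
apply: measurable_funM; last exact: measurable_wave.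
apply: measurable_funM; last exact: measurable_funX.
apply: continuous_measurable_fun => t.
apply: (@continuous_comp _ _ _ (fun t => - (s * t)) expR); last exact: continuous_expR.
by apply: cvgN; exact: mulrl_continuous.
Qed.

Lemma integrable_integrand s k x : 0 <= s ->
  mu.-integrable D (EFin \o fourier_integrand s k x).
Proof.
move=> s0; have [C C0 h] := integrand_dominated k.
apply: (@integrable_dominated _ C); first exact: measurable_integrand.
by move=> t t0; exact: h.
Qed.

Lemma is_derive_fourier s k x : 0 <= s ->
  is_derive x (1 : R) (fourier s k) (fourier s k.+1 x).
Proof.
move=> s0; have [C C0 h] := integrand_dominated k.+1.
apply: (@is_derive_Rintegral _ _ _ mu D (fourier_integrand s k)
   (fourier_integrand s k.+1) (fun t => C * (oneDsqr t)^-1)) => //.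
- by move=> y; exact: integrable_integrand.
- move=> y t Dt; rewrite /fourier_integrand /wave.
  have e : (k.+1%:R : R) * (pi / 2) = k%:R * (pi / 2) + pi / 2 by rewrite -natr1 mulrDl mul1r.
  rewrite e addrA cosDpihalf sinDpihalf.
  apply: is_derive_eq; rewrite /GRing.scale /= exprS; ring.
- by move=> t; rewrite mulr_ge0 ?ltW // invr_ge0 (le_trans ler01) ?oneDsqr_ge1.
- exact: integrable_oneDsqrV.
- by move=> y t; rewrite /D /= in_itv/= andbT => t0; exact: h.
Qed.

Lemma Rintegral_dominated (f : R -> R) (C : R) : measurable_fun setT f ->
  (forall t, 0 <= t -> `|f t| <= C * (oneDsqr t)^-1) ->
  `|\int[mu]_(t in D) f t| <= C * (pi / 2).
Proof.
move=> mf fC; have If := integrable_dominated mf fC.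
apply: le_trans (le_normr_Rintegral mD If) _.
have -> : C * (pi / 2) = \int[mu]_(t in D) (C * (oneDsqr t)^-1).
  rewrite RintegralZl //; last first.
    have := integrable_oneDsqrV 1; congr (_.-integrable _ _).
    by apply/funext => t /=; rewrite mul1r.
  by congr (_ * _); rewrite /Rintegral integral0y_oneDsqr.
apply: le_Rintegral => //.
- exact: (integrable_norm If).
- exact: integrable_oneDsqrV.
- by move=> t; rewrite /D /= in_itv/= andbT; exact: fC.
Qed.

Lemma fourier_bounded k : exists2 C, 0 < C & forall s x, 0 <= s -> `|fourier s k x| <= C.
Proof.
have [C C0 h] := integrand_dominated k.
exists (C * (pi / 2)) => [|s x s0]; first by rewrite mulr_gt0 // divr_gt0 ?pi_gt0.
apply: Rintegral_dominated; first exact: measurable_integrand.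
by move=> t t0; exact: h.
Qed.

(** Since 1 - expR (- (s * t)) <= s * t, the moments of orders 1 and 3 bound the error linearly in
    s. *)
Lemma fourier_cvg0 : exists2 C, 0 < C &
  forall s x, 0 <= s -> `|fourier s 0 x - fourier 0 0 x| <= s * C.
Proof.
have [C1 C10 h1] := abC 1; have [C3 C30 h3] := abC 3.
exists ((C1 + C3) * (pi / 2)) => [|s x s0].
  by rewrite mulr_gt0 ?addr_gt0 // divr_gt0 ?pi_gt0.
rewrite /fourier -RintegralB //; last 2 first.
- exact: integrable_integrand.
- exact: integrable_integrand.
rewrite mulrA; apply: Rintegral_dominated.
  by apply: measurable_funB; exact: measurable_integrand.
move=> t t0; rewrite ler_pdivlMr ?(lt_le_trans ltr01) ?oneDsqr_ge1 //.
rewrite /fourier_integrand mul0r oppr0 expR0 !expr0 !mulr1 -mulrBl normrM.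
have h : `|expR (- (s * t)) - 1| <= s * t.
  rewrite ler_norml; apply/andP; split.
    by have := expR_ge1Dx (- (s * t)); lra.
  have : 0 <= s * t by exact: mulr_ge0.
  have : expR (- (s * t)) <= 1 by rewrite expR_le1 oppr_le0 mulr_ge0.
  lra.
apply: (@le_trans _ _ (s * t * (`|a t| + `|b t|) * oneDsqr t)).
  apply: ler_wpM2r; first by rewrite (le_trans ler01) ?oneDsqr_ge1.
  by apply: ler_pM => //; exact: wave_le.
rewrite -!mulrA; apply: ler_wpM2l => //.
rewrite mulrA /oneDsqr mulrDr mulr1; apply: lerD; first by have := h1 t t0; rewrite expr1.
by rewrite mulrAC -exprS; exact: h3.
Qed.

End fourier_integral.

Section laplace_cos.
Context (R : realType).
Local Notation mu := (@lebesgue_measure R).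

Lemma laplace_1Dcos (s y : R) : 0 < s ->
  (\int[mu]_(t in `[0%R, +oo[) (expR (- (s * t)) * (1 + cos (t * y)))%:E =
   (s^-1 + s / (s ^+ 2 + y ^+ 2))%:E)%E.
Proof.
move=> s0; have q0 : 0 < s ^+ 2 + y ^+ 2 by rewrite ltr_pwDl ?sqr_ge0 // exprn_gt0.
(* The primitive that vanishes at infinity; its value at 0 is minus the integral. *)
pose F (t : R) := - (expR (- (s * t)) / s) +
  expR (- (s * t)) * ((y * sin (t * y) - s * cos (t * y)) / (s ^+ 2 + y ^+ 2)).
have dF t : is_derive t (1 : R) F (expR (- (s * t)) * (1 + cos (t * y))).
  rewrite /F; apply: is_derive_eq; rewrite /GRing.scale /=.
  by field; rewrite !gt_eqF.
have cF : continuous F.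
  move=> t; apply: differentiable_continuous; apply/derivable1_diffP.
  by case: (dF t).
have ce : continuous (fun t => expR (- (s * t)) * (1 + cos (t * y))).
  by move=> t; apply: differentiable_continuous; apply/derivable1_diffP; apply: ex_derive.
have Fy : F t @[t --> +oo%R] --> 0.
  pose K := s^-1 + (`|y| + s) / (s ^+ 2 + y ^+ 2).
  have ey : expR (- (s * t)) @[t --> +oo%R] --> 0.
    have st : s * t @[t --> +oo%R] --> +oo%R by exact: (gt0_cvgMry s0 cvg_id).
    exact: (cvg_comp _ _ st (@cvgr_expR R)).
  have eK : expR (- (s * t)) * K @[t --> +oo%R] --> 0.
    by rewrite -[0](mul0r K); apply: cvgMl.
  apply/norm_cvg0P; apply: (squeeze_cvgr _ (@cvg_cst _ 0 _ _ _) eK).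
  apply: nearW => t; rewrite normr_ge0 /= /F.
  have e0 := expR_ge0 (- (s * t)).
  rewrite (_ : - _ + _ = expR (- (s * t)) * (- s^-1 + (y * sin (t * y) - s * cos (t * y)) / (s ^+ 2 + y ^+ 2))); last by ring.
  rewrite normrM (ger0_norm e0) ler_wpM2l //.
  apply: le_trans (ler_normD _ _) _; rewrite normrN.
  rewrite gtr0_norm ?invr_gt0 // lerD2l normrM [X in _ * X]gtr0_norm ?invr_gt0 //.
  rewrite ler_pM2r ?invr_gt0 //; apply: le_trans (ler_normB _ _) _.
  rewrite !normrM (gtr0_norm s0); apply: lerD.
    by rewrite ler_piMr // sin_max.
  by rewrite ler_piMr ?cos_max // ltW.
rewrite (ge0_continuous_FTC2y _ _ Fy).
- rewrite /F mulr0 oppr0 expR0 mul0r sin0 cos0; congr (_%:E); field.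
  by rewrite !gt_eqF.
- move=> t _; rewrite mulr_ge0 ?expR_ge0 //; have := cos_geN1 (t * y); lra.
- exact: continuous_subspaceT.
- by move=> t _; case: (dF t).
- apply: cvg_at_right_filter; exact: cF.
- by move=> t _; rewrite derive1E; have h := dF t; rewrite derive_val.
Qed.

End laplace_cos.

(** * Inversion of the characteristic function *)

Section inversion.
Context (R : realType) d (T : measurableType d) (P : probability T R) (X : T -> R).
Local Notation mu := (@lebesgue_measure R).
Hypothesis mX : measurable_fun setT X.

Definition charc (t : R) := \int[P]_w cos (t * X w).
Definition chars (t : R) := \int[P]_w sin (t * X w).

Hypothesis decay : forall p, exists2 C : R, 0 < C & forall t : R, 0 < t ->
  `|charc t| <= C / t ^+ p /\ `|chars t| <= C / t ^+ p.

Let D : set (measurableTypeR R) := `[0, +oo[%classic.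
Let mD : measurable D. Proof. exact: measurable_itv. Qed.

Lemma continuous_derive (f df : R -> R) :
  (forall x : R, is_derive x (1 : R) f (df x)) -> continuous f.
Proof.
by move=> h x; apply: differentiable_continuous; apply/derivable1_diffP; case: (h x).
Qed.

Lemma continuous_cosM (t : R) : continuous (fun x => cos (t * x)).
Proof. by move=> x; apply: differentiable_continuous; apply/derivable1_diffP; apply: ex_derive. Qed.

Lemma continuous_sinM (t : R) : continuous (fun x => sin (t * x)).
Proof. by move=> x; apply: differentiable_continuous; apply/derivable1_diffP; apply: ex_derive. Qed.

Lemma integrable_cos t : P.-integrable setT (EFin \o (fun w => cos (t * X w))).
Proof. by apply: (@integrable_comp _ _ _ P X mX (fun x => cos (t * x)) 1); [exact: continuous_cosM|move=> x; exact: cos_max]. Qed.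

Lemma integrable_sin t : P.-integrable setT (EFin \o (fun w => sin (t * X w))).
Proof. by apply: (@integrable_comp _ _ _ P X mX (fun x => sin (t * x)) 1); [exact: continuous_sinM|move=> x; exact: sin_max]. Qed.

Lemma Rintegral_le (f : T -> R) (B : R) : P.-integrable setT (EFin \o f) ->
  (forall w, `|f w| <= B) -> `|\int[P]_w f w| <= B.
Proof.
move=> If fB; apply: le_trans (le_normr_Rintegral measurableT If) _.
have -> : B = \int[P]_(w in setT) B.
  rewrite Rintegral_cst // -[LHS]mulr1; congr (_ * _).
  rewrite -[LHS]/(fine 1%E); congr fine; apply/esym; exact: probability_setT.
apply: le_Rintegral => //.
- exact: (integrable_norm If).
- exact: finite_measure_integrable_cst.
Qed.

Lemma measurable_charc : measurable_fun setT charc.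
Proof.
apply: continuous_measurable_fun => t.
have It : `]t - 1, t + 1[%classic t by rewrite /= in_itv/= ltrBlDr ltrDl ltr01.
apply: (@continuity_under_integral _ _ _ P (fun t w => cos (t * X w)) setT measurableT (t - 1) (t + 1) _ _ (cst 1)).
- by move=> x _; exact: integrable_cos.
- apply: aeW => w _ x _; apply: differentiable_continuous; apply/derivable1_diffP; exact: ex_derive.
- exact: finite_measure_integrable_cst.
- by move=> x _; apply: aeW => w _; exact: cos_max.
- by rewrite inE.
Qed.

Lemma measurable_chars : measurable_fun setT chars.
Proof.
apply: continuous_measurable_fun => t.
have It : `]t - 1, t + 1[%classic t by rewrite /= in_itv/= ltrBlDr ltrDl ltr01.
apply: (@continuity_under_integral _ _ _ P (fun t w => sin (t * X w)) setT measurableT (t - 1) (t + 1) _ _ (cst 1)).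
- by move=> x _; exact: integrable_sin.
- apply: aeW => w _ x _; apply: differentiable_continuous; apply/derivable1_diffP; exact: ex_derive.
- exact: finite_measure_integrable_cst.
- by move=> x _; apply: aeW => w _; exact: sin_max.
- by rewrite inE.
Qed.

Lemma char_moments k : exists2 C : R, 0 < C &
  forall t, 0 <= t -> t ^+ k * (`|charc t| + `|chars t|) <= C.
Proof.
have [C C0 h] := decay k.
exists (2 + 2 * C) => [|t t0]; first by rewrite addr_gt0 // mulr_gt0.
have c1 : `|charc t| <= 1 by apply: Rintegral_le; [exact: integrable_cos|move=> w; exact: cos_max].
have s1 : `|chars t| <= 1 by apply: Rintegral_le; [exact: integrable_sin|move=> w; exact: sin_max].
have [t1|t1] := leP t 1.
  apply: (@le_trans _ _ (1 * (1 + 1))); last by lra.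
  by apply: ler_pM; rewrite ?exprn_ge0 ?addr_ge0 ?exprn_ile1 // lerD.
have tp : 0 < t by exact: lt_trans t1.
have [h1 h2] := h t tp.
apply: (@le_trans _ _ (t ^+ k * (C / t ^+ k + C / t ^+ k))).
  by apply: ler_wpM2l; [exact: exprn_ge0|exact: lerD].
have -> : t ^+ k * (C / t ^+ k + C / t ^+ k) = 2 * C.
  by field; rewrite expf_neq0 // gt_eqF.
by lra.
Qed.

Local Notation fou := (fourier charc chars).

Lemma wave0 x t : wave charc chars 0 x t = \int[P]_w cos (t * (x - X w)).
Proof.
rewrite /wave /charc /chars mul0r !addr0 -!RintegralZr //; last 2 first.
- exact: integrable_sin.
- exact: integrable_cos.
rewrite -RintegralD //; last 2 first.
- by apply: (@integrable_comp _ _ _ P X mX (fun y => cos (t * y) * cos (t * x)) 1);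
    [move=> y; apply: differentiable_continuous; apply/derivable1_diffP; apply: ex_derive|
     move=> y; rewrite normrM -[leRHS]mulr1 ler_pM ?cos_max].
- by apply: (@integrable_comp _ _ _ P X mX (fun y => sin (t * y) * sin (t * x)) 1);
    [move=> y; apply: differentiable_continuous; apply/derivable1_diffP; apply: ex_derive|
     move=> y; rewrite normrM -[leRHS]mulr1 ler_pM ?sin_max].
by apply: eq_Rintegral => w _; rewrite mulrBr cosB [cos (t * x) * _]mulrC [sin (t * x) * _]mulrC.
Qed.

Lemma integral_cD (c B : R) (h : R -> R) : continuous h -> (forall x, `|h x| <= B) ->
  (\int[P]_w (c + h (X w))%:E = (c + \int[P]_w h (X w))%:E)%E.
Proof.
move=> ch h1; have Ih := @integrable_comp _ _ _ P X mX _ _ ch h1.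
transitivity (\int[P]_w (c%:E + (h (X w))%:E))%E; first by apply: eq_integral.
rewrite integralD_EFin //; last exact: finite_measure_integrable_cst.
rewrite EFinD fineK; last exact: integrable_fin_num.
congr (_ + _)%E; transitivity (c%:E * P setT)%E; first exact: integral_cst.
by rewrite probability_setT mule1.
Qed.

Lemma integral_indic_mul (g : R -> R) :
  (\int[mu]_t (\1_D t * g t)%:E = \int[mu]_(t in D) (g t)%:E)%E.
Proof.
rewrite [RHS]integral_mkcond; apply: eq_integral => t _.
rewrite /patch indicE; case: (t \in D); first by rewrite mul1r.
by rewrite mul0r.
Qed.

Lemma integral_expN (s : R) : 0 < s ->
  (\int[mu]_(t in D) (expR (- (s * t)))%:E = (s^-1)%:E)%E.
Proof.
move=> s0; have h : (\int[mu]_(t in D) (expR (- (s * t)) * (1 + cos (t * 0)))%:E =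
    (s^-1 + s / (s ^+ 2 + 0 ^+ 2))%:E)%E := laplace_1Dcos 0 s0.
have me : measurable_fun D (fun t : R => (expR (- (s * t)) * (1 + cos (t * 0)))%:E).
  apply/measurable_EFinP; apply: measurable_funTS; apply: continuous_measurable_fun => t.
  apply: differentiable_continuous; apply/derivable1_diffP; exact: ex_derive.
transitivity (\int[mu]_(t in D) ((2^-1)%:E * (expR (- (s * t)) * (1 + cos (t * 0)))%:E))%E.
  apply: eq_integral => t _; rewrite mulr0 cos0 -EFinM; congr EFin; lra.
transitivity ((2^-1)%:E * (\int[mu]_(t in D) (expR (- (s * t)) * (1 + cos (t * 0)))%:E))%E.
  apply: ge0_integralZl_EFin => //.
rewrite h -EFinM expr0n addr0; congr EFin; field; exact: lt0r_neq0.
Qed.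

(* The summand 1 makes the integrand nonnegative, so that Tonelli applies. *)
Let joint (s x : R) (z : measurableTypeR R * T) : R :=
  \1_D z.1 * (expR (- (s * z.1)) * (1 + cos (z.1 * (x - X z.2)))).

(** Two evaluations of one double integral: over w first it gives the transform of X, over t first
    the Laplace transform of a cosine. The contribution s^-1 of the summand 1 cancels. *)
Lemma fourier_poisson (s x : R) : 0 < s ->
  fou s 0 x = \int[P]_w (s / (s ^+ 2 + (x - X w) ^+ 2)).
Proof.
move=> s0.
have mjoint : measurable_fun setT (EFin \o joint s x).
  apply/measurable_EFinP; apply: measurable_funM.
    apply: measurableT_comp => //; exact: measurable_fst.
  apply: measurable_funM.
    apply: measurableT_comp; first exact: measurable_expR.
    apply: measurableT_comp; first exact: oppr_measurable.
    by apply: measurable_funM => //; exact: measurable_fst.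
  apply: measurable_funD => //; apply: measurableT_comp.
    by apply: continuous_measurable_fun; exact: continuous_cos.
  apply: measurable_funM; first exact: measurable_fst.
  apply: measurable_funB => //; apply: measurableT_comp mX _; exact: measurable_snd.
have joint0 z : (0 <= (EFin \o joint s x) z)%E.
  rewrite /= lee_fin /joint !mulr_ge0 ?expR_ge0 //.
have := fubini_tonelli (m1 := mu) (m2 := P) (EFin \o joint s x) mjoint joint0.
have cx t : continuous (fun y => cos (t * (x - y))).
  by move=> y; apply: differentiable_continuous; apply/derivable1_diffP; apply: ex_derive.
have inner1 t : (\int[P]_w (EFin \o joint s x) (t, w) =
    (\1_D t * (expR (- (s * t)) * (1 + wave charc chars 0 x t)))%:E)%E.
  rewrite wave0 mulrA EFinM -(integral_cD 1 (cx t) (B := 1)); last by move=> y; exact: cos_max.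
  rewrite -integralZl //; last first.
    apply: (@integrable_comp _ _ _ P X mX (fun y => 1 + cos (t * (x - y))) 2).
      by move=> y; apply: cvgD; [exact: cvg_cst|exact: cx].
    by move=> y; apply: le_trans (ler_normD _ _) _; rewrite normr1 lerD2l cos_max.
  by apply: eq_integral => w _; rewrite /= /joint /= mulrA EFinM.
have inner2 w : (\int[mu]_t (EFin \o joint s x) (t, w) =
    (s^-1 + s / (s ^+ 2 + (x - X w) ^+ 2))%:E)%E.
  rewrite -laplace_1Dcos // -[`[0%R, +oo[%classic]/D -integral_indic_mul.
  by apply: eq_integral.
under eq_integral do rewrite inner1.
under [X in _ = X -> _]eq_integral do rewrite inner2.
have cq : continuous (fun y => s ^+ 2 + (x - y) ^+ 2).
  by move=> y; apply: differentiable_continuous; apply/derivable1_diffP; apply: ex_derive.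
have q0 y : 0 < s ^+ 2 + (x - y) ^+ 2 by rewrite ltr_pwDl ?sqr_ge0 // exprn_gt0.
rewrite integral_indic_mul (@integral_cD s^-1 s^-1 (fun y => s / (s ^+ 2 + (x - y) ^+ 2))); last 2 first.
- move=> y; apply: cvgM; first exact: cvg_cst.
  apply: (@cvgV _ _ _ _ (fun y => s ^+ 2 + (x - y) ^+ 2)); first by rewrite gt_eqF.
  exact: cq.
- move=> y; rewrite (ger0_norm (divr_ge0 (ltW s0) (ltW (q0 y)))) ler_pdivrMr // ler_pdivlMl //.
  by rewrite -expr2 lerDl sqr_ge0.
have -> : (\int[mu]_(t in D) (expR (- (s * t)) * (1 + wave charc chars 0 x t))%:E =
    (s^-1 + fou s 0 x)%:E)%E.
  have If := integrable_integrand measurable_charc measurable_chars char_moments 0 x (ltW s0).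
  have Ie : mu.-integrable D (EFin \o (fun t => expR (- (s * t)))).
    apply/integrableP; split.
      apply/measurable_EFinP; apply: measurable_funTS; apply: continuous_measurable_fun => t.
      apply: differentiable_continuous; apply/derivable1_diffP; exact: ex_derive.
    under eq_integral do rewrite /= ger0_norm ?expR_ge0 //.
    by rewrite integral_expN // ltry.
  transitivity (\int[mu]_(t in D) ((expR (- (s * t)))%:E +
      (fourier_integrand charc chars s 0 x t)%:E))%E.
    apply: eq_integral => t _.
    by rewrite -EFinD /fourier_integrand expr0 mulr1 mulrDr mulr1.
  rewrite EFinD -integral_expN // fineK; last exact: integrable_fin_num.
  exact: integralD_EFin.
by move=> h; apply: (addrI s^-1); exact: EFin_inj h.
Qed.

End inversion.

Lemma mean_value (R : realType) (f df : R -> R) :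
  (forall x : R, is_derive x (1 : R) f (df x)) ->
  forall x h : R, exists2 c, `|c - x| <= `|h| & f (x + h) - f x = h * df c.
Proof.
move=> fdf x h; have cf : continuous f.
  by move=> y; apply: differentiable_continuous; apply/derivable1_diffP; case: (fdf y).
have [h0|h0|->] := ltgtP h 0; last by exists x; rewrite ?subrr ?normr0 // addr0 subrr mul0r.
- have xh : x + h < x by rewrite gtrDl.
  have [|c cI e] := MVT xh (fun y _ => fdf y); first exact: continuous_subspaceT.
  exists c; last by rewrite -opprB e; ring.
  move: cI; rewrite in_itv/= => /andP[c1 c2]; rewrite (ltr0_norm h0) ler_norml.
  by apply/andP; split; lra.
- have xh : x < x + h by rewrite ltrDl.
  have [|c cI e] := MVT xh (fun y _ => fdf y); first exact: continuous_subspaceT.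
  exists c; last by rewrite e; ring.
  move: cI; rewrite in_itv/= => /andP[c1 c2]; rewrite (gtr0_norm h0) ler_norml.
  by apply/andP; split; lra.
Qed.

(** * Smoothed distribution functions and their limit *)

Section smoothed_cdf.
Context (R : realType) d (T : measurableType d) (P : probability T R) (X : T -> R).
Hypothesis mX : measurable_fun setT X.
Hypothesis decay : forall p, exists2 C : R, 0 < C & forall t : R, 0 < t ->
  `|charc P X t| <= C / t ^+ p /\ `|chars P X t| <= C / t ^+ p.

Local Notation fou := (fourier (charc P X) (chars P X)).
Let mc := measurable_charc P mX.
Let ms := measurable_chars P mX.
Let mom := char_moments mX decay.

Definition smoothed (s x : R) := \int[P]_w atan ((x - X w) / s).

Lemma integrable_atan (s x : R) :
  P.-integrable setT (EFin \o (fun w => atan ((x - X w) / s))).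
Proof.
apply: (@integrable_comp _ _ _ P X mX (fun y => atan ((x - y) / s)) (pi / 2)).
  by move=> y; apply: differentiable_continuous; apply/derivable1_diffP; apply: ex_derive.
by move=> y; rewrite ler_norml !ltW ?atan_ltpi2 ?atan_gtNpi2.
Qed.

Lemma is_derive_smoothed s x : 0 < s ->
  is_derive x (1 : R) (smoothed s) (fou s 0 x).
Proof.
move=> s0; rewrite (fourier_poisson mX decay) //.
have q0 y : 0 < s ^+ 2 + y ^+ 2 by rewrite ltr_pwDl ?sqr_ge0 // exprn_gt0.
apply: (@is_derive_Rintegral _ _ _ P setT (fun x w => atan ((x - X w) / s))
   (fun x w => s / (s ^+ 2 + (x - X w) ^+ 2)) (cst s^-1)) => //.
- by move=> y; exact: integrable_atan.
- move=> y w _; apply: is_derive_eq; rewrite /GRing.scale /=.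
  by field; rewrite !gt_eqF // (_ : _ + _ = s ^+ 2 + (y - X w) ^+ 2).
- by move=> w; rewrite /= invr_ge0 ltW.
- exact: finite_measure_integrable_cst.
- move=> y w _; rewrite (ger0_norm (divr_ge0 (ltW s0) (ltW (q0 _)))) ler_pdivrMr // ler_pdivlMl //.
  by rewrite -expr2 lerDl sqr_ge0.
Qed.

(* This is [pi * (F x - 1 / 2)], where [F] is the distribution function of [X]
   with the midpoint convention at atoms. *)
Definition signed_cdf (x : R) := \int[P]_w (pi / 2 * Num.sg (x - X w)).

Lemma measurable_sg (x : R) : measurable_fun setT (fun w => Num.sg (x - X w)).
Proof.
rewrite (_ : (fun w => _) = (fun w => \1_[set w | X w < x] w - \1_[set w | x < X w] w : R)).
  apply: measurable_funB; apply: measurable_indic.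
    rewrite (_ : mkset _ = X @^-1` `]-oo, x[%classic).
      by rewrite -[_ @^-1` _]setTI; apply: mX.
    by apply/seteqP; split=> w /=; rewrite in_itv.
  rewrite (_ : mkset _ = X @^-1` `]x, +oo[%classic).
    by rewrite -[_ @^-1` _]setTI; apply: mX.
  by apply/seteqP; split=> w /=; rewrite in_itv /= andbT.
apply/funext => w; rewrite !indicE.
have -> : (w \in [set w | X w < x]) = (X w < x) by apply/idP/idP; rewrite inE.
have -> : (w \in [set w | x < X w]) = (x < X w) by apply/idP/idP; rewrite inE.
case: (ltgtP (X w) x) => [xX|xX|->].
- by rewrite gtr0_sg ?subr_gt0 //= subr0.
- by rewrite ltr0_sg ?subr_lt0 //= sub0r.
- by rewrite subrr sgr0 /= subr0.
Qed.

Lemma integrable_sg x : P.-integrable setT (EFin \o (fun w => pi / 2 * Num.sg (x - X w))).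
Proof.
apply: (@le_integrable _ _ _ _ _ measurableT _ (cst (pi / 2)%:E)).
- by apply/measurable_EFinP; apply: measurable_funM => //; exact: measurable_sg.
- move=> w _; rewrite /= lee_fin normrM normr_sg.
  by case: (x - X w == 0); rewrite ?mulr0 ?mulr1.
- exact: finite_measure_integrable_cst.
Qed.

(** Where X w = x both the arctangent and the sign vanish, which forces the midpoint convention in
    [signed_cdf]. *)
Lemma smoothed_cvg x : smoothed n.+1%:R^-1 x @[n --> \oo] --> signed_cdf x.
Proof.
have pi2 : 0 < pi / 2 :> R by rewrite divr_gt0 // pi_gt0.
have [|||||_ _] := @dominated_convergence _ _ _ P setT measurableT
    (fun n w => (atan ((x - X w) / n.+1%:R^-1))%:E)
    (fun w => (pi / 2 * Num.sg (x - X w))%:E) (cst (pi / 2)%:E).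
- by move=> n; case/integrableP: (integrable_atan n.+1%:R^-1 x).
- by case/integrableP: (integrable_sg x).
- apply: aeW => w _; apply: cvg_EFin; first exact: nearW.
  have ny : n.+1%:R @[n --> \oo] --> (+oo%R : set_system R).
    apply/cvgryPge => A; near=> n; apply: (@le_trans _ _ n%:R); last by rewrite ler_nat.
    by near: n; exact: nbhs_infty_ger.
  have key y : 0 < y -> atan (y / n.+1%:R^-1) @[n --> \oo] --> (pi / 2 : R).
    move=> y0; have yn : y / n.+1%:R^-1 @[n --> \oo] --> (+oo%R : set_system R).
      move/cvgryPge : ny => ny; apply/cvgryPge => A.
      by apply: filterS (ny (A / y)) => n; rewrite invrK ler_pdivrMr // mulrC.
    exact: (cvg_comp _ _ yn (@cvgy_atan R)).
  have [xX|xX|->] := ltgtP (X w) x.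
  + by rewrite gtr0_sg ?subr_gt0 // mulr1; apply: key; rewrite subr_gt0.
  + rewrite ltr0_sg ?subr_lt0 // mulrN1.
    rewrite (_ : fine \o _ = (fun n => - atan ((X w - x) / n.+1%:R^-1))); last first.
      by apply/funext => n /=; rewrite -atanN -mulNr opprB.
    by apply: cvgN; apply: key; rewrite subr_gt0.
  + rewrite subrr sgr0 mulr0 (_ : fine \o _ = cst 0); first exact: cvg_cst.
    by apply/funext => n /=; rewrite mul0r atan0.
- exact: finite_measure_integrable_cst.
- by apply: aeW => w n _; rewrite /= lee_fin ler_norml !ltW ?atan_ltpi2 ?atan_gtNpi2.
have e : (\int[P]_w (pi / 2 * Num.sg (x - X w))%:E)%E = (signed_cdf x)%:E.
  rewrite fineK //; apply: integrable_fin_num => //; exact: integrable_sg.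
by rewrite e => /fine_cvg.
Unshelve. all: by end_near. Qed.

(** The mean value theorem at level s, then s tending to 0: [fourier_cvg0] is uniform in the
    intermediate point, and the limiting derivative is Lipschitz. The quadratic error yields both
    the absence of atoms and the derivative. *)
Lemma signed_cdf_taylor : exists2 B, 0 < B & forall x h,
  `|signed_cdf (x + h) - signed_cdf x - h * fou 0 0 x| <= B * h ^+ 2.
Proof.
have [B B0 hB] := fourier_bounded mc ms mom 1.
have [C C0 hC] := fourier_cvg0 mc ms mom.
exists B => // x h.
have lip c : `|c - x| <= `|h| -> `|fou 0 0 c - fou 0 0 x| <= B * `|h|.
  move=> cx; have [y _] := mean_value (fun y => is_derive_fourier mc ms mom 0 y (lexx 0)) x (c - x).
  rewrite [x + _]addrC subrK => ->; rewrite normrM mulrC.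
  by apply: ler_pM => //; exact: hB.
have step n : `|smoothed n.+1%:R^-1 (x + h) - smoothed n.+1%:R^-1 x - h * fou 0 0 x| <=
    B * h ^+ 2 + `|h| * C * n.+1%:R^-1.
  have s0 : 0 < n.+1%:R^-1 :> R by rewrite invr_gt0.
  have [c cx ->] := mean_value (fun y => is_derive_smoothed y s0) x h.
  rewrite -mulrBr normrM.
  apply: (@le_trans _ _ (`|h| * (n.+1%:R^-1 * C + B * `|h|))); last first.
    by rewrite -[h ^+ 2]real_normK ?num_real // le_eqVlt; apply/orP; left; apply/eqP; ring.
  apply: ler_wpM2l => //.
  rewrite (_ : _ - _ = (fou n.+1%:R^-1 0 c - fou 0 0 c) + (fou 0 0 c - fou 0 0 x)); last by ring.
  apply: le_trans (ler_normD _ _) _; apply: lerD; first by apply: hC; exact: ltW.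
  exact: lip.
have cl : `|smoothed n.+1%:R^-1 (x + h) - smoothed n.+1%:R^-1 x - h * fou 0 0 x| @[n --> \oo] -->
    `|signed_cdf (x + h) - signed_cdf x - h * fou 0 0 x|.
  apply: cvg_norm; apply: cvgB; last exact: cvg_cst.
  by apply: cvgB; exact: smoothed_cvg.
have cr : (B * h ^+ 2 + `|h| * C * n.+1%:R^-1) @[n --> \oo] --> B * h ^+ 2.
  rewrite -[X in _ --> X]addr0; apply: cvgD; first exact: cvg_cst.
  rewrite -(mulr0 (`|h| * C)); apply: cvgM; first exact: cvg_cst.
  exact: cvg_harmonic.
rewrite -(cvg_lim (@Rhausdorff R) cl) -(cvg_lim (@Rhausdorff R) cr).
apply: ler_lim; [by apply/cvg_ex; eexists; exact: cl|by apply/cvg_ex; eexists; exact: cr|].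
by apply: nearW => n; exact: step.
Qed.

End smoothed_cdf.

Lemma le0_small (R : realFieldType) (a K : R) :
  (forall h, 0 < h -> h <= 1 -> a <= h * K) -> a <= 0.
Proof.
move=> H; apply/ler_addgt0Pr => e e0; rewrite add0r.
pose K' := `|K| + 1; have K0 : 0 < K' by rewrite ltr_wpDl.
pose h := Num.min 1 (e / K').
have h0 : 0 < h by rewrite lt_min ltr01 divr_gt0.
apply: le_trans (H h h0 _) _; first by rewrite ge_min lexx.
apply: (@le_trans _ _ (h * K')).
  by rewrite ler_pM2l // /K' (le_trans (ler_norm K)) // lerDl.
by rewrite -ler_pdivlMr // /h ge_min lexx orbT.
Qed.

Lemma sgr_homo (R : realDomainType) : {homo @Num.sg R : a b / a <= b}.
Proof. by move=> a b ab; case: (sgrP a) => ha; case: (sgrP b) => hb; lra. Qed.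

Lemma is_derive_taylor (R : realType) (f : R -> R) (x df B : R) : 0 < B ->
  (forall h, `|f (x + h) - f x - h * df| <= B * h ^+ 2) ->
  is_derive x (1 : R) f df.
Proof.
move=> B0 H.
have cv : (fun h : R => h^-1 *: ((f \o shift x) (h *: (1 : R)) - f x)) @ 0^' --> df.
  apply/cvgrPdist_le => e e0; near=> h.
  have h0 : h != 0 by near: h; exact: nbhs_dnbhs_neq.
  rewrite /= [h%:A]mulr1 [h + x]addrC /GRing.scale /=.
  rewrite distrC (_ : _ - df = h^-1 * (f (x + h) - f x - h * df)); last by field.
  rewrite normrM normfV ler_pdivrMl ?normr_gt0 //.
  apply: le_trans (H h) _; rewrite -[h ^+ 2]real_normK ?num_real // expr2 mulrCA.
  rewrite ler_pM2l ?normr_gt0 // mulrC -ler_pdivlMr //.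
  near: h; apply: nbhs_dnbhs; apply/nbhs_normP; exists (e / B) => /=; first exact: divr_gt0.
  by move=> y; rewrite /= sub0r normrN => /ltW.
apply: DeriveDef; first by apply/cvg_ex; exists df.
exact: cvg_lim cv.
Unshelve. all: by end_near. Qed.

Section density_measure.
Context (R : realType) (f : R -> R).
Local Notation mu := (@lebesgue_measure R).

(** Nonnegativity and measurability are arguments so that the measure structure can be inferred from
    the term. *)
Definition density_measure of (forall x, 0 <= f x) & measurable_fun setT f :=
  fun A : set (measurableTypeR R) => (\int[mu]_(x in A) (f x)%:E)%E.

Hypotheses (f0 : forall x, 0 <= f x) (mf : measurable_fun setT f).

Let density0 : density_measure f0 mf set0 = 0%E.
Proof. exact: integral_set0. Qed.

Let density_ge0 A : (0 <= density_measure f0 mf A)%E.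
Proof. by apply: integral_ge0 => x _; rewrite lee_fin. Qed.

Let density_sigma_additive : semi_sigma_additive (density_measure f0 mf).
Proof.
move=> A mA tA mUA; rewrite /density_measure ge0_integral_bigcup //.
- by apply: is_cvg_ereal_nneg_natsum_cond => n _ _; exact: density_ge0.
- by apply/measurable_EFinP; exact: measurable_funTS.
- by move=> x _; rewrite lee_fin.
Qed.

HB.instance Definition _ := isMeasure.Build _ _ _
  (density_measure f0 mf) density0 density_ge0 density_sigma_additive.

End density_measure.

(** * The density of the limit *)

Section density.
Context (R : realType) d (T : measurableType d) (P : probability T R) (X : T -> R).
Hypothesis mX : measurable_fun setT X.
Hypothesis decay : forall p, exists2 C : R, 0 < C & forall t : R, 0 < t ->
  `|charc P X t| <= C / t ^+ p /\ `|chars P X t| <= C / t ^+ p.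

Local Notation fou := (fourier (charc P X) (chars P X)).
Local Notation G := (signed_cdf P X).
Local Notation mu := (@lebesgue_measure R).
Let mc := measurable_charc P mX.
Let ms := measurable_chars P mX.
Let mom := char_moments mX decay.

Let pi0 : 0 < pi :> R. Proof. exact: pi_gt0. Qed.

Definition pdf (x : R) := fou 0 0 x / pi.

Lemma measurable_X (A : set R) : measurable A -> measurable (X @^-1` A).
Proof. by move=> mA; rewrite -[_ @^-1` _]setTI; apply: mX. Qed.

Lemma Rintegral_indic (A : set T) : measurable A ->
  \int[P]_w \1_A w = fine (P A).
Proof. by move=> mA; rewrite /Rintegral integral_indic // setIT. Qed.

Lemma integrable_cindic (c : R) (A : set T) : measurable A ->
  P.-integrable setT (EFin \o (fun w => c * \1_A w)).
Proof.
move=> mA; apply: (@le_integrable _ _ _ _ _ measurableT _ (cst c%:E)).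
- by apply/measurable_EFinP; apply: measurable_funM => //; exact: measurable_indic.
- move=> w _; rewrite /= lee_fin normrM indicE.
  by case: (w \in A); rewrite /= ?normr1 ?normr0 ?mulr1 ?mulr0.
- exact: finite_measure_integrable_cst.
Qed.

Lemma Rintegral_cindic (c : R) (A : set T) : measurable A ->
  \int[P]_w (c * \1_A w) = c * fine (P A).
Proof.
move=> mA; rewrite RintegralZl // ?Rintegral_indic //.
have := integrable_cindic 1 mA; congr (_.-integrable _ _).
by apply/funext => w /=; rewrite mul1r.
Qed.

Lemma signed_cdfB x y :
  G y - G x = \int[P]_w (pi / 2 * Num.sg (y - X w) - pi / 2 * Num.sg (x - X w)).
Proof. by rewrite RintegralB //; exact: integrable_sg. Qed.

Lemma signed_cdf_lip : exists2 K, 0 < K & forall x h, 0 <= h -> h <= 2 ->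
  `|G (x + h) - G x| <= h * K.
Proof.
have [B B0 hB] := signed_cdf_taylor mX decay.
have [C C0 hC] := fourier_bounded mc ms mom 0.
exists (C + 2 * B) => [|x h h0 h2]; first by rewrite addr_gt0 // mulr_gt0.
have := hB x h; have := hC 0 x (lexx 0) => h3 h4.
rewrite (_ : _ - _ = (G (x + h) - G x - h * fou 0 0 x) + h * fou 0 0 x); last by ring.
apply: le_trans (ler_normD _ _) _; rewrite normrM (ger0_norm h0) mulrDr addrC.
apply: lerD; first by rewrite ler_wpM2l.
apply: le_trans h4 _; rewrite expr2 mulrC -mulrA ler_wpM2l // ler_wpM2r // ltW //.
Qed.

(** An atom at x would raise [signed_cdf] by at least pi times its mass over every interval from x -
    h to x + h, against the Lipschitz bound. *)
Lemma no_atom x : P [set w | X w = x] = 0%E.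
Proof.
have mA : measurable [set w | X w = x] by exact: (measurable_X (measurable_set1 x)).
have [K K0 hK] := signed_cdf_lip.
suff : pi * fine (P [set w | X w = x]) <= 0.
  rewrite pmulr_rle0 // => p0; rewrite -[LHS]fineK ?fin_num_measure //; congr EFin.
  by apply/eqP; rewrite eq_le p0 fine_ge0.
apply: (@le0_small _ _ (2 * K)) => h h0 h1.
rewrite -Rintegral_cindic //.
apply: (@le_trans _ _ (G (x - h + 2 * h) - G (x - h))); last first.
  apply: le_trans (ler_norm _) _; apply: le_trans (hK _ _ _ _) _; [by lra|by lra|].
  by rewrite mulrCA mulrA.
rewrite signed_cdfB; apply: le_Rintegral => //.
- exact: integrable_cindic.
- have := integrableB measurableT (integrable_sg P mX (x - h + 2 * h)) (integrable_sg P mX (x - h)).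
  by congr (_.-integrable _ _); apply/funext => w.
- move=> w _; rewrite indicE; case: (boolP (w \in _)) => [|_].
    rewrite inE /= => ->; rewrite gtr0_sg; last by lra.
    by rewrite ltr0_sg; lra.
  rewrite mulr0 -mulrBr mulr_ge0 ?divr_ge0 ?(ltW pi0) // subr_ge0.
  by apply: sgr_homo; lra.
Qed.

Lemma prob_ocitv x y : x < y -> P (X @^-1` `]x, y]%classic) = ((G y - G x) / pi)%:E.
Proof.
move=> xy; set I := X @^-1` _; have mI : measurable I by exact: measurable_X.
have mA z : measurable [set w | X w = z] by exact: (measurable_X (measurable_set1 z)).
rewrite -[LHS]fineK ?fin_num_measure //; congr EFin.
apply: (mulIf (lt0r_neq0 pi0)); rewrite divfK ?lt0r_neq0 // mulrC.
rewrite -Rintegral_cindic // signed_cdfB.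
(* The sign vanishes at an endpoint, which therefore counts by half; the two corrections are null by
   [no_atom]. *)
transitivity (\int[P]_w (pi * \1_I w +
   (pi / 2 * \1_[set w | X w = x] w + - (pi / 2) * \1_[set w | X w = y] w))).
  have I1 := integrable_cindic pi mI.
  have I2 := integrable_cindic (pi / 2) (mA x).
  have I3 := integrable_cindic (- (pi / 2)) (mA y).
  have I23 : P.-integrable setT (EFin \o (fun w => pi / 2 * \1_[set w | X w = x] w + - (pi / 2) * \1_[set w | X w = y] w)).
    have := integrableD measurableT I2 I3.
    by congr (_.-integrable _ _); apply/funext => w.
  rewrite RintegralD // RintegralD // (Rintegral_cindic _ (mA x)) (Rintegral_cindic _ (mA y)).
  by rewrite !no_atom !mulr0 !addr0.
apply: eq_Rintegral => w _; rewrite !indicE.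
have -> : (w \in I) = (x < X w <= y).
  by apply/idP/idP; rewrite inE /I /= in_itv.
have -> : (w \in [set w | X w = x]) = (X w == x) by apply/idP/eqP; rewrite inE.
have -> : (w \in [set w | X w = y]) = (X w == y) by apply/idP/eqP; rewrite inE.
case: (ltgtP (X w) x) => [xX|xX|e].
- have y1 : 0 < y - X w by lra.
  have x1 : 0 < x - X w by lra.
  by rewrite (lt_eqF (lt_trans xX xy)) (gtr0_sg y1) (gtr0_sg x1) /=; lra.
- have x1 : x - X w < 0 by lra.
  rewrite (ltr0_sg x1); case: (ltgtP (X w) y) => [Xy|Xy|e] /=.
  + have y1 : 0 < y - X w by lra.
    by rewrite (gtr0_sg y1); lra.
  + have y1 : y - X w < 0 by lra.
    by rewrite (ltr0_sg y1); lra.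
  + by rewrite e subrr sgr0; lra.
- have y1 : 0 < y - x by lra.
  by rewrite e (lt_eqF xy) subrr sgr0 (gtr0_sg y1) /=; lra.
Qed.

Lemma is_derive_signed_cdf x : is_derive x (1 : R) G (fou 0 0 x).
Proof.
have [B B0 hB] := signed_cdf_taylor mX decay.
by apply: (is_derive_taylor B0) => h; exact: hB.
Qed.

(** A Fourier integral has no evident sign; nonnegativity comes from the monotonicity of the
    distribution function. *)
Lemma pdf_ge0 x : 0 <= pdf x.
Proof.
have [B B0 hB] := signed_cdf_taylor mX decay.
apply: divr_ge0; last exact: ltW.
rewrite -oppr_le0; apply: (@le0_small _ _ B) => h h0 h1.
have Gx : 0 <= G (x + h) - G x.
  have : (0 <= P (X @^-1` `]x, (x + h)%R]%classic))%E by [].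
  by rewrite prob_ocitv ?ltrDl // lee_fin pmulr_lge0 // invr_gt0.
have := hB x h; rewrite ler_norml => /andP[_ h2].
rewrite -(ler_pM2l h0); lra.
Qed.

Lemma continuous_pdf : continuous pdf.
Proof.
move=> x; apply: cvgMl; apply: (continuous_derive (df := fou 0 1)).
by move=> y; exact: (is_derive_fourier mc ms mom).
Qed.

Let mpdf : measurable_fun setT pdf.
Proof. exact: continuous_measurable_fun continuous_pdf. Qed.

Lemma density_ocitv x y : x < y ->
  density_measure pdf_ge0 mpdf `]x, y]%classic = ((G y - G x) / pi)%:E.
Proof.
move=> xy; rewrite /density_measure.
have mp : measurable_fun (`]x, y]%classic : set (measurableTypeR R)) (EFin \o pdf).
  by apply/measurable_EFinP; exact: measurable_funTS.
rewrite (integral_itv_obnd_cbnd mp).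
have dG z : is_derive z (1 : R) (fun z => G z / pi) (pdf z).
  have h := is_derive_signed_cdf z.
  apply: is_derive_eq; rewrite /GRing.scale /= /pdf; ring.
have cG : continuous (fun z => G z / pi) by exact: continuous_derive dG.
rewrite (continuous_FTC2 (F := fun z => G z / pi)) //.
- by rewrite -EFinB; congr EFin; ring.
- by apply: continuous_subspaceT; exact: continuous_pdf.
- split.
  + by move=> z _; case: (dG z).
  + by apply: cvg_at_right_filter; exact: cG.
  + by apply: cvg_at_left_filter; exact: cG.
- by move=> z _; rewrite derive1E; have h := dG z; rewrite derive_val.
Qed.

Lemma prob_density (A : set R) : measurable A ->
  P (X @^-1` A) = (\int[mu]_(x in A) (pdf x)%:E)%E.
Proof.
move=> mA; pose g (k : nat) : set (measurableTypeR R) := `](- k%:R), k%:R]%classic.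
(* [X] is recast to the measurable type that carries the Lebesgue measure; the two laws are then
   compared on half-open intervals. *)
have mX' : @measurable_fun _ _ T (measurableTypeR R) setT X by exact: mX.
pose Xm : {mfun T >-> measurableTypeR R} := @mfun_Sub _ _ T (measurableTypeR R) X (mem_set mX').
apply: (@measure_unique _ R (measurableTypeR R) (@ocitv R) g erefl (@ocitvI R) _ _
  (distribution P Xm) (density_measure pdf_ge0 mpdf)) => //.
- by move=> i; exact: is_ocitv.
- apply/seteqP; split=> x // _; exists (Num.bound `|x|) => //.
  have := archi_boundP (normr_ge0 x); rewrite /g /= in_itv/= ltr_norml.
  by move=> /andP[-> /ltW].
- move=> _ [[x y] _ <-] /=; rewrite /distribution /pushforward.
  have [xy|yx] := ltP x y; first by rewrite density_ocitv // -prob_ocitv.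
  by rewrite set_itv_ge ?preimage_set0 ?measure0 // bnd_simp -leNgt.
- move=> k; apply: le_lt_trans (probability_le1 _ _) (ltry 1).
  by rewrite /g; exact: measurable_itv.
Qed.

End density.

(** * Rapid decay *)

Section rapid_decay.
Variable R : realType.
Implicit Types (g dg ddg : R -> R).

Definition rapid g := forall m, exists C : R, forall x, `|x| ^+ m * `|g x| <= C.

(* Increments are taken away from the origin, so that the limits of [g] at both
   infinities do not matter: a distribution function qualifies. *)
Definition rapid_increments g := forall m, exists C : R, forall x h, 0 <= h -> h <= 1 ->
  (0 <= x -> `|x| ^+ m * `|g (x + h) - g x| <= C) /\
  (x <= 0 -> `|x| ^+ m * `|g (x - h) - g x| <= C).

Lemma rapid_rapid_increments g : rapid g -> rapid_increments g.
Proof.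
move=> rg m; have [C hC] := rg m; exists (C + C) => x h h0 h1.
have key y : `|x| <= `|y| -> `|x| ^+ m * `|g y - g x| <= C + C.
  move=> xy; apply: (@le_trans _ _ (`|x| ^+ m * (`|g y| + `|g x|))).
    by apply: ler_wpM2l; [exact: exprn_ge0|exact: ler_normB].
  rewrite mulrDr; apply: lerD; last exact: hC.
  apply: le_trans (hC y); apply: ler_wpM2r => //.
  by rewrite lerXn2r // nnegrE.
split=> x0; apply: key.
  by rewrite !ger0_norm ?addr_ge0 // lerDl.
by rewrite !ler0_norm //; lra.
Qed.

(* Landau interpolation, with the increment [h = |x| ^- m]. *)
Lemma rapid_derive g dg ddg (B1 B2 : R) :
  (forall x : R, is_derive x (1 : R) g (dg x)) ->
  (forall x : R, is_derive x (1 : R) dg (ddg x)) ->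
  (forall x, `|dg x| <= B1) -> (forall x, `|ddg x| <= B2) ->
  rapid_increments g -> rapid dg.
Proof.
(* Dividing an increment by h = |x| ^- m costs |x| ^+ m, so order m for [dg] takes order 2m for [g];
   the error B2 * h is itself of order |x| ^- m. *)
move=> gd dgd hB1 hB2 rg m; have [C hC] := rg (m + m)%N.
have B20 : 0 <= B2 := le_trans (normr_ge0 _) (hB2 0).
have taylor x h : `|h| * `|dg x| <= `|g (x + h) - g x| + B2 * `|h| ^+ 2.
  have [c cx ->] := mean_value gd x h.
  have [e _] := mean_value dgd x (c - x).
  rewrite [x + _]addrC subrK => E.
  have -> : dg x = dg c - (c - x) * ddg e by rewrite -E; ring.
  rewrite -normrM mulrBr; apply: le_trans (ler_normB _ _) _.
  rewrite lerD2l !normrM (_ : B2 * _ = `|h| * (`|h| * B2)); last by ring.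
  by apply: ler_wpM2l => //; apply: ler_pM.
exists (B1 + `|C| + B2) => x; have B10 : 0 <= B1 := le_trans (normr_ge0 _) (hB1 x).
have [x1|x1] := ltP `|x| 1.
  apply: (@le_trans _ _ (1 * B1)).
    by apply: ler_pM; rewrite ?exprn_ge0 // exprn_ile1 // ltW.
  by rewrite mul1r -addrA lerDl addr_ge0.
pose y := `|x| ^+ m; have y1 : 1 <= y by exact: exprn_ege1.
have y0 : 0 < y := lt_le_trans ltr01 y1.
have yV0 : 0 <= y^-1 by rewrite invr_ge0 ltW.
have yV1 : y^-1 <= 1 by rewrite invf_le1.
have key (e : R) : `|e| = y^-1 -> `|x| ^+ (m + m) * `|g (x + e) - g x| <= C ->
    `|x| ^+ m * `|dg x| <= B1 + `|C| + B2.
  move=> he; rewrite exprD -/y => hg; have := taylor x e; rewrite he => ht.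
  have : y * y * (y^-1 * `|dg x|) <= y * y * (`|g (x + e) - g x| + B2 * y^-1 ^+ 2).
    by rewrite ler_pM2l // mulr_gt0.
  rewrite (_ : y * y * (y^-1 * _) = y * `|dg x|); last by field; rewrite gt_eqF.
  rewrite mulrDr (_ : y * y * (B2 * _) = B2); last by field; rewrite gt_eqF.
  by have := ler_norm C; lra.
have [h1 h2] := hC x y^-1 yV0 yV1.
have [x0|x0] := leP 0 x.
  by apply: (key y^-1); [rewrite ger0_norm|exact: h1].
by apply: (key (- y^-1)); [rewrite normrN ger0_norm|exact/h2/ltW].
Qed.

Lemma exprn_expRN_bounded (lam : R) m : 0 < lam ->
  exists C, forall x, 0 <= x -> x ^+ m * expR (- (lam * x)) <= C.
Proof.
move=> l0; exists (m`!%:R / lam ^+ m) => x x0.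
have lx : 0 <= lam * x by rewrite mulr_ge0 // ltW.
have fm0 : 0 < m`!%:R :> R by rewrite ltr0n fact_gt0.
rewrite expRN ler_pdivrMr ?expR_gt0 // mulrAC ler_pdivlMr ?exprn_gt0 //.
rewrite -exprMn [x * _]mulrC [leRHS]mulrC -ler_pdivrMr //.
case: m {fm0} => [|m]; first by rewrite fact0 expr0 divr1 -expR0 ler_expR.
by have := expR_ge1Dxn m lx; lra.
Qed.

End rapid_decay.

(** * The density is a Schwartz function *)

Section schwartz_density.
Context (R : realType) d (T : measurableType d) (P : probability T R) (X : T -> R).
Hypothesis mX : measurable_fun setT X.
Hypothesis decay : forall p, exists2 C : R, 0 < C & forall t : R, 0 < t ->
  `|charc P X t| <= C / t ^+ p /\ `|chars P X t| <= C / t ^+ p.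
Local Notation fou := (fourier (charc P X) (chars P X)).
Let mc := measurable_charc P mX.
Let ms := measurable_chars P mX.
Let mom := char_moments mX decay.

Lemma is_derive_div c (f df : R -> R) x : is_derive (x : R) (1 : R) f (df x) ->
   is_derive x (1 : R) (fun x => f x / c) (df x / c).
Proof.
move=> h; apply: is_derive_eq; rewrite /GRing.scale /=; ring.
Qed.

Lemma derive1n_pdf n : derive1n n (pdf P X) = (fun x => fou 0 n x / pi).
Proof.
elim: n => [//|n IH]; rewrite derive1nS IH; apply/funext => x.
have h := is_derive_div pi (is_derive_fourier mc ms mom n x (lexx 0)).
by rewrite derive1E derive_val.
Qed.

(** An increment away from the origin is the probability of an interval on which |X| >= |x|, so the
    exponential tail bounds it. *)
Lemma rapid_signed_cdf : (exists lam C : R, [/\ 0 < lam, 0 < C & forall x : R, 0 <= x ->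
    (P [set w | (x <= `|X w|)%R] <= (C * expR (- (lam * x)))%:E)%E]) ->
  rapid_increments (fun x => signed_cdf P X x / pi).
Proof.
move=> [lam [C [l0 C0 hP]]] m; have [K hK] := exprn_expRN_bounded m l0.
have mA x : measurable [set w | x <= `|X w|] by exact: measurable_norm_ge.
have incr u v y : u <= v -> 0 <= y -> (forall z, u < z -> z <= v -> y <= `|z|) ->
    y ^+ m * `|(signed_cdf P X v - signed_cdf P X u) / pi| <= C * K.
  rewrite le_eqVlt => /predU1P[<-|uv] y0 H.
    rewrite subrr mul0r normr0 mulr0 mulr_ge0 ?(ltW C0) //.
    by apply: le_trans (hK 0 (lexx 0)); rewrite mulr_ge0 ?exprn_ge0 ?expR_ge0.
  have pE := prob_ocitv mX decay uv.
  have p0 : 0 <= (signed_cdf P X v - signed_cdf P X u) / pi.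
    by rewrite -lee_fin -pE measure_ge0.
  have le1 : (signed_cdf P X v - signed_cdf P X u) / pi <= C * expR (- (lam * y)).
    rewrite -lee_fin -pE; apply: le_trans (hP y y0); apply: le_measure.
    - by rewrite inE; exact: measurable_X.
    - by rewrite inE; exact: mA.
    - by move=> w /=; rewrite in_itv /= => /andP[h1 h2]; exact: H.
  rewrite (ger0_norm p0); apply: (@le_trans _ _ (y ^+ m * (C * expR (- (lam * y))))).
    by rewrite ler_wpM2l // exprn_ge0.
  by rewrite mulrCA ler_pM2l //; exact: hK.
exists (C * K) => x h h0 h1; split=> x0; rewrite -mulrBl.
  apply: incr; rewrite ?normr_ge0 ?lerDl // => z xz _.
  by rewrite (ger0_norm x0) (le_trans (ltW xz)) // ler_norm.
rewrite -[`|_ / pi|]normrN -mulNr opprB; apply: incr; rewrite ?normr_ge0 ?gerBl // => z _ zx.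
by rewrite (ler0_norm x0) -normrN (le_trans _ (ler_norm _)) // lerN2.
Qed.

Lemma pdf_schwartz : (exists lam C : R, [/\ 0 < lam, 0 < C & forall x : R, 0 <= x ->
    (P [set w | (x <= `|X w|)%R] <= (C * expR (- (lam * x)))%:E)%E]) ->
  schwartz (pdf P X).
Proof.
move=> tail.
have pi0 : 0 < pi :> R by exact: pi_gt0.
have dfou n x : is_derive x (1 : R) (fun x => fou 0 n x / pi) (fou 0 n.+1 x / pi).
  exact: is_derive_div (is_derive_fourier mc ms mom n x (lexx 0)).
have bfou n : exists B : R, forall x, `|fou 0 n x / pi| <= B.
  have [B B0 hB] := fourier_bounded mc ms mom n.
  exists (B / pi) => x; rewrite normrM normfV (gtr0_norm pi0) ler_pM2r ?invr_gt0 //.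
  exact: hB.
have rfou n : rapid (fun x => fou 0 n x / pi).
  (* The density itself is interpolated between the distribution function and the bounded first
     derivative; each further derivative between its predecessor and its bounded successor. *)
  elim: n => [|n IH].
    have [B1 h1] := bfou 0; have [B2 h2] := bfou 1.
    apply: (rapid_derive _ (dfou 0) h1 h2 (rapid_signed_cdf tail)) => x.
    exact: is_derive_div (is_derive_signed_cdf mX decay x).
  have [B1 h1] := bfou n.+1; have [B2 h2] := bfou n.+2.
  exact: (rapid_derive (dfou n) (dfou n.+1) h1 h2 (rapid_rapid_increments IH)).
split=> [n x|n m]; rewrite derive1n_pdf; last exact: rfou.
by case: (dfou n x).
Qed.

End schwartz_density.

Theorem theorem2p8 (R : realType) (theta : R) (d : measure_display)
    (T : measurableType d) (P : probability T R)
    (par : nat -> T -> nat) (X : T -> R) :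
  0 < theta ->
  hoppe_choices theta P par ->
  measurable_fun setT X ->
  {ae P, forall w, (fun n : nat =>
      (((ipl (fun k => par k w) n)%:R - n%:R * ln n%:R) / n%:R) : R)
        @ \oo --> X w} ->
  exists f : R -> R,
    (forall A : set R, measurable A ->
       P (X @^-1` A) = (\int[lebesgue_measure]_(x in A) (f x)%:E)%E) /\
    schwartz f.
Proof.
move=> theta0 Hpar mX cvgX; have decay := char_decay theta0 Hpar mX cvgX.
exists (pdf P X); split; first exact: (prob_density mX decay).
by apply: (pdf_schwartz mX decay); exact: (tail_bound theta0 Hpar mX cvgX).
Qed.
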